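(* Let $\lambda,\mu\ge0$ be real numbers, not both zero, and let $R>0$. Suppose $\{\Omega_i\}_{i\in\mathbb{N}}$ is a cover of $\mathbb{R}^2$ by open squares with edges parallel to the coordinate axes and side-length $R$, such that each point of $\mathbb{R}^2$ belongs to at most $3$ of the $\Omega_i$. Then there exists $C$ such that $$\sum_{i=0}^\infty\|u\|^2_{X^{1/2}(\Omega_i)}\le C\|u\|^2_{X^{1/2}}\quad\text{for all }u\in X^{1/2}.$$
   Context: $D_x^{s}$ is the Fourier multiplier $|\xi|^{s}$ and $\partial_x^{-1}$ the multiplier $(i\xi)^{-1}$ in $x$. $X^{1/2}=\{f\in L^2(\mathbb{R}^2): D_x^{1/2}f,\ D_x^{-1/2}\partial_y f\in L^2\}$ with norm $\|f\|^2_{X^{1/2}}=\int_{\mathbb{R}^2} f^2+(D_x^{1/2}f)^2+\lambda(D_x^{-1/2}f_y)^2+\mu(\partial_x^{-1}f_y)^2$. For an open connected $\Omega$, $X^{1/2}(\Omega)=\{f\in L^2(\Omega): f=g|_\Omega,\ g\in X^{1/2}\}$ with norm $\|f\|_{X^{1/2}(\Omega)}=\inf\{\|g\|_{X^{1/2}}: g\in X^{1/2},\ g|_\Omega=f\}$. *)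

(* Defs.v *)
From HB Require Import structures.
From mathcomp Require Import all_boot all_order all_algebra.
From mathcomp Require Import all_classical all_reals all_analysis.
Set Implicit Arguments. Unset Strict Implicit. Unset Printing Implicit Defensive.
Import Order.TTheory GRing.Theory Num.Theory.
Import numFieldNormedType.Exports.
Local Open Scope classical_set_scope.
Local Open Scope ring_scope.

Section Defs.
Variable R : realType.

Definition leb2 := ((@lebesgue_measure R) \x (@lebesgue_measure R))%E.

Definition L2 (f : R * R -> R) : Prop :=
  measurable_fun setT f /\ (\int[leb2]_p ((f p) ^+ 2)%:E < +oo)%E.

(* Fourier transform of an integrable function, real and imaginary parts:
   fhat(xi,eta) = \int f(x,y) e^{-i(x xi + y eta)} dx dy *)
Definition FTre (f : R * R -> R) (k : R * R) : R :=
  Rintegral leb2 setT (fun p => f p * cos (p.1 * k.1 + p.2 * k.2)).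
Definition FTim (f : R * R -> R) (k : R * R) : R :=
  - Rintegral leb2 setT (fun p => f p * sin (p.1 * k.1 + p.2 * k.2)).

Definition trunc (f : R * R -> R) (n : nat) (p : R * R) : R :=
  if (`|p.1| <= n%:R) && (`|p.2| <= n%:R) then f p else 0.

(* (Fr, Fi) is the L^2 (Plancherel) Fourier transform of f : the L^2-limit of
   the Fourier transforms of the truncations of f. *)
Definition is_FT (f : R * R -> R) (Fr Fi : R * R -> R) : Prop :=
  [/\ measurable_fun setT Fr, measurable_fun setT Fi &
    (fun n : nat => \int[leb2]_k
        (((Fr k - FTre (trunc f n) k) ^+ 2
          + (Fi k - FTim (trunc f n) k) ^+ 2)%:E))%E @ \oo --> 0%E].

Definition FTsq (Fr Fi : R * R -> R) (k : R * R) : R := Fr k ^+ 2 + Fi k ^+ 2.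

(* Fourier symbol of the X^{1/2} norm:
   1 + |xi| + lambda eta^2/|xi| + mu eta^2/xi^2
   (values on the null set xi = 0 are irrelevant). *)
Definition Xweight (lam mu : R) (k : R * R) : R :=
  1 + `|k.1| + lam * (k.2 ^+ 2 / `|k.1|) + mu * (k.2 ^+ 2 / (k.1 ^+ 2)).

(* membership in X^{1/2}: f in L^2, D_x^{1/2} f in L^2, D_x^{-1/2} f_y in L^2 *)
Definition inX (f : R * R -> R) : Prop :=
  L2 f /\ exists Fr Fi, [/\ is_FT f Fr Fi,
    (\int[leb2]_k ((`|k.1| * FTsq Fr Fi k)%:E) < +oo)%E &
    (\int[leb2]_k ((k.2 ^+ 2 / `|k.1| * FTsq Fr Fi k)%:E) < +oo)%E].

(* squared X^{1/2} norm (extended real), computed by Plancherel: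
   (2 pi)^{-2} \int |fhat|^2 (1 + |xi| + lam eta^2/|xi| + mu eta^2/xi^2) *)
Definition Xnorm2 (lam mu : R) (f : R * R -> R) : \bar R :=
  ereal_inf [set x | exists Fr Fi, is_FT f Fr Fi /\
    x = (((2 * pi) ^- 2)%:E *
         \int[leb2]_k ((FTsq Fr Fi k * Xweight lam mu k)%:E))%E].

Definition XOmnorm2 (lam mu : R) (Om : set (R * R)) (f : R * R -> R) : \bar R :=
  ereal_inf [set Xnorm2 lam mu g | g in [set g | inX g /\ forall p, Om p -> g p = f p]].

Definition open_square (r : R) (Om : set (R * R)) : Prop :=
  exists a b : R, Om = [set p | a < p.1 < a + r /\ b < p.2 < b + r].

End Defs.

(* Main.v *)
(* Extending u from a square by a plain cut-off fails because the norm contains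
   |xi|^-1. Instead let Phi be the x-primitive of u with mean zero over a strip
   to the left of the square; for smooth cut-offs chi(x), theta(y) the function
     g = d/dx (chi theta Phi) = theta (chi u + chi' Phi)
   agrees with u on the square and |g^| = |xi| |(chi theta Phi)^|, so that the
   weights eta^2/|xi| and eta^2/xi^2 on g become eta^2 |xi| and eta^2 on
   chi theta Phi. All weights are then expressed, up to constants, by L^2 norms
   of finite differences (2 - 2 cos(t xi)) and of the primitives
   int_0^t u(x + s, y) ds ((2 - 2 cos(t xi)) / xi^2), integrated against dt/t^2
   and dt. In physical space these are local: g on the i-th square is controlled
   by u on an enlarged square, and enlarged squares overlap boundedly. Constants
   being irrelevant, instead of Plancherel's identity only a two-sided estimate
   for compactly supported functions is needed; it follows by damping the
   Fourier side with exp(-e|xi| - e|eta|), whose transform is an explicit kernel. *)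
Require Import Defs.
From HB Require Import structures.
From mathcomp Require Import all_boot all_order all_algebra.
From mathcomp Require Import all_classical all_reals all_analysis.
From mathcomp Require Import measurable_realfun ring lra.
Set Implicit Arguments. Unset Strict Implicit. Unset Printing Implicit Defensive.
Import Order.TTheory GRing.Theory Num.Theory.
Import numFieldNormedType.Exports.
Local Open Scope classical_set_scope.
Local Open Scope ring_scope.

(** Two one-sided passages meet. From [u] to physical space: the transform of [u] is only an L^2
    limit, so the lower Plancherel bound is applied to truncations and carried over to [u] by
    multipliers that are bounded and of finite range. From physical space to the extensions [g]:
    these have bounded support and the upper bound applies directly. One extension serves all four
    weights. Each weighted integral of the [g], summed over the squares, is at most a constant times
    the same weight of [u] plus the weight 1; the latter absorbs the terms in which a difference
    falls on a cut-off. No derivative in y is available. On |eta| <= 1 / h the factor eta^2 is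
    replaced by 2 h^-2 (2 - 2 cos(h eta)). Every physical term produced by a y-difference of step h
    is of order h^2, so the resulting bound is uniform in h, and frequency space is exhausted as h
    tends to 0. Locality limits differences to t <= r and primitives to length 6 r; cutting the
    integral for |xi| at r costs the term 1 / r. Primitives need every horizontal slice to be square
    integrable, while restriction to a square is pointwise equality: [u] is altered on a null set
    for the construction and restored on the square afterwards. *)

(** * Measurability *)

Lemma measurable_invr (R : realType) : measurable_fun [set: R] (@GRing.inv R).
Proof.
have -> : [set: R] = [set 0] `|` ~` [set 0] by rewrite setUv.
apply/measurable_funU => //; first exact: measurableC.
split; first exact: measurable_fun_set1.
apply: open_continuous_measurable_fun; first exact/closed_openC/closed_eq.
by move=> x; rewrite inE /= => /eqP x0; exact: inv_continuous.
Qed.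

Lemma measurable_sin (R : realType) : measurable_fun [set: R] (@sin R).
Proof. by apply: continuous_measurable_fun; exact: continuous_sin. Qed.

Lemma measurable_cos (R : realType) : measurable_fun [set: R] (@cos R).
Proof. by apply: continuous_measurable_fun; exact: continuous_cos. Qed.

Lemma measurable_fun_uncurry d d1 d2 d3 (T : measurableType d) (T1 : measurableType d1)
  (T2 : measurableType d2) (T3 : measurableType d3) (h : T1 -> T2 -> T3) (f : T -> T1) (g : T -> T2) :
  measurable_fun setT (fun z => h z.1 z.2) -> measurable_fun setT f ->
  measurable_fun setT g -> measurable_fun setT (fun x => h (f x) (g x)).
Proof.
by move=> mh mf mg; exact: (measurableT_comp mh (measurable_fun_pair mf mg)).
Qed.

Ltac mea_base := first [ assumption
  | exact: measurable_id | exact: measurable_cst | exact: measurable_fst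
  | exact: measurable_snd ].

Ltac mea :=
  cbv beta;
  lazymatch goal with
  | |- measurable_fun _ (fun _ => ?c) => exact: measurable_cst
  | |- measurable_fun _ (fun x => ((@?f x)%:E)) =>
      apply: (@measurableT_comp _ _ _ _ _ _ EFin _ f);
        [exact: EFin_measurable|mea]
  | |- measurable_fun _ (fun x => x) => exact: measurable_id
  | |- measurable_fun _ (fun x => (@?f x).1) =>
      apply: (@measurableT_comp _ _ _ _ _ _ fst _ f); [exact: measurable_fst|mea]
  | |- measurable_fun _ (fun x => (@?f x).2) =>
      apply: (@measurableT_comp _ _ _ _ _ _ snd _ f); [exact: measurable_snd|mea]
  | |- measurable_fun _ (fun x => `|@?f x|%R) =>
      apply: (measurableT_comp (g := f) (@normr_measurable _ setT)); mea
  | |- measurable_fun _ (fun x => sin (@?f x)) =>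
      apply: (@measurableT_comp _ _ _ _ _ _ sin _ f); [exact: measurable_sin|mea]
  | |- measurable_fun _ (fun x => cos (@?f x)) =>
      apply: (@measurableT_comp _ _ _ _ _ _ cos _ f); [exact: measurable_cos|mea]
  | |- measurable_fun _ (fun x => expR (@?f x)) =>
      apply: (@measurableT_comp _ _ _ _ _ _ expR _ f); [exact: measurable_expR|mea]
  | |- measurable_fun _ (fun x => (@?f x)^-1%R) =>
      apply: (measurableT_comp (g := f) (@measurable_invr _)); mea
  | |- measurable_fun _ (fun x => ((@?f x) + (@?g x))%R) =>
      apply: (@measurable_funD _ _ _ _ f g); mea
  | |- measurable_fun _ (fun x => ((@?f x) * (@?g x))%R) =>
      apply: (@measurable_funM _ _ _ _ f g); mea
  | |- measurable_fun _ (fun x => ((@?f x) ^+ ?n)%R) =>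
      apply: (@measurable_funX _ _ _ _ f n); mea
  | |- measurable_fun _ (fun x => (- (@?f x))%R) =>
      apply: (@measurable_funN _ _ _ _ f); mea
  | |- measurable_fun _ (fun x => Num.max (@?f x) (@?g x)) =>
      apply: (@measurable_maxr _ _ _ _ f g); mea
  | |- measurable_fun _ (fun x => Num.min (@?f x) (@?g x)) =>
      apply: (@measurable_minr _ _ _ _ f g); mea
  | |- measurable_fun _ (fun x => ((@?f x) + (@?g x))%E) =>
      apply: (@emeasurable_funD _ _ _ _ f g); mea
  | |- measurable_fun _ (fun x => ((@?f x) * (@?g x))%E) =>
      apply: (@emeasurable_funM _ _ _ _ f g); mea
  | |- measurable_fun _ (fun x => `|@?f x|%E) =>
      apply: (measurableT_comp (g := f) (@abse_measurable _ setT)); mea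
  | |- measurable_fun _ (fun x => if _ then _ else _) =>
      apply: measurable_fun_ifT; mea
  | |- measurable_fun _ (fun x => (@?f x) && (@?g x)) =>
      apply: (@measurable_and _ _ _ f g); mea
  | |- measurable_fun _ (fun x => ((@?f x) <= (@?g x))%R) =>
      apply: (@measurable_fun_ler _ _ _ _ f g); mea
  | |- measurable_fun _ (fun x => ((@?f x) < (@?g x))%R) =>
      apply: (@measurable_fun_ltr _ _ _ _ f g); mea
  | |- measurable_fun _ (fun x => (@?f x) == (@?g x)) =>
      apply: (@measurable_fun_eqr _ _ _ _ f g); mea
  | |- measurable_fun _ (fun x => (@?f x, @?g x)) =>
      apply: (@measurable_fun_pair _ _ _ _ _ _ f g); mea
  | |- measurable_fun _ (fun x => ?h (@?f x)) =>
      first [ mea_base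
        | apply: (@measurableT_comp _ _ _ _ _ _ h _ f); [mea_base|mea]
        | lazymatch goal with |- measurable_fun _ (fun x => ?k (@?a x) (@?b x)) =>
            apply: (@measurable_fun_uncurry _ _ _ _ _ _ _ _ k a b); [mea_base|mea|mea] end]
  | |- _ => mea_base
  end.

(** * Integration: parameters, Fubini, translation invariance *)

Section integral_tools.
Context d (T : measurableType d) (R : realType) (m : {measure set T -> \bar R}).
Implicit Types f g : T -> R.
Local Open Scope ereal_scope.

Lemma le_int f g : measurable_fun setT f -> measurable_fun setT g ->
  (forall x, 0 <= f x)%R -> (forall x, f x <= g x)%R ->
  \int[m]_x (f x)%:E <= \int[m]_x (g x)%:E.
Proof.
by move=> mf mg f0 fg; apply: ge0_le_integral => //; [move=> x _; rewrite lee_fin|mea|mea|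
  move=> x _; rewrite lee_fin].
Qed.

Lemma intD f g : measurable_fun setT f -> measurable_fun setT g ->
  (forall x, 0 <= f x)%R -> (forall x, 0 <= g x)%R ->
  \int[m]_x (f x + g x)%:E = \int[m]_x (f x)%:E + \int[m]_x (g x)%:E.
Proof.
move=> mf mg f0 g0; under eq_integral do rewrite EFinD.
by apply: ge0_integralD => //; [move=> x _; rewrite lee_fin|mea|move=> x _; rewrite lee_fin|mea].
Qed.

Lemma intZ c f : measurable_fun setT f -> (forall x, 0 <= f x)%R -> (0 <= c)%R ->
  \int[m]_x (c * f x)%:E = c%:E * \int[m]_x (f x)%:E.
Proof.
move=> mf f0 c0; under eq_integral do rewrite EFinM.
by rewrite ge0_integralZl//; [mea|move=> x _; rewrite lee_fin].
Qed.

Lemma int_ge0 f : (forall x, 0 <= f x)%R -> 0 <= \int[m]_x (f x)%:E.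
Proof. by move=> f0; apply: integral_ge0 => x _; rewrite lee_fin. Qed.

Lemma integrable_ltoo f : measurable_fun setT f ->
  \int[m]_x (`|f x|)%:E < +oo -> m.-integrable setT (EFin \o f).
Proof.
by move=> mf foo; apply/integrableP; split; first by rewrite /comp; mea.
Qed.

Lemma integrable_le f g : measurable_fun setT f -> (forall x, `|f x| <= g x)%R ->
  m.-integrable setT (EFin \o g) -> m.-integrable setT (EFin \o f).
Proof.
move=> mf fg; apply: le_integrable => //; first by rewrite /comp; mea.
by move=> x _ /=; rewrite lee_fin (le_trans (fg x))// ler_norm.
Qed.

Lemma Rint_EFin f : m.-integrable setT (EFin \o f) ->
  (\int[m]_x f x)%R%:E = \int[m]_x (f x)%:E.
Proof. by move=> mf; rewrite /Rintegral fineK//; exact: integrable_fin_num. Qed.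

End integral_tools.

Section integral_param.
Context d1 d2 (T1 : measurableType d1) (T2 : measurableType d2) (R : realType).
Variable m2 : {sigma_finite_measure set T2 -> \bar R}.
Local Open Scope ereal_scope.

Lemma measurable_integral_param (F : T1 -> T2 -> \bar R) :
  measurable_fun setT (fun z => F z.1 z.2) ->
  measurable_fun setT (fun x => \int[m2]_y F x y).
Proof.
move=> mF; rewrite (_ : (fun x => _) = fun x =>
  \int[m2]_y (fun z => F z.1 z.2)^\+ (x, y) -
  \int[m2]_y (fun z => F z.1 z.2)^\- (x, y)); last first.
  apply/funext => x; rewrite integralE; congr (_ - _).
  by apply: eq_integral => y _; rewrite !funeposE.
  by apply: eq_integral => y _; rewrite !funenegE.
apply: emeasurable_funB.
- apply: (measurable_fun_fubini_tonelli_F ((fun z => F z.1 z.2)^\+)) => //.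
  exact: measurable_funepos.
- apply: (measurable_fun_fubini_tonelli_F ((fun z => F z.1 z.2)^\-)) => //.
  exact: measurable_funeneg.
Qed.

Lemma measurable_Rintegral_param (F : T1 -> T2 -> R) :
  measurable_fun setT (fun z => F z.1 z.2) ->
  measurable_fun setT (fun x => \int[m2]_y F x y)%R.
Proof.
move=> mF; apply: (measurableT_comp (f := fine)); first exact: fine_measurable.
by apply: (@measurable_integral_param (fun x y => (F x y)%:E)); mea.
Qed.

End integral_param.

Section fubini_tools.
Context d1 d2 (T1 : measurableType d1) (T2 : measurableType d2) (R : realType).
Variables (m1 : {sigma_finite_measure set T1 -> \bar R})
  (m2 : {sigma_finite_measure set T2 -> \bar R}).
Local Open Scope ereal_scope.

Lemma tonelli (F : T1 -> T2 -> \bar R) :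
  measurable_fun setT (fun z => F z.1 z.2) -> (forall x y, 0 <= F x y) ->
  \int[m1]_x \int[m2]_y F x y = \int[m2]_y \int[m1]_x F x y.
Proof.
by move=> mF F0; rewrite (sfinite_Fubini m1 m2 (fun z => F z.1 z.2)).
Qed.

(** A real integral is [fine] of the extended one, and an inner integral may be infinite on a null
    set; real and extended iterated integrals are therefore compared almost everywhere before the
    extended Fubini theorem is used. *)
Lemma Rfubini (F : T1 -> T2 -> R) :
  (m1 \x m2).-integrable setT (fun z => (F z.1 z.2)%:E) ->
  (\int[m1]_x \int[m2]_y F x y = \int[m2]_y \int[m1]_x F x y)%R.
Proof.
move=> iF; have mF := measurable_int _ iF.
have mF' : measurable_fun setT (fun z => F z.1 z.2) by apply/measurable_EFinP.
rewrite /Rintegral; congr fine.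
transitivity (\int[m1]_x \int[m2]_y (F x y)%:E).
  apply: ae_eq_integral => //.
  - by apply/measurable_EFinP/measurable_Rintegral_param.
  - exact: measurable_integral_param.
  apply: filterS (ae_integrable1 iF) => x ix _; rewrite fineK//.
  exact: integrable_fin_num.
transitivity (\int[m2]_y \int[m1]_x (F x y)%:E); first exact: (Fubini iF).
have mF21 : measurable_fun setT (fun z : T2 * T1 => F z.2 z.1).
  exact: (measurableT_comp mF' (@measurable_swap _ _ T2 T1)).
apply: ae_eq_integral => //.
- exact: (measurable_fubini_G iF).
- by apply/measurable_EFinP/(@measurable_Rintegral_param _ _ _ _ _ _ (fun y x => F x y)).
apply: filterS (ae_integrable2 iF) => y iy _; rewrite fineK//.
exact: integrable_fin_num.
Qed.

Lemma integrable_prod (F : T1 -> T2 -> R) (a : T1 -> R) (b : T2 -> R) :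
  measurable_fun setT (fun z => F z.1 z.2) ->
  m1.-integrable setT (EFin \o a) -> m2.-integrable setT (EFin \o b) ->
  (forall x y, `|F x y| <= a x * b y)%R ->
  (m1 \x m2).-integrable setT (fun z => (F z.1 z.2)%:E).
Proof.
move=> mF ia ib Fab.
have ma : measurable_fun setT a by exact/measurable_EFinP/(measurable_int _ ia).
have mb : measurable_fun setT b by exact/measurable_EFinP/(measurable_int _ ib).
apply/(integrable12ltyP m1 m2); first by mea.
apply: (@le_lt_trans _ _ (\int[m1]_x (`|a x|%:E * \int[m2]_y `|b y|%:E))).
  apply: ge0_le_integral => //.
  - by move=> x _; exact: integral_ge0.
  - by apply: (@measurable_integral_param _ _ _ _ _ _ (fun x y => `|(F x y)%:E|)); mea.
  - by apply: emeasurable_funM; mea.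
  - move=> x _; rewrite -ge0_integralZl//; last by mea.
    apply: ge0_le_integral => //; [|by mea|move=> y _].
      by have := measurableT_comp mF (pair1_measurable x); move=> ?; mea.
    rewrite /= lee_fin (le_trans (Fab _ _))// -normrM ler_norm//.
have /integrableP[_ ia'] := ia; have /integrableP[_ ib'] := ib.
have [r rE] : exists r, \int[m2]_y `|b y|%:E = r%:E.
  exists (fine (\int[m2]_y `|b y|%:E)); rewrite fineK//.
  by rewrite ge0_fin_numE// integral_ge0.
rewrite rE ge0_integralZr//; [|by mea|by rewrite -rE integral_ge0].
by rewrite muleC lte_mul_pinfty// -rE integral_ge0.
Qed.

End fubini_tools.

Section measure_preserving.
Context d (T : measurableType d) (R : realType) (m : {measure set T -> \bar R}).
Local Open Scope ereal_scope.

Lemma int_preserving_ge0 (phi : T -> T) (f : T -> \bar R) :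
  (forall g : T -> \bar R, measurable_fun setT g -> (forall x, 0 <= g x) ->
    \int[m]_x g (phi x) = \int[m]_x g x) ->
  measurable_fun setT f -> \int[m]_x f (phi x) = \int[m]_x f x.
Proof.
move=> ge0 mf; rewrite integralE [RHS]integralE; congr (_ - _).
- rewrite -[RHS](ge0 (f^\+))//; last exact: measurable_funepos.
  by apply: eq_integral => x _; rewrite !funeposE.
- rewrite -[RHS](ge0 (f^\-))//; last exact: measurable_funeneg.
  by apply: eq_integral => x _; rewrite !funenegE.
Qed.

Lemma int_preserving (phi : T -> T) (f : T -> \bar R) :
  measurable_fun setT phi ->
  (forall A, measurable A -> pushforward m phi A = m A) ->
  measurable_fun setT f ->
  \int[m]_x f (phi x) = \int[m]_x f x.
Proof.
move=> mphi pm; apply: int_preserving_ge0 => g mg g0.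
rewrite -[LHS](@ge0_integral_pushforward _ _ _ _ _ _ mphi m setT)//.
by apply: eq_measure_integral => A mA _; exact: pm.
Qed.

End measure_preserving.

(* The library leaves products of sigma-finite measures without a usable
   canonical sigma-finite structure. *)
Lemma leb2_sigma_finite (R : realType) : sigma_finite setT (@leb2 R).
Proof.
exists (fun n => `[- n%:R, n%:R]%classic `*` `[- n%:R, n%:R]%classic).
  rewrite predeqE => -[x y]; split=> // _.
  have [n xn] : exists n : nat, `|x| <= n%:R.
    by exists (Num.truncn `|x|).+1; rewrite ltW// truncnS_gt.
  have [k yk] : exists n : nat, `|y| <= n%:R.
    by exists (Num.truncn `|y|).+1; rewrite ltW// truncnS_gt.
  exists (maxn n k) => //; split => /=; rewrite in_itv/= -ler_norml.
    by rewrite (le_trans xn)// ler_nat leq_maxl.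
  by rewrite (le_trans yk)// ler_nat leq_maxr.
move=> k; split; first exact: measurableX.
rewrite /leb2 product_measure1E//= !lebesgue_measure_itv/=.
by case: ifP => _; rewrite ?mule0 ?ltry// -EFinD -EFinM ltry.
Qed.

HB.instance Definition _ (R : realType) := Measure.on (@leb2 R).
HB.instance Definition _ (R : realType) :=
  Measure_isSigmaFinite.Build _ _ _ (@leb2 R) (leb2_sigma_finite R).

Section translation.
Variable R : realType.
Local Notation mu := (@lebesgue_measure R).
Local Notation leb2 := (@leb2 R).
Local Open Scope ereal_scope.

Lemma lebesgue_measure_shift (a : R) (A : set R) : measurable A ->
  pushforward mu (fun x : measurableTypeR R => (x + a)%R : measurableTypeR R) A = mu A.
Proof.
move=> mA; apply/esym/lebesgue_measure_unique => //=.
  by mea.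
move=> _ _ [[u v]] _ <-; rewrite /pushforward /=.
rewrite [X in _ = mu X](_ : _ = `]u - a, v - a]%classic)%R; last first.
  by apply/seteqP; split => x /=; rewrite !in_itv/= ltrBlDr lerBrDr.
rewrite !lebesgue_measure_itv/= !lte_fin ltrD2r.
by case: ifP => // _; rewrite -!EFinD; congr EFin; ring.
Qed.

Lemma int_shift (a : R) (f : R -> \bar R) : measurable_fun setT f ->
  \int[mu]_x f (x + a)%R = \int[mu]_x f x.
Proof.
by move=> mf; apply: (@int_preserving _ _ _ mu (fun x => x + a)%R) => //;
  [mea|exact: lebesgue_measure_shift].
Qed.

Lemma int_opp (f : R -> \bar R) : measurable_fun setT f ->
  \int[mu]_x f (- x)%R = \int[mu]_x f x.
Proof.
by move=> mf; apply: (@int_preserving _ _ _ mu (fun x => - x)%R) => //;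
  [mea|exact: lebesgue_measureN].
Qed.

Lemma measurable_param_mu d (T : measurableType d) (F : T -> R -> \bar R) :
  measurable_fun setT (fun z => F z.1 z.2) ->
  measurable_fun setT (fun x => \int[mu]_y F x y).
Proof. exact: (@measurable_integral_param _ _ T (measurableTypeR R) R mu). Qed.

Lemma measurable_param_leb2 d (T : measurableType d) (F : T -> R * R -> \bar R) :
  measurable_fun setT (fun z => F z.1 z.2) ->
  measurable_fun setT (fun x => \int[leb2]_y F x y).
Proof.
exact: (@measurable_integral_param _ _ T
  (measurableTypeR R * measurableTypeR R)%type R leb2).
Qed.

Lemma measurable_Rparam_mu d (T : measurableType d) (F : T -> R -> R) :
  measurable_fun setT (fun z => F z.1 z.2) ->
  measurable_fun setT (fun x => \int[mu]_y F x y)%R.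
Proof. exact: (@measurable_Rintegral_param _ _ T (measurableTypeR R) R mu). Qed.

Lemma measurable_Rparam_leb2 d (T : measurableType d) (F : T -> R * R -> R) :
  measurable_fun setT (fun z => F z.1 z.2) ->
  measurable_fun setT (fun x => \int[leb2]_y F x y)%R.
Proof.
exact: (@measurable_Rintegral_param _ _ T
  (measurableTypeR R * measurableTypeR R)%type R leb2).
Qed.

Lemma leb2_tonelli (f : R * R -> \bar R) : measurable_fun setT f ->
  (forall p, 0 <= f p) -> \int[leb2]_p f p = \int[mu]_x \int[mu]_y f (x, y).
Proof.
move=> mf f0.
exact: (@fubini_tonelli1 _ _ (measurableTypeR R) (measurableTypeR R) R mu mu f).
Qed.

Lemma leb2_tonelli2 (f : R * R -> \bar R) : measurable_fun setT f ->
  (forall p, 0 <= f p) -> \int[leb2]_p f p = \int[mu]_y \int[mu]_x f (x, y).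
Proof.
move=> mf f0.
exact: (@fubini_tonelli2 _ _ (measurableTypeR R) (measurableTypeR R) R mu mu f).
Qed.

Lemma int2_shift (a b : R) (f : R * R -> \bar R) : measurable_fun setT f ->
  \int[leb2]_p f (p.1 + a, p.2 + b)%R = \int[leb2]_p f p.
Proof.
apply: (@int_preserving_ge0 _ _ _ leb2 (fun p : R * R => (p.1 + a, p.2 + b)%R)).
suff H (g : R * R -> \bar R) : measurable_fun setT g -> (forall p, 0 <= g p) ->
    \int[leb2]_p g (p.1 + a, p.2 + b)%R = \int[leb2]_p g p by exact: H.
move=> mg g0; rewrite leb2_tonelli; [|by mea|by move=> p; exact: g0].
rewrite (leb2_tonelli mg g0).
pose G (x : R) := \int[mu]_y g (x, y).
have mG : measurable_fun setT G.
  by apply: (measurable_param_mu (F := fun x y => g (x, y))); mea.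
rewrite -[RHS](int_shift a (f := G) mG).
apply: eq_integral => x _; apply: (@int_shift b (fun y => g (x + a, y)%R)).
by mea.
Qed.

End translation.

Section cauchy_schwarz.
Context d (T : measurableType d) (R : realType) (m : {measure set T -> \bar R}).
Local Open Scope ereal_scope.

(** Cauchy-Schwarz against the constant 1, from the nonnegative integral of (f - I / c)^2 with [I]
    the integral of [f]. Expanding it needs [f] integrable, which follows from |f| <= 1 + f^2 on a
    set of finite measure; if f^2 has infinite integral the claim is trivial. *)
Lemma sqr_Rintegral_le (D : set T) (c : R) (f : T -> R) :
  measurable D -> measurable_fun setT f -> (0 < c)%R -> m D = c%:E ->
  ((\int[m]_(x in D) f x)%R ^+ 2)%:E <= c%:E * \int[m]_(x in D) (f x ^+ 2)%:E.
Proof.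
move=> mD mf c0 mDc; have mfD := measurable_funS measurableT (@subsetT _ D) mf.
have [foo|foo] := eqVneq (\int[m]_(x in D) (f x ^+ 2)%:E) +oo.
  by rewrite foo gt0_muley// leey.
have f2oo : \int[m]_(x in D) (f x ^+ 2)%:E < +oo by rewrite ltey.
have icst k : m.-integrable D (EFin \o cst k).
  apply/integrableP; split; first exact/measurable_EFinP.
  by under eq_integral do rewrite /=; rewrite integral_cst// mDc ltry.
have if2 : m.-integrable D (EFin \o (fun x => f x ^+ 2)%R).
  apply/integrableP; split; first by apply/measurable_EFinP/measurable_funX.
  by under eq_integral do rewrite /= ger0_norm ?sqr_ge0//.
have if1 : m.-integrable D (EFin \o f).
  apply: (@le_integrable _ _ _ m D mD _ (EFin \o (fun x => 1 + f x ^+ 2)%R)).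
  - exact/measurable_EFinP.
  - move=> x _; rewrite /= lee_fin.
    rewrite (ger0_norm (_ : 0 <= 1 + f x ^+ 2)%R); last by rewrite addr_ge0// sqr_ge0.
    by rewrite ler_norml; apply/andP; split; nra.
  - exact: (integrableD mD (icst 1%R) if2).
set I := (\int[m]_(x in D) f x)%R.
pose Q := (\int[m]_(x in D) (f x ^+ 2))%R.
have -> : \int[m]_(x in D) (f x ^+ 2)%:E = Q%:E.
  by rewrite /Q /Rintegral fineK// ge0_fin_numE// integral_ge0// => x _; rewrite lee_fin sqr_ge0.
have : (0 <= \int[m]_(x in D) (f x ^+ 2 - (2 * (I / c)) * f x + (I / c) ^+ 2))%R.
  by apply: Rintegral_ge0 => x _; have := sqr_ge0 (f x - I / c); nra.
have iZ : m.-integrable D (EFin \o (fun x => (2 * (I / c)) * f x)%R).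
  exact: (integrableZl mD (2 * (I / c))%R if1).
rewrite RintegralD//; [|exact: (integrableB mD if2 iZ)|exact: icst].
rewrite RintegralB//.
rewrite RintegralZl// Rintegral_cst// mDc /= -/I -/Q -EFinM lee_fin.
have -> : (Q - 2 * (I / c) * I + (I / c) ^+ 2 * c = Q - I ^+ 2 / c)%R by field; rewrite gt_eqF.
by rewrite subr_ge0 ler_pdivrMr// mulrC.
Qed.

End cauchy_schwarz.

(** * Plancherel estimates *)

Section poisson_kernel.
Variable R : realType.
Local Notation mu := (@lebesgue_measure R).

Let sqD_gt0 (e a : R) : 0 < e -> 0 < e ^+ 2 + a ^+ 2.
Proof. by move=> e0; rewrite ltr_wpDr ?sqr_ge0// exprn_gt0. Qed.

(* The Fourier transform of [exp (- e |x|)]. *)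
Definition poisson (e a : R) : R := 2 * e / (e ^+ 2 + a ^+ 2).

(** An antiderivative of exp(-e x) (1 + cos(a x)). The added 1 keeps the integrand nonnegative, as
    the improper fundamental theorem requires; it is removed later by comparison with the case a =
    0, where the integrand is twice the exponential. *)
Let F (e a : R) (x : R) : R := - (e^-1 * expR (- (e * x))) +
  (e ^+ 2 + a ^+ 2)^-1 * (expR (- (e * x)) * (a * sin (a * x) - e * cos (a * x))).

Let dF (e a x : R) : 0 < e ->
  is_derive x 1 (F e a) (expR (- (e * x)) * (1 + cos (a * x))).
Proof.
move=> e0; rewrite /F; apply: is_derive_eq.
rewrite /GRing.scale /=; field.
by rewrite !gt_eqF ?sqD_gt0.
Qed.

Lemma cvg_expRNM (e : R) : 0 < e -> expR (- (e * x)) @[x --> +oo] --> (0 : R).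
Proof.
move=> e0; have H : (e * x) @[x --> +oo] --> +oo.
  by apply: gt0_cvgMry => //; exact: cvg_id.
exact: (cvg_comp _ _ H (@cvgr_expR R)).
Qed.

Let cvgF (e a : R) : 0 < e -> F e a x @[x --> +oo] --> (0 : R).
Proof.
move=> e0; apply/cvgr0Pnorm_le => /= d d0.
pose M := e^-1 + (e ^+ 2 + a ^+ 2)^-1 * (`|a| + e).
have s0 : 0 < e ^+ 2 + a ^+ 2 by exact: sqD_gt0.
have M0 : 0 < M.
  by rewrite ltr_pwDl ?invr_gt0// mulr_ge0 ?invr_ge0 ?(ltW s0)// addr_ge0// ltW.
have dM : 0 < d / M by rewrite divr_gt0.
have /cvgr0Pnorm_le /(_ _ dM) := cvg_expRNM e0.
apply: filterS => x; rewrite ger0_norm ?expR_ge0// ler_pdivlMr// => xM.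
apply: le_trans xM; rewrite /F (le_trans (ler_normD _ _))// normrN !normrM.
rewrite (ger0_norm (expR_ge0 _)) [`|e^-1|]gtr0_norm ?invr_gt0//.
rewrite [`|(_ + _)^-1|]gtr0_norm ?invr_gt0//.
have : `|a * sin (a * x) - e * cos (a * x)| <= `|a| + e.
  rewrite (le_trans (ler_normB _ _))// !normrM (gtr0_norm e0).
  have := sin_max (a * x); have := cos_max (a * x); have := normr_ge0 a.
  by nra.
move=> H; rewrite /M mulrDr [e^-1 * _]mulrC lerD2l mulrCA ler_wpM2l ?expR_ge0//.
by rewrite ler_wpM2l ?invr_ge0 ?(ltW s0).
Qed.

Let int_half (e a : R) : 0 < e ->
  (\int[mu]_(x in `[0%R, +oo[) (expR (- (e * x)) * (1 + cos (a * x)))%:E =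
   (e^-1 + e / (e ^+ 2 + a ^+ 2))%:E)%E.
Proof.
move=> e0; rewrite (@ge0_continuous_FTC2y _ _ (F e a) 0 0).
- rewrite -EFinB /F !mulr0 oppr0 expR0 sin0 cos0; congr EFin; field.
  by rewrite !gt_eqF ?sqD_gt0.
- by move=> x _; rewrite mulr_ge0 ?expR_ge0//; have := cos_geN1 (a * x); lra.
- apply: continuous_subspaceT => x.
  apply: cvgM; first by apply: continuous_comp; [apply: cvgN; apply: cvgM; [exact: cvg_cst|exact: cvg_id]|exact: continuous_expR].
  apply: cvgD; first exact: cvg_cst.
  by apply: continuous_comp; [apply: cvgM; [exact: cvg_cst|exact: cvg_id]|exact: continuous_cos].
- exact: cvgF.
- by move=> x _; have [] := dF a x e0.
- apply: cvg_at_right_filter.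
  by have /@ex_derive /derivable1_diffP /differentiable_continuous := dF a 0 e0.
- by move=> x _; rewrite derive1E; have [_ ->] := dF a x e0.
Qed.

Lemma int_even (f : R -> R) : measurable_fun setT f -> (forall x, 0 <= f x) ->
  (forall x, f (- x) = f x) ->
  (\int[mu]_x (f x)%:E = 2%:E * \int[mu]_(x in `[0%R, +oo[) (f x)%:E)%E.
Proof.
move=> mf f0 fe.
have -> : [set: R] = `]-oo, 0%R[%classic `|` `[0%R, +oo[%classic.
  apply/seteqP; split => x //= _; rewrite !in_itv/= andbT.
  by case: (ltP x 0) => _; [left|right].
rewrite ge0_integral_setU//=; last 3 first.
- by apply: measurable_funTS; mea.
- by move=> x _; rewrite lee_fin.
- rewrite disj_set2E; apply/eqP; rewrite -subset0 => x []/=.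
  by rewrite !in_itv/= andbT; case: ltP.
rewrite integral_itv_bndo_bndc; last by apply: measurable_funTS; mea.
rewrite (_ : (\int[mu]_(x in `]-oo, 0%R]) (f x)%:E =
  \int[mu]_(x in `[0%R, +oo[) (f x)%:E)%E); last first.
  rewrite (ge0_integration_by_substitution0 (f := fun x => (f x)%:E)).
  - by apply: eq_integral => x _; rewrite fe.
  - by mea.
  - by move=> x; rewrite lee_fin.
by rewrite -[2]/(1 + 1)%R EFinD ge0_muleDl ?lee_fin ?ler01// mul1e.
Qed.

Lemma int_expR_cos (e a : R) : 0 < e ->
  (\int[mu]_x (expR (- (e * `|x|)) * (1 + cos (a * x)))%:E =
   (2 / e + poisson e a)%:E)%E.
Proof.
move=> e0; rewrite int_even.
- rewrite (_ : (\int[mu]_(x in `[0%R, +oo[) _ =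
    \int[mu]_(x in `[0%R, +oo[) (expR (- (e * x)) * (1 + cos (a * x)))%:E)%E); last first.
    apply: eq_integral => x; rewrite inE/= in_itv/= andbT => x0.
    by rewrite (ger0_norm x0).
  by rewrite int_half// -EFinM /poisson; congr EFin; field;
    rewrite !gt_eqF ?sqD_gt0.
- by mea.
- by move=> x; rewrite mulr_ge0 ?expR_ge0//; have := cos_geN1 (a * x); lra.
- by move=> x; rewrite normrN mulrN cosN.
Qed.

Lemma integrable_expR (e : R) : 0 < e ->
  mu.-integrable setT (EFin \o (fun x => expR (- (e * `|x|)))).
Proof.
move=> e0.
apply: (@integrable_le _ _ _ mu _ (fun x => expR (- (e * `|x|)) * (1 + cos (0 * x)))).
- by mea.
- by move=> x; rewrite mul0r cos0 ger0_norm ?expR_ge0// ler_peMr ?expR_ge0// lerDl.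
- apply: integrable_ltoo; first by mea.
  under eq_integral => x _.
    rewrite ger0_norm; last by rewrite mulr_ge0 ?expR_ge0// mul0r cos0; lra.
    over.
  by rewrite int_expR_cos// ltry.
Qed.

Lemma integrable_expRM (e : R) (g : R -> R) : 0 < e -> measurable_fun setT g ->
  (forall x, `|g x| <= 1) ->
  mu.-integrable setT (EFin \o (fun x => expR (- (e * `|x|)) * g x)).
Proof.
move=> e0 mg g1; apply: integrable_le (integrable_expR e0); first by mea.
by move=> x; rewrite normrM ger0_norm ?expR_ge0// ler_piMr ?expR_ge0.
Qed.

Lemma Rint_expR_cos (e a : R) : 0 < e ->
  \int[mu]_x (expR (- (e * `|x|)) * cos (a * x)) = poisson e a.
Proof.
move=> e0.
have H b : 2 / e + poisson e b = \int[mu]_x expR (- (e * `|x|)) +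
    \int[mu]_x (expR (- (e * `|x|)) * cos (b * x)).
  rewrite -RintegralD//; last 2 first.
  - exact: integrable_expR.
  - by apply: integrable_expRM => //; [mea|move=> x; exact: cos_max].
  rewrite /Rintegral (_ : 2 / e + poisson e b = fine (2 / e + poisson e b)%:E)//.
  rewrite -int_expR_cos//; congr fine; apply: eq_integral => x _; congr EFin; ring.
have := H 0; rewrite (_ : \int[mu]_x (expR (- (e * `|x|)) * cos (0 * x)) =
  \int[mu]_x expR (- (e * `|x|))); last first.
  by apply: eq_Rintegral => x _; rewrite mul0r cos0 mulr1.
have -> : 2 / e + poisson e 0 = 4 / e by rewrite /poisson; field; rewrite gt_eqF.
move: (H a) => {H}; set I0 := Rintegral _ _ _; set I1 := Rintegral _ _ _.
by move: I0 I1 => I0 I1; lra.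
Qed.

Lemma Rint_expR_sin (e a : R) : 0 < e ->
  \int[mu]_x (expR (- (e * `|x|)) * sin (a * x)) = 0.
Proof.
move=> e0; set I := (X in X = 0).
suff : I = - I by lra.
have iI : mu.-integrable setT (EFin \o (fun x => expR (- (e * `|x|)) * sin (a * x))).
  by apply: integrable_expRM => //; [mea|move=> x; exact: sin_max].
rewrite {1}/I -[RHS]mulN1r -RintegralZl//.
rewrite /Rintegral -[in RHS]int_opp; last by mea.
by congr fine; apply: eq_integral => x _; rewrite normrN mulrN sinN; congr EFin; ring.
Qed.

Lemma poisson_ge0 e a : 0 < e -> 0 <= poisson e a.
Proof.
move=> e0; rewrite /poisson divr_ge0//; first by rewrite mulr_ge0// ltW.
by rewrite addr_ge0 ?sqr_ge0.
Qed.

Lemma measurable_poisson e : measurable_fun setT (poisson e).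
Proof. by rewrite /poisson; mea. Qed.

Lemma poisson_tail e a d : 0 < e -> 0 < d -> d <= `|a| -> poisson e a <= 2 * e / d ^+ 2.
Proof.
move=> e0 d0 da; rewrite /poisson ler_pM2l ?mulr_gt0// lef_pV2 ?posrE.
- have : d ^+ 2 <= a ^+ 2 by rewrite -(real_normK (num_real a)) lerXn2r// nnegrE ltW.
  by have := sqr_ge0 e; lra.
- exact: sqD_gt0.
- by rewrite exprn_gt0.
Qed.

(** Points of a box of half-side n have coordinate differences at most 2 n, so a function supported
    there sees only this part of the kernel. Its mass is an explicit arctangent. *)
Definition poisson_cut (N e a : R) : R := if `|a| <= N then poisson e a else 0.

Lemma int_poisson_cut (N e : R) : 0 < N -> 0 < e ->
  (\int[mu]_a (poisson_cut N e a)%:E = (4 * atan (N / e))%:E)%E.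
Proof.
move=> N0 e0; rewrite int_even; last first.
- by move=> a; rewrite /poisson_cut /poisson normrN sqrrN.
- by move=> a; rewrite /poisson_cut; case: ifP => // _; exact: poisson_ge0.
- rewrite /poisson_cut; have := measurable_poisson e => ?.
  by apply: measurable_fun_ifT; [mea|by []|mea].
pose G (x : R) := 2 * atan (x / e).
have dG (x : R) : is_derive x 1 G (poisson e x).
  rewrite /G; apply: is_derive_eq; rewrite /GRing.scale /= /poisson; field.
  by rewrite !gt_eqF ?sqD_gt0// addrC sqD_gt0.
have -> : (4 * atan (N / e) = 2 * (G N - G 0))%R.
  by rewrite /G mul0r atan0; ring.
rewrite [RHS]EFinM; congr (_ * _)%E; rewrite [RHS]EFinB.
rewrite -(@continuous_FTC2 _ (poisson e) G 0 N)//.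
- rewrite integral_mkcond [RHS]integral_mkcond; apply: eq_integral => a _.
  rewrite /patch !mem_setE !in_itv/= andbT /poisson_cut.
  by case: (leP 0 a) => //= a0; rewrite ger0_norm//; case: ifP.
- apply: continuous_subspaceT => x.
  apply: cvgM; first exact: cvg_cst.
  apply: cvgV; first by rewrite gt_eqF ?sqD_gt0.
  by apply: cvgD; [exact: cvg_cst|exact: exprn_continuous].
- have cG (x : R) : {for x, continuous G}.
    by have /@ex_derive /derivable1_diffP /differentiable_continuous := dG x.
  split; first by move=> x _; have [] := dG x.
    exact/cvg_at_right_filter/cG.
  exact/cvg_at_left_filter/cG.
- by move=> x _; rewrite derive1E; have [_ ->] := dG x.
Qed.
End poisson_kernel.

Section fubini_tools2.
Context d1 d2 (T1 : measurableType d1) (T2 : measurableType d2) (R : realType).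
Variables (m1 : {sigma_finite_measure set T1 -> \bar R})
  (m2 : {sigma_finite_measure set T2 -> \bar R}).

Lemma Rintegral_prod (F : T1 -> T2 -> R) :
  (m1 \x m2)%E.-integrable setT (fun z => (F z.1 z.2)%:E) ->
  \int[(m1 \x m2)%E]_z F z.1 z.2 = \int[m1]_x \int[m2]_y F x y.
Proof.
move=> iF.
have mF' : measurable_fun setT (fun z => F z.1 z.2).
  by apply/measurable_EFinP; exact: (measurable_int _ iF).
rewrite /Rintegral; congr fine; rewrite -integral12_prod_meas1//.
apply: ae_eq_integral => //.
- exact: (measurable_fubini_F iF).
- by apply/measurable_EFinP/measurable_Rintegral_param.
apply: filterS (ae_integrable1 iF) => x ix _; rewrite fineK//.
exact: integrable_fin_num.
Qed.

End fubini_tools2.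

(** * The damped Fourier integral *)

Section fourier.
Variable R : realType.
Local Notation mu := (@lebesgue_measure R).
Local Notation leb2 := (@leb2 R).

Implicit Types (f : R * R -> R) (k p : R * R).

Definition N2 (f : R * R -> R) : \bar R := (\int[leb2]_p (f p ^+ 2)%:E)%E.

Definition FTsin (f : R * R -> R) (k : R * R) : R :=
  \int[leb2]_p (f p * sin (p.1 * k.1 + p.2 * k.2)).

Definition ft2 (f : R * R -> R) : R * R -> R := FTsq (FTre f) (FTim f).

Lemma ft2E f k : ft2 f k = FTre f k ^+ 2 + FTsin f k ^+ 2.
Proof. by rewrite /ft2 /FTsq /FTim sqrrN. Qed.

Lemma ft2_ge0 f k : 0 <= ft2 f k.
Proof. by rewrite /ft2 /FTsq addr_ge0 ?sqr_ge0. Qed.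

Lemma measurable_FTre f : measurable_fun setT f -> measurable_fun setT (FTre f).
Proof.
move=> mf; apply: (measurable_Rparam_leb2
  (F := fun k p => f p * cos (p.1 * k.1 + p.2 * k.2))).
by mea.
Qed.

Lemma measurable_FTsin f : measurable_fun setT f -> measurable_fun setT (FTsin f).
Proof.
move=> mf; apply: (measurable_Rparam_leb2
  (F := fun k p => f p * sin (p.1 * k.1 + p.2 * k.2))).
by mea.
Qed.

Lemma measurable_FTim f : measurable_fun setT f -> measurable_fun setT (FTim f).
Proof. by move=> mf; apply: measurable_funN; exact: measurable_FTsin. Qed.

Lemma measurable_ft2 f : measurable_fun setT f -> measurable_fun setT (ft2 f).
Proof.
move=> mf; rewrite /ft2 /FTsq.
by have := measurable_FTre mf; have := measurable_FTim mf => ? ?; mea.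
Qed.

Lemma integrable_FT (f h : R * R -> R) : leb2.-integrable setT (EFin \o f) ->
  measurable_fun setT h -> (forall p, `|h p| <= 1) ->
  leb2.-integrable setT (EFin \o (fun p => f p * h p)).
Proof.
move=> fi mh h1; have mf : measurable_fun setT f.
  by apply/measurable_EFinP; exact: (measurable_int _ fi).
apply: (@integrable_le _ _ _ leb2 _ (fun p => `|f p|)).
- by mea.
- by move=> p; rewrite normrM ler_piMr.
- exact: (integrable_norm fi).
Qed.

Lemma integrable_cos f k : leb2.-integrable setT (EFin \o f) ->
  leb2.-integrable setT (EFin \o (fun p => f p * cos (p.1 * k.1 + p.2 * k.2))).
Proof.
by move=> fi; apply: integrable_FT => //; [mea|move=> p; exact: cos_max].
Qed.

Lemma integrable_sin f k : leb2.-integrable setT (EFin \o f) ->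
  leb2.-integrable setT (EFin \o (fun p => f p * sin (p.1 * k.1 + p.2 * k.2))).
Proof.
by move=> fi; apply: integrable_FT => //; [mea|move=> p; exact: sin_max].
Qed.

Lemma FT_lin f k (a b : R) : leb2.-integrable setT (EFin \o f) ->
  a * FTre f k + b * FTsin f k =
  \int[leb2]_p (f p * (a * cos (p.1 * k.1 + p.2 * k.2) +
                       b * sin (p.1 * k.1 + p.2 * k.2))).
Proof.
move=> fi; have ic := integrable_cos k fi; have is_ := integrable_sin k fi.
rewrite -!RintegralZl// -RintegralD//.
- by apply: eq_Rintegral => p _; ring.
- exact: (integrableZl measurableT _ ic).
- exact: (integrableZl measurableT _ is_).
Qed.

Definition damp (e : R) (k : R * R) : R :=
  expR (- (e * `|k.1|)) * expR (- (e * `|k.2|)).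

Lemma damp_ge0 e k : 0 <= damp e k.
Proof. by rewrite mulr_ge0 ?expR_ge0. Qed.

Lemma damp_le1 e k : 0 < e -> damp e k <= 1.
Proof.
move=> e0; rewrite mulr_ile1 ?expR_ge0// -expR0 ler_expR oppr_le0 mulr_ge0// ltW//.
Qed.

Lemma measurable_damp e : measurable_fun setT (damp e).
Proof. by rewrite /damp; mea. Qed.

Lemma integrable_damp e : 0 < e -> leb2.-integrable setT (EFin \o damp e).
Proof.
move=> e0.
apply: (@integrable_prod _ _ (measurableTypeR R) (measurableTypeR R) R mu mu
  (fun x y => damp e (x, y)) (fun x => expR (- (e * `|x|)))
  (fun x => expR (- (e * `|x|)))).
- by rewrite /damp; mea.
- exact: integrable_expR.
- exact: integrable_expR.
- by move=> x y; rewrite ger0_norm// damp_ge0.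
Qed.

Lemma Rint_damp_cos (e a b : R) : 0 < e ->
  \int[leb2]_k (damp e k * cos (a * k.1 + b * k.2)) = poisson e a * poisson e b.
Proof.
move=> e0; rewrite /leb2.
have iF : leb2.-integrable setT (EFin \o (fun k => damp e k * cos (a * k.1 + b * k.2))).
  by apply: integrable_FT; [exact: integrable_damp|mea|move=> p; exact: cos_max].
rewrite (@Rintegral_prod _ _ (measurableTypeR R) (measurableTypeR R) R mu mu
  (fun x y => damp e (x, y) * cos (a * x + b * y)))//.
have H x : \int[mu]_y (damp e (x, y) * cos (a * x + b * y)) =
    expR (- (e * `|x|)) * cos (a * x) * poisson e b.
  (* The sine part of cos(a x + b y) contributes a multiple of the vanishing sine integral; it is
     added so that both integrals can be merged by linearity. *)
  rewrite -[RHS]subr0 -[X in _ = _ - X](mulr0 (expR (- (e * `|x|)) * sin (a * x))).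
  rewrite -(Rint_expR_sin b e0) -(Rint_expR_cos b e0).
  have icos : mu.-integrable setT (EFin \o (fun x => expR (- (e * `|x|)) * cos (b * x))).
    by apply: integrable_expRM => //; [mea|move=> z; exact: cos_max].
  have isin : mu.-integrable setT (EFin \o (fun x => expR (- (e * `|x|)) * sin (b * x))).
    by apply: integrable_expRM => //; [mea|move=> z; exact: sin_max].
  rewrite -!RintegralZl// -RintegralB//.
  - apply: eq_Rintegral => y _; rewrite /damp /= cosD; ring.
  - exact: (integrableZl measurableT _ icos).
  - exact: (integrableZl measurableT _ isin).
under eq_Rintegral do rewrite H.
rewrite RintegralZr// ?Rint_expR_cos//.
by apply: integrable_expRM => //; [mea|move=> z; exact: cos_max].
Qed.

Lemma norm_FT_le f (h : R * R -> R) : leb2.-integrable setT (EFin \o f) ->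
  measurable_fun setT h -> (forall p, `|h p| <= 1) ->
  `|\int[leb2]_p (f p * h p)| <= \int[leb2]_p `|f p|.
Proof.
move=> fi mh h1; have ifh := integrable_FT fi mh h1.
apply: le_trans (le_normr_Rintegral _ ifh) _ => //.
apply: le_Rintegral => //.
- exact: (integrable_norm ifh).
- exact: (integrable_norm fi).
- by move=> p _; rewrite normrM ler_piMr.
Qed.

(** Both parts of the transform are bounded by the L^1 norm of [f] and the damping is integrable, so
    all exchanges are absolutely convergent. The two factors of |f^|^2 are opened one at a time,
    each followed by Fubini; the remaining integral in [k] of cos((p - q).k) is the product of
    Poisson kernels. *)
Lemma Rint_damp_ft2 (e : R) (f : R * R -> R) : 0 < e ->
  leb2.-integrable setT (EFin \o f) ->
  \int[leb2]_k (damp e k * ft2 f k) =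
  \int[leb2]_p \int[leb2]_q
    (f p * f q * (poisson e (p.1 - q.1) * poisson e (p.2 - q.2))).
Proof.
move=> e0 fi.
have mf : measurable_fun setT f.
  by apply/measurable_EFinP; exact: (measurable_int _ fi).
have nfi := integrable_norm fi.
have mC := measurable_FTre mf; have mS := measurable_FTsin mf.
pose A := \int[leb2]_p `|f p|.
have CA k : `|FTre f k| <= A.
  by apply: norm_FT_le => //; [mea|move=> p; exact: cos_max].
have SA k : `|FTsin f k| <= A.
  by apply: norm_FT_le => //; [mea|move=> p; exact: sin_max].
have mw := measurable_damp e.
have iw := integrable_damp e0.
transitivity (\int[leb2]_k \int[leb2]_p (damp e k * f p *
    (FTre f k * cos (p.1 * k.1 + p.2 * k.2) +
     FTsin f k * sin (p.1 * k.1 + p.2 * k.2)))).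
  apply: eq_Rintegral => k _.
  rewrite [LHS](_ : _ = (damp e k * FTre f k) * FTre f k +
      (damp e k * FTsin f k) * FTsin f k); last by rewrite ft2E; ring.
  by rewrite FT_lin//; apply: eq_Rintegral => p _; ring.
pose F1 k p := damp e k * f p * (FTre f k * cos (p.1 * k.1 + p.2 * k.2) +
     FTsin f k * sin (p.1 * k.1 + p.2 * k.2)).
rewrite (@Rfubini _ _ _ _ R leb2 leb2 F1); last first.
  apply: (@integrable_prod _ _ _ _ R leb2 leb2 F1
    (fun k => (A + A) * damp e k) (fun p => `|f p|)).
  - by rewrite /F1; mea.
  - exact: (integrableZl measurableT (A + A) iw).
  - by [].
  - move=> k p; rewrite /F1 2!normrM (ger0_norm (damp_ge0 _ _)).
    rewrite [leRHS](_ : _ = damp e k * `|f p| * (A + A)); last by ring.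
    apply: ler_wpM2l; first by rewrite mulr_ge0// damp_ge0.
    rewrite (le_trans (ler_normD _ _))// lerD// normrM.
    + have := CA k; have := cos_max (p.1 * k.1 + p.2 * k.2).
      by have := normr_ge0 (FTre f k); nra.
    + have := SA k; have := sin_max (p.1 * k.1 + p.2 * k.2).
      by have := normr_ge0 (FTsin f k); nra.
apply: eq_Rintegral => p _.
transitivity (\int[leb2]_k \int[leb2]_q (f p * damp e k * f q *
    cos ((p.1 - q.1) * k.1 + (p.2 - q.2) * k.2))).
  apply: eq_Rintegral => k _.
  rewrite /F1; set c := cos (_ + _); set s := sin (_ + _).
  rewrite [LHS](_ : _ = (damp e k * f p * c) * FTre f k +
      (damp e k * f p * s) * FTsin f k); last by ring.
  rewrite FT_lin//; apply: eq_Rintegral => q _.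
  rewrite (_ : (p.1 - q.1) * k.1 + (p.2 - q.2) * k.2 =
    (p.1 * k.1 + p.2 * k.2) - (q.1 * k.1 + q.2 * k.2)); last by ring.
  by rewrite cosB -/c -/s; ring.
pose F2 k q := f p * damp e k * f q *
    cos ((p.1 - q.1) * k.1 + (p.2 - q.2) * k.2).
rewrite (@Rfubini _ _ _ _ R leb2 leb2 F2); last first.
  apply: (@integrable_prod _ _ _ _ R leb2 leb2 F2
    (fun k => `|f p| * damp e k) (fun q => `|f q|)).
  - by rewrite /F2; mea.
  - exact: (integrableZl measurableT `|f p| iw).
  - by [].
  - move=> k q; rewrite /F2 3!normrM (ger0_norm (damp_ge0 _ _)) ler_piMr ?cos_max//.
    by rewrite !mulr_ge0// damp_ge0.
apply: eq_Rintegral => q _.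
rewrite -Rint_damp_cos// -RintegralZl//.
  by apply: eq_Rintegral => k _; rewrite /F2; ring.
by apply: integrable_FT => //; [mea|move=> k; exact: cos_max].
Qed.

End fourier.

(** * Continuity of translations in L^2 *)

Section translation_continuity.
Variable R : realType.
Local Notation mu := (@lebesgue_measure R).
Local Notation leb2 := (@leb2 R).
Implicit Types (f g : R * R -> R) (t p : R * R).
Local Open Scope ereal_scope.

Definition trans t f p : R := f (p.1 + t.1, p.2 + t.2)%R.

Lemma measurable_trans t f : measurable_fun setT f -> measurable_fun setT (trans t f).
Proof. by move=> mf; rewrite /trans; mea. Qed.

Lemma N2_ge0 f : 0 <= N2 f.
Proof. by apply: int_ge0 => p; exact: sqr_ge0. Qed.

Lemma N2_trans t f : measurable_fun setT f -> N2 (trans t f) = N2 f.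
Proof.
by move=> mf; apply: (int2_shift t.1 t.2 (f := fun p => (f p ^+ 2)%:E)); mea.
Qed.

Lemma N2D f g : measurable_fun setT f -> measurable_fun setT g ->
  N2 (fun p => f p + g p)%R <= 2%:E * N2 f + 2%:E * N2 g.
Proof.
move=> mf mg; rewrite /N2 -!intZ//; try by [mea|move=> p; exact: sqr_ge0].
rewrite -intD//; try by [mea|move=> p; rewrite mulr_ge0 ?sqr_ge0].
apply: le_int; [mea|mea|move=> p; exact: sqr_ge0|move=> p].
by have := sqr_ge0 (f p - g p)%R; nra.
Qed.

Lemma N2Z c f : measurable_fun setT f ->
  N2 (fun p => c * f p)%R = (c ^+ 2)%:E * N2 f.
Proof.
move=> mf; rewrite /N2 -intZ//; [|by mea|by move=> p; exact: sqr_ge0|exact: sqr_ge0].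
by apply: eq_integral => p _; rewrite exprMn.
Qed.

Definition modulus f t := N2 (fun p => trans t f p - f p)%R.

Lemma measurable_modulus f : measurable_fun setT f -> measurable_fun setT (modulus f).
Proof.
move=> mf; apply: (measurable_param_leb2
  (F := fun t p => ((trans t f p - f p) ^+ 2)%:E)).
by rewrite /trans; mea.
Qed.

Definition translation_continuous f := forall e : R, (0 < e)%R ->
  exists d : R, (0 < d)%R /\
  forall t, (`|t.1| <= d)%R -> (`|t.2| <= d)%R -> modulus f t <= e%:E.

Lemma modulus_le f t : measurable_fun setT f -> modulus f t <= 4%:E * N2 f.
Proof.
move=> mf; have mt := measurable_trans t mf.
rewrite (_ : 4%:E = 2%:E + 2%:E); last by rewrite -EFinD; congr EFin; ring.
rewrite ge0_muleDl ?lee_fin// -{1}(N2_trans t mf).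
rewrite (_ : N2 f = N2 (fun p => (- 1) * f p)%R); last first.
  by rewrite N2Z// sqrrN expr1n mul1e.
rewrite /modulus (_ : (fun p => _) = fun p => (trans t f p + (- 1) * f p)%R).
  by apply: N2D => //; mea.
by apply/funext => p; rewrite mulN1r.
Qed.

Lemma modulusD f g t : measurable_fun setT f -> measurable_fun setT g ->
  modulus (fun p => f p + g p)%R t <= 2%:E * modulus f t + 2%:E * modulus g t.
Proof.
move=> mf mg; have mtf := measurable_trans t mf; have mtg := measurable_trans t mg.
rewrite {1}/modulus (_ : (fun p => _) = fun p => ((trans t f p - f p) + (trans t g p - g p))%R).
  by apply: N2D; mea.
by apply/funext => p; rewrite /trans; ring.
Qed.

Lemma translation_continuousD f g : measurable_fun setT f -> measurable_fun setT g ->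
  translation_continuous f -> translation_continuous g ->
  translation_continuous (fun p => f p + g p)%R.
Proof.
move=> mf mg cf cg e e0; have e4 : (0 < e / 4)%R by rewrite divr_gt0.
have [d [d0 fd]] := cf _ e4; have [d' [d'0 gd]] := cg _ e4.
exists (Num.min d d'); split; first by rewrite lt_min d0.
move=> t; rewrite !le_min => /andP[t1 t1'] /andP[t2 t2'].
apply: le_trans (modulusD t mf mg) _.
have -> : e%:E = 2%:E * (e / 4)%:E + 2%:E * (e / 4)%:E.
  by rewrite -!EFinM -EFinD; congr EFin; field.
by apply: leeD; rewrite lee_pmul2l ?lte_fin//; [exact: fd|exact: gd].
Qed.

Lemma translation_continuousZ c f : measurable_fun setT f ->
  translation_continuous f -> translation_continuous (fun p => c * f p)%R.
Proof.
move=> mf cf e e0; have e4 : (0 < e / (1 + c ^+ 2))%R.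
  by rewrite divr_gt0// ltr_pwDl// sqr_ge0.
have [d [d0 fd]] := cf _ e4; exists d; split=> // t t1 t2.
rewrite /modulus (_ : (fun p => _) = fun p => (c * (trans t f p - f p))%R); last first.
  by apply/funext => p; rewrite /trans; ring.
have mtf := measurable_trans t mf.
rewrite N2Z; last by mea.
apply: (@le_trans _ _ ((c ^+ 2)%:E * (e / (1 + c ^+ 2))%:E)).
  by apply: lee_wpmul2l; [rewrite lee_fin sqr_ge0|exact: fd].
rewrite -EFinM lee_fin mulrA ler_pdivrMr; last by rewrite ltr_pwDl// sqr_ge0.
by have := sqr_ge0 c; nra.
Qed.

Lemma translation_continuous_approx f : measurable_fun setT f ->
  (forall e : R, (0 < e)%R -> exists g, [/\ measurable_fun setT g,
     translation_continuous g & N2 (fun p => f p - g p)%R <= e%:E]) ->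
  translation_continuous f.
Proof.
(* The bound obtained is 2 e / 16 from [g] plus 2 * 4 e / 16 from the remainder, whose modulus is at
   most 4 times its squared norm. *)
move=> mf H e e0; have e4 : (0 < e / 16)%R by rewrite divr_gt0.
have [g [mg cg fg]] := H _ e4; have [d [d0 gd]] := cg _ e4.
exists d; split=> // t t1 t2.
rewrite (_ : f = fun p => (g p + (f p - g p))%R); last by apply/funext => p; ring.
have mfg : measurable_fun setT (fun p => (f p - g p)%R) by mea.
apply: le_trans (modulusD t mg mfg) _.
apply: (@le_trans _ _ (2%:E * (e / 16)%:E + 2%:E * (4%:E * (e / 16)%:E))); last first.
  by rewrite -!EFinM -EFinD lee_fin; lra.
apply: leeD; rewrite lee_pmul2l ?lte_fin//; first exact: gd.
apply: le_trans (modulus_le t mfg) _.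
by rewrite lee_pmul2l ?lte_fin.
Qed.

Let ind (A : set (R * R)) : R * R -> R := \1_A.

Let itv_ind (a b : R) (x : R) : R := if (a < x <= b)%R then 1%R else 0%R.

Let mitv a b : measurable_fun setT (itv_ind a b).
Proof. by rewrite /itv_ind; mea. Qed.

Let int_itv a b : \int[mu]_x (itv_ind a b x)%:E <= `|b - a|%:E.
Proof.
have -> : \int[mu]_x (itv_ind a b x)%:E = mu `]a, b]%classic.
  rewrite -[X in _ = mu X]setIT -integral_indic//; apply: eq_integral => x _.
  by rewrite indicE mem_setE in_itv/= /itv_ind; case: ifP.
rewrite lebesgue_measure_itv/= lte_fin.
case: ifP => ab; last by rewrite lee_fin.
by rewrite -EFinB lee_fin ler_norm.
Qed.

Let int_near (a s : R) : \int[mu]_x (if (`|x - a| <= `|s|)%R then 1 else 0)%:E <= (2 * `|s|)%:E.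
Proof.
rewrite (_ : \int[mu]_x _ = mu `[(a - `|s|)%R, (a + `|s|)%R]%classic); last first.
  rewrite -[X in _ = mu X]setIT -integral_indic//; apply: eq_integral => x _.
  by rewrite indicE mem_setE in_itv/= ler_distl; case: ifP.
rewrite lebesgue_measure_itv/= lte_fin.
case: ifP => _; last by rewrite lee_fin mulr_ge0.
by rewrite -EFinB lee_fin; lra.
Qed.

(** The two indicators differ only at points within |s| of [a] or of [b]. *)
Let int_itv_diff a b s :
  \int[mu]_x ((itv_ind a b (x + s) - itv_ind a b x) ^+ 2)%:E <= (4 * `|s|)%:E.
Proof.
pose near (a x : R) : R := if (`|x - a| <= `|s|)%R then 1%R else 0%R.
have mn c : measurable_fun setT (near c) by rewrite /near; mea.
have n0 c x : (0 <= near c x)%R by rewrite /near; case: ifP.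
apply: (@le_trans _ _ (\int[mu]_x (near a x + near b x)%:E)).
  have m1 := mitv a b; have m2 := mn a; have m3 := mn b.
  apply: le_int; [by mea|by mea|by move=> x; exact: sqr_ge0|].
  move=> x; rewrite /itv_ind /near.
  have := ler_norm s; have := ler_norm (- s)%R; rewrite normrN.
  move: (`|s|)%R => ns s1 s2; rewrite !ler_distl.
  by do ![case: ifP => [/andP[? ?]|/negbT]; rewrite ?negb_and -?leNgt -?ltNge];
    try (by rewrite ?subrr; nra); move=> /orP[] ? ; try (move=> /orP[] ?); try (move=> /orP[] ?); nra.
rewrite (intD mu (mn a) (mn b) (n0 a) (n0 b)).
apply: (@le_trans _ _ ((2 * `|s|)%:E + (2 * `|s|)%:E)%E).
  by apply: leeD; exact: int_near.
by rewrite -EFinD lee_fin; lra.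
Qed.

Let box (a b c d : R) p : R := (itv_ind a b p.1 * itv_ind c d p.2)%R.

Let itv_ind01 a b x : (0 <= itv_ind a b x <= 1)%R.
Proof. by rewrite /itv_ind; case: ifP; rewrite ?lexx ler01. Qed.

Let int_box_prod (f g : R -> R) (A B : R) :
  measurable_fun setT f -> measurable_fun setT g ->
  (forall x, 0 <= f x)%R -> (forall x, 0 <= g x)%R -> (0 <= B)%R ->
  \int[mu]_x (f x)%:E <= A%:E -> \int[mu]_x (g x)%:E <= B%:E ->
  \int[leb2]_p (f p.1 * g p.2)%:E <= (A * B)%:E.
Proof.
move=> mf mg f0 g0 B0 fA gB; rewrite leb2_tonelli; [|by mea|]; last first.
  by move=> p; rewrite lee_fin mulr_ge0.
apply: (@le_trans _ _ (\int[mu]_x (f x * B)%:E)).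
  apply: ge0_le_integral => //.
  - by move=> x _; apply: integral_ge0 => y _; rewrite lee_fin mulr_ge0.
  - by apply: (measurable_param_mu (F := fun x y => (f x * g y)%:E)); mea.
  - by mea.
  - move=> x _; rewrite /= intZ// EFinM.
    by apply: lee_wpmul2l => //; rewrite lee_fin.
under eq_integral do rewrite mulrC.
by rewrite intZ// mulrC EFinM; apply: lee_wpmul2l => //; rewrite lee_fin.
Qed.

Let continuous_box a b c d : translation_continuous (box a b c d).
Proof.
(* Moving in one coordinate costs 2 * 4 |t_j| times the length of the other side; the + 1 keeps the
   divisor positive. *)
move=> e e0; pose K := (8 * `|d - c| + 8 * `|b - a| + 1)%R.
have K0 : (0 < K)%R by rewrite ltr_wpDl// addr_ge0// mulr_ge0.
exists (e / K)%R; split; first by rewrite divr_gt0.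
move=> t t1 t2; rewrite /modulus.
have m1 := mitv a b; have m2 := mitv c d.
pose f1 x := ((itv_ind a b (x + t.1) - itv_ind a b x) ^+ 2)%R.
pose g1 x := ((itv_ind c d (x + t.2) - itv_ind c d x) ^+ 2)%R.
have mf1 : measurable_fun setT f1 by rewrite /f1; mea.
have mg1 : measurable_fun setT g1 by rewrite /g1; mea.
pose g0 x := itv_ind c d (x + t.2)%R.
have mg0 : measurable_fun setT g0 by rewrite /g0; mea.
have i0 u v x : (0 <= itv_ind u v x)%R by have /andP[] := itv_ind01 u v x.
apply: (@le_trans _ _ (\int[leb2]_p (2 * (f1 p.1 * g0 p.2) + 2 * (itv_ind a b p.1 * g1 p.2))%:E)).
  apply: le_int.
  - by rewrite /trans /box; mea.
  - by mea.
  - by move=> p; exact: sqr_ge0.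
  - move=> p; rewrite /trans /box /= /f1 /g1 /g0.
    have := itv_ind01 a b (p.1 + t.1); have := itv_ind01 a b p.1.
    have := itv_ind01 c d (p.2 + t.2); have := itv_ind01 c d p.2.
    move: (itv_ind _ _ _) (itv_ind _ _ _) (itv_ind _ _ _) (itv_ind _ _ _).
    move=> x y z w /andP[x0 x1] /andP[y0 y1] /andP[z0 z1] /andP[w0 w1].
    have -> : (x * z - y * w = (x - y) * z + y * (z - w))%R by ring.
    have h (u v : R) : ((u + v) ^+ 2 <= 2 * u ^+ 2 + 2 * v ^+ 2)%R.
      by have := sqr_ge0 (u - v)%R; nra.
    apply: le_trans (h _ _) _; rewrite !exprMn lerD// ler_pM2l//.
    + by rewrite ler_wpM2l ?sqr_ge0// expr2 ler_piMr.
    + by rewrite ler_wpM2r ?sqr_ge0// expr2 ler_piMr.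
have f10 x : (0 <= f1 x)%R by exact: sqr_ge0.
have g10 x : (0 <= g1 x)%R by exact: sqr_ge0.
have g00 x : (0 <= g0 x)%R by exact: i0.
have h0 p : (0 <= f1 p.1 * g0 p.2)%R by exact: mulr_ge0.
have h1 p : (0 <= itv_ind a b p.1 * g1 p.2)%R by exact: mulr_ge0.
have mh0 : measurable_fun setT (fun p : R * R => f1 p.1 * g0 p.2)%R by mea.
have mh1 : measurable_fun setT (fun p : R * R => itv_ind a b p.1 * g1 p.2)%R by mea.
rewrite intD; [|by mea|by mea|by move=> p; rewrite mulr_ge0|by move=> p; rewrite mulr_ge0].
rewrite (intZ leb2 mh0 h0 (ler0n _ 2)) (intZ leb2 mh1 h1 (ler0n _ 2)).
apply: (@le_trans _ _ (2%:E * ((4 * `|t.1|) * `|d - c|)%:E + 2%:E * (`|b - a| * (4 * `|t.2|))%:E)).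
  apply: leeD; rewrite lee_pmul2l ?lte_fin//; apply: int_box_prod => //.
  - exact: int_itv_diff.
  - by rewrite (int_shift t.2 (f := fun x => (itv_ind c d x)%:E)) ?int_itv//; mea.
  - exact: int_itv_diff.
rewrite -!EFinM -EFinD lee_fin.
move: t1 t2; rewrite !ler_pdivlMr// /K.
have := normr_ge0 (d - c)%R; have := normr_ge0 (b - a)%R.
have := normr_ge0 t.1; have := normr_ge0 t.2.
by move: `|t.1|%R `|t.2|%R `|d - c|%R `|b - a|%R => x y z w; nra.
Qed.

(* Sierpinski-Dynkin: the sets [A] such that the indicator of [D `&` g @^-1` A]
   is continuous under translation form a lambda-system. *)
Let continuous_dynkin d (T : measurableType d) (G : set (set T))
    (D : set (R * R)) (g : R * R -> T) :
  setI_closed G -> @measurable _ T = <<s G >> -> measurable_fun setT g ->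
  measurable D -> leb2 D < +oo -> translation_continuous (ind D) ->
  (forall A, G A -> translation_continuous (ind (D `&` g @^-1` A))) ->
  forall A, measurable A -> translation_continuous (ind (D `&` g @^-1` A)).
Proof.
move=> GI GE mg mD Doo cD cG.
have mDA A : measurable A -> measurable (D `&` g @^-1` A).
  by move=> mA; apply: measurableI => //; rewrite -[X in measurable X]setTI; exact: mg.
pose H : set (set T) := [set A | measurable A /\ translation_continuous (ind (D `&` g @^-1` A))].
suff : <<s G >> `<=` H by move=> GH A mA; apply: (GH A _).2; rewrite -GE.
apply: lambda_system_subset => //; last first.
  by move=> A GA; split; [rewrite GE; exact: sub_sigma_algebra|exact: cG].
split=> //.
- by split; [exact: measurableT|rewrite preimage_setT setIT].
- move=> A B BA [mA cA] [mB cB]; split; first exact: measurableD.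
  have -> : ind (D `&` g @^-1` (A `\` B)) =
      fun p => (ind (D `&` g @^-1` A) p + (- 1) * ind (D `&` g @^-1` B) p)%R.
    apply/funext => p; rewrite /ind !indicE.
    have in_ X : (p \in D `&` g @^-1` X) = `[< D p /\ X (g p) >].
      by apply/idP/asboolP; rewrite inE.
    rewrite !in_; case: (asboolP (D p /\ (A `\` B) (g p))) => H1;
      case: (asboolP (D p /\ A (g p))) => H2; case: (asboolP (D p /\ B (g p))) => H3;
      try (by rewrite /= ?mulr1n ?mulr0n; ring);
      exfalso; have := BA (g p); rewrite /setD /= in H1; tauto.
  apply: translation_continuousD => //; last apply: translation_continuousZ => //.
  + by apply: measurable_indic; exact: mDA.
  + apply: measurable_funM => //.
    by apply: measurable_indic; exact: mDA.
  + by apply: measurable_indic; exact: mDA.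
- move=> F ndF HF.
  have mF n : measurable (F n) by have [] := HF n.
  split; first exact: bigcupT_measurable.
  have mU : measurable (\bigcup_i F i) by exact: bigcupT_measurable.
  (* For an increasing union the squared L^2 distance to the n-th set is the measure of a difference
     of sets, which is small for large n because [D] has finite measure. *)
  apply: translation_continuous_approx; first by apply: measurable_indic; exact: mDA.
  move=> e e0.
  pose E n := D `&` g @^-1` (F n).
  have EU : D `&` g @^-1` (\bigcup_i F i) = \bigcup_i E i.
    by rewrite preimage_bigcup setI_bigcupr.
  have mE n : measurable (E n) by exact: mDA.
  have ndE : nondecreasing_seq E.
    move=> n m nm; rewrite subsetEset; apply: setIS; apply: preimage_subset.
    by rewrite -subsetEset; exact: ndF.
  have cvE : leb2 (E n) @[n --> \oo] --> leb2 (\bigcup_i E i).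
    apply: nondecreasing_cvg_mu => //; exact: bigcupT_measurable.
  have Uoo : leb2 (\bigcup_i E i) < +oo.
    apply: le_lt_trans Doo; rewrite -EU; apply: le_measure; rewrite ?inE//; exact: mDA.
  have [r rE] : exists r, leb2 (\bigcup_i E i) = r%:E.
    by exists (fine (leb2 (\bigcup_i E i))); rewrite fineK// ge0_fin_numE.
  have [n En] : exists n, (r - e)%:E <= leb2 (E n).
    have : \forall n \near \oo, (r - e)%:E < leb2 (E n).
      move: cvE; rewrite rE => cvE.
      by apply: (cvE _ (open_ereal_gt' _)); rewrite lte_fin; lra.
    by move=> [n _ /(_ n (leqnn n)) /ltW]; exists n.
  exists (ind (E n)); split.
  + by apply: measurable_indic; exact: mE.
  + by have [_] := HF n.
  have mUE : measurable (\bigcup_i E i) by exact: bigcupT_measurable.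
  have mDU : measurable (\bigcup_i E i `\` E n) by exact: measurableD.
  have EnU : E n `<=` \bigcup_i E i by exact: bigcup_sup.
  rewrite (_ : N2 _ = leb2 ((\bigcup_i E i) `\` E n)); last first.
    rewrite -[in RHS](setIT (_ `\` _)) -integral_indic//.
    apply: eq_integral => p _; congr EFin; rewrite EU /ind !indicE in_setD.
    have : p \in E n -> p \in \bigcup_i E i by rewrite !inE; exact: EnU.
    case: (p \in E n) => /= [->//|_]; first by rewrite /= ?mulr1n ?mulr0n; ring.
    by case: (p \in _) => /=; rewrite ?mulr1n ?mulr0n; ring.
  have -> : leb2 (\bigcup_i E i `\` E n) = leb2 (\bigcup_i E i) - leb2 (E n).
    rewrite -[X in _ - leb2 X](setIidr EnU).
    by apply: (@measureD _ _ _ leb2) => //; exact: mE.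
  rewrite rE.
  by move: En; case: (leb2 (E n)) => [s||]; rewrite /= ?lee_fin ?leNye//; lra.
Qed.

Let ind_itv a b x : (x \in `]a, b]%classic)%:R = itv_ind a b x.
Proof. by rewrite mem_setE in_itv/= /itv_ind; case: ifP. Qed.

Let continuous_rect (X Y : set R) : ocitv X -> ocitv Y ->
  translation_continuous (ind (X `*` Y)).
Proof.
move=> [[a b]] _ <- [[c d]] _ <-.
rewrite (_ : ind _ = box a b c d); first exact: continuous_box.
by apply/funext => p; rewrite /ind indicE in_setX /= -mulnb natrM !ind_itv.
Qed.

Let ocitv_lty (X : set R) : ocitv X -> mu X < +oo.
Proof.
move=> [[a b]] _ <-; rewrite lebesgue_measure_itv/=; case: ifP => _ //.
by rewrite -EFinB ltry.
Qed.

Let measurable_ocitv (X : set R) : ocitv X -> measurable X.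
Proof. by move=> [[a b]] _ <-; exact: measurable_itv. Qed.

Let rect_lty (X Y : set R) : ocitv X -> ocitv Y -> leb2 (X `*` Y) < +oo.
Proof.
move=> oX oY; rewrite /leb2 product_measure1E; [|exact: measurable_ocitv|exact: measurable_ocitv].
by rewrite lte_mul_pinfty ?ocitv_lty// ge0_fin_numE// ocitv_lty.
Qed.

Let sub_lty (A D : set (R * R)) : measurable A -> measurable D -> A `<=` D ->
  leb2 D < +oo -> leb2 A < +oo.
Proof. by move=> mA mD AD; apply: le_lt_trans; apply: le_measure; rewrite ?inE. Qed.

Let measurable_preim1 (A : set R) : measurable A -> measurable (@fst R R @^-1` A).
Proof.
by move=> mA; rewrite -[X in measurable X]setTI; exact: measurable_fst.
Qed.

(** Plane Borel sets are reached by three applications of the Dynkin argument: Borel conditions on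
    the first coordinate, then on the second, then the product sigma-algebra, whose generating
    pi-system of measurable rectangles is covered by the first two. The bounded rectangle keeps
    every measure finite. *)
Let continuous_stage1 (X Y A : set R) : ocitv X -> ocitv Y -> measurable A ->
  translation_continuous (ind ((X `*` Y) `&` fst @^-1` A)).
Proof.
move=> oX oY; have mX := measurable_ocitv oX; have mY := measurable_ocitv oY.
apply: (@continuous_dynkin _ (measurableTypeR R) (@ocitv R)) => //.
- exact: ocitvI.
- exact: measurableX.
- exact: rect_lty.
- exact: continuous_rect.
- move=> B oB; rewrite (_ : _ `&` _ = (X `&` B) `*` Y); last first.
    by apply/seteqP; split => -[x y] /=; tauto.
  by apply: continuous_rect => //; exact: ocitvI.
Qed.

Let continuous_stage2 (X Y A B : set R) : ocitv X -> ocitv Y -> measurable A ->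
  measurable B ->
  translation_continuous (ind (((X `*` Y) `&` fst @^-1` A) `&` snd @^-1` B)).
Proof.
move=> oX oY mA; have mX := measurable_ocitv oX; have mY := measurable_ocitv oY.
have mD : measurable (X `*` Y `&` fst @^-1` A).
  by apply: measurableI; [exact: measurableX|exact: measurable_preim1].
apply: (@continuous_dynkin _ (measurableTypeR R) (@ocitv R)) => //.
- exact: ocitvI.
- apply: (sub_lty mD (measurableX mX mY)); first exact: subIsetl.
  exact: rect_lty.
- exact: continuous_stage1.
- move=> C oC; rewrite (_ : _ `&` _ = (X `*` (Y `&` C)) `&` fst @^-1` A); last first.
    by apply/seteqP; split => -[x y] /=; tauto.
  by apply: continuous_stage1 => //; exact: ocitvI.
Qed.

Let continuous_measurable (X Y : set R) (A : set (R * R)) : ocitv X -> ocitv Y ->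
  measurable A -> translation_continuous (ind ((X `*` Y) `&` A)).
Proof.
move=> oX oY; have mX := measurable_ocitv oX; have mY := measurable_ocitv oY.
pose G := [set C `*` E | C in @measurable _ (measurableTypeR R) & E in @measurable _ (measurableTypeR R)].
apply: (@continuous_dynkin _ (measurableTypeR R * measurableTypeR R)%type G (X `*` Y) idfun).
- move=> _ _ [C mC [E mE <-]] [C' mC' [E' mE' <-]].
  exists (C `&` C'); first exact: measurableI.
  by exists (E `&` E'); [exact: measurableI|rewrite setXI].
- exact: measurable_prod_measurableType.
- exact: measurable_id.
- exact: measurableX.
- exact: rect_lty.
- exact: continuous_rect.
- move=> _ [C mC [E mE <-]].
  rewrite (_ : _ `&` _ = ((X `*` Y) `&` fst @^-1` C) `&` snd @^-1` E); last first.
    by apply/seteqP; split => -[x y] /=; tauto.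
  exact: continuous_stage2.
Qed.

Let translation_continuous_sum (I : Type) (s : seq I) (F : I -> R * R -> R) :
  (forall i, measurable_fun setT (F i)) -> (forall i, translation_continuous (F i)) ->
  translation_continuous (fun p => \sum_(i <- s) F i p)%R.
Proof.
move=> mF cF; elim: s => [|i s IH].
  move=> e e0; exists 1%R; split=> // t _ _.
  rewrite /modulus /N2 (eq_integral (cst 0)) ?integral0 ?lee_fin ?ltW//.
  by move=> p _; rewrite /trans !big_nil subrr expr0n.
rewrite (_ : (fun p => _) = (fun p => F i p + \sum_(i <- s) F i p)%R); last first.
  by apply/funext => p; rewrite big_cons.
by apply: translation_continuousD => //; exact: measurable_sum.
Qed.

Import HBNNSimple.

Variable n : R.
Let ball f := forall p, f p != 0%R -> (`|p.1| <= n)%R /\ (`|p.2| <= n)%R.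
Let X : set R := `](- (n + 1))%R, (n + 1)%R]%classic.

Let oX : ocitv X. Proof. by exists (- (n + 1), n + 1)%R. Qed.

Let continuous_nnsfun (s : {nnsfun [the measurableType _ of (R * R)%type] >-> R}) :
  ball (fun p => s p) -> translation_continuous (fun p => s p).
Proof.
move=> sb; have fr := fimfunP s.
(* The level set of the value 0 is unbounded, so its term, whose coefficient is 0, is written with
   the empty set. *)
rewrite (_ : (fun p => s p) = fun p => (\sum_(y <- finmap.enum_fset (fset_set (range s)))
    y * ind (s @^-1` [set y] `&` (if y == 0%R then set0 else setT)) p)%R); last first.
  apply/funext => p; rewrite {1}fimfunE fsbig_finite//=; apply: eq_bigr => y _.
  by case: eqVneq => [->|y0]; rewrite ?mul0r// setIT.
have mS y : measurable (s @^-1` [set y]) by [].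
have mE y : measurable (s @^-1` [set y] `&` (if y == 0%R then set0 else setT)).
  by apply: measurableI => //; case: ifP.
apply: translation_continuous_sum => y.
  by apply: measurable_funM => //; apply: measurable_indic; exact: mE.
apply: translation_continuousZ; first by apply: measurable_indic; exact: mE.
rewrite (_ : _ `&` _ = (X `*` X) `&` (s @^-1` [set y] `&` (if y == 0%R then set0 else setT))).
  by apply: continuous_measurable => //; exact: mE.
apply/seteqP; split=> [p [sp +]|p []//]; case: eqVneq => // y0 _; split=> //.
have /sb[] : s p != 0%R by rewrite sp.
by rewrite !ler_norml /X => /andP[? ?] /andP[? ?]; split; rewrite /= in_itv /=; lra.
Qed.

Let continuous_ge0 f : measurable_fun setT f -> (forall p, 0 <= f p)%R ->
  N2 f < +oo -> ball f -> translation_continuous f.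
Proof.
move=> mf f0 foo fb.
have mEf : measurable_fun setT (EFin \o f) by exact/measurable_EFinP.
pose s := nnsfun_approx measurableT mEf.
have sf k p : (s k p <= f p)%R.
  rewrite -lee_fin /s nnsfun_approxE; apply: (le_approx k (f := EFin \o f)) => //.
  by move=> ? _; rewrite lee_fin.
have s0 k p : (0 <= s k p)%R by exact: fun_ge0.
have ms k : measurable_fun setT (s k) by [].
apply: translation_continuous_approx => // e e0.
have if2 : leb2.-integrable setT (EFin \o (fun p => f p ^+ 2)%R).
  apply: integrable_ltoo; first by mea.
  by under eq_integral do rewrite ger0_norm ?sqr_ge0//.
have hs p : (s k p)%R @[k --> \oo] --> (f p : R).
  have := cvg_nnsfun_approx measurableT mEf (fun p _ => f0 p) (x := p) I.
  by move=> /fine_cvgP[_].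
have hp p : ((f p - s k p) ^+ 2)%:E @[k --> \oo] --> (0%R%:E : \bar R).
  apply: cvg_EFin; first exact: nearW.
  have h : (f p - s k p)%R @[k --> \oo] --> (0%R : R).
    by rewrite -(subrr (f p)); apply: cvgB => //; exact: cvg_cst.
  by have := cvgM h h; rewrite mulr0 /comp /=; exact.
(* Dominated convergence with dominating function f^2, since 0 <= s k <= f. *)
have : N2 (fun p => f p - s k p)%R @[k --> \oo] --> \int[leb2]_p (cst 0 p).
  apply: (@dominated_cvg _ _ _ leb2 setT measurableT
      (fun k p => ((f p - s k p) ^+ 2)%:E) (cst 0) (fun p => (f p ^+ 2)%:E)) => //.
  - by move=> k; have := ms k => ?; mea.

  - move=> k p _; rewrite /= lee_fin ger0_norm ?sqr_ge0//.
    by rewrite lerXn2r ?nnegrE ?subr_ge0 ?sf// lerBlDr lerDl s0.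
rewrite integral0 => cv0.
have : \forall k \near \oo, N2 (fun p => f p - s k p)%R < e%:E.
  by apply: (cv0 _ (open_ereal_lt' _)); rewrite lte_fin.
move=> [k _ /(_ k (leqnn k)) /ltW ke]; exists (s k); split=> //.
have sb : ball (fun p => s k p).
  move=> p sp; apply: fb; apply/eqP => fp; move: sp (sf k p); rewrite fp => sp.
  by rewrite real_leNgt ?num_real// lt_neqAle eq_sym sp s0.
exact: (continuous_nnsfun sb).
Qed.

(** This is what makes the error term in the lower Plancherel bound small. Positive and negative
    parts are treated separately because simple functions approximate nonnegative functions from
    below. *)
Lemma translation_continuous_L2 f : measurable_fun setT f -> N2 f < +oo ->
  (forall p, f p != 0%R -> (`|p.1| <= n)%R /\ (`|p.2| <= n)%R) ->
  translation_continuous f.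
Proof.
move=> mf foo fb.
have mp : measurable_fun setT (fun p => Num.max (f p) 0%R) by mea.
have mn : measurable_fun setT (fun p => Num.max (- f p) 0)%R by mea.
have maxsq (x : R) : (Num.max x 0 ^+ 2 <= x ^+ 2)%R.
  by rewrite /Num.max; case: ifP => _; rewrite ?lexx// expr0n sqr_ge0.
rewrite (_ : f = fun p => (Num.max (f p) 0 + (- 1) * Num.max (- f p) 0)%R); last first.
  apply/funext => p; have [f0|f0] := leP 0%R (f p).
    by rewrite (max_idPr _) ?oppr_le0//; ring.
  by rewrite (max_idPl _) ?oppr_ge0 ?ltW//; ring.
apply: translation_continuousD => //; first by mea.
  apply: continuous_ge0 => //; first by move=> p; rewrite le_max lexx orbT.
  - apply: le_lt_trans foo; apply: le_int; [by mea|by mea|by move=> p; exact: sqr_ge0|].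
    by move=> p; exact: maxsq.
  - by move=> p; rewrite /Num.max; case: ifPn => [_|?]; rewrite ?eqxx// => /fb.
apply: translation_continuousZ => //; apply: continuous_ge0 => //.
- by move=> p; rewrite le_max lexx orbT.
- apply: le_lt_trans foo; apply: le_int; [by mea|by mea|by move=> p; exact: sqr_ge0|].
  by move=> p; rewrite -[leRHS]sqrrN; exact: maxsq.
- by move=> p; rewrite /Num.max; case: ifPn => [_|?]; rewrite ?eqxx// oppr_eq0 => /fb.
Qed.

End translation_continuity.

(** * The two Plancherel inequalities *)

Section plancherel.
Variable R : realType.
Local Notation mu := (@lebesgue_measure R).
Local Notation leb2 := (@leb2 R).
Implicit Types (f g : R * R -> R) (t p k : R * R).
Local Open Scope ereal_scope.

Definition inbox (n : R) p : bool := (`|p.1| <= n)%R && (`|p.2| <= n)%R.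

Lemma measurable_inbox n : measurable_fun setT (inbox n).
Proof. by rewrite /inbox; mea. Qed.

Lemma int_le_exhaust (F : R * R -> R) (B : \bar R) : measurable_fun setT F ->
  (forall p, 0 <= F p)%R ->
  (forall n : nat, \int[leb2]_p (if inbox n%:R p then F p else 0)%:E <= B) ->
  \int[leb2]_p (F p)%:E <= B.
Proof.
move=> mF F0 FB.
pose g (n : nat) p : \bar R := (if inbox n%:R p then F p else 0)%:E.
have mg n : measurable_fun setT (g n).
  by rewrite /g; have := measurable_inbox n%:R => ?; mea.
have g0 n p : setT p -> 0 <= g n p.
  by move=> _; rewrite lee_fin; case: ifP.
have ndg p : setT p -> {homo g ^~ p : n m / (n <= m)%N >-> n <= m}.
  move=> _ n m nm; rewrite lee_fin /inbox.
  have nm' : (n%:R <= m%:R :> R)%R by rewrite ler_nat.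
  case: ifPn => [/andP[p1 p2]|_]; last by case: ifP.
  by rewrite (le_trans p1 nm') (le_trans p2 nm').
have limg p : limn (g ^~ p) = (F p)%:E.
  apply/cvg_lim => //; apply: cvg_near_cst.
  have [N NE] : exists N : nat, (`|p.1| + `|p.2| <= N%:R)%R.
    by exists (Num.truncn (`|p.1| + `|p.2|)%R).+1; rewrite ltW// truncnS_gt.
  exists N => // n /= Nn; rewrite /g /inbox.
  have Nn' : (N%:R <= n%:R :> R)%R by rewrite ler_nat.
  have := normr_ge0 p.1; have := normr_ge0 p.2 => h1 h2.
  have -> : (`|p.1| <= n%:R)%R by lra.
  by have -> : (`|p.2| <= n%:R)%R by lra.
have -> : \int[leb2]_p (F p)%:E = \int[leb2]_p limn (g ^~ p).
  by apply: eq_integral => p _; rewrite limg.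
rewrite (monotone_convergence leb2 measurableT mg g0 ndg).
apply: lime_le; last by apply: nearW => n; exact: FB.
apply: ereal_nondecreasing_is_cvgn => n m nm.
by apply: ge0_le_integral; [exact: measurableT|exact: g0|exact: mg|exact: mg|move=> p pT; exact: ndg].
Qed.

(** The class for which the Fourier transform is a plain integral: bounded support and square
    integrability give integrability. *)
Definition cl2 f := [/\ measurable_fun setT f, N2 f < +oo &
  exists n : R, forall p, f p != 0%R -> inbox n p].

Lemma integrable_inbox (n : R) :
  leb2.-integrable setT (EFin \o (fun p => if inbox n p then 1 else 0)%R).
Proof.
pose b (x : R) : R := (if `|x| <= n then 1 else 0)%R.
have ib : mu.-integrable setT (EFin \o b).
  rewrite (_ : b = \1_`[(- n)%R, n]%classic).
    exact: (@integrable_indic_itv R (- n)%R n true false).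
  by apply/funext => x; rewrite indicE mem_setE in_itv/= -ler_norml /b; case: ifP.
apply: (@integrable_prod _ _ (measurableTypeR R) (measurableTypeR R) R mu mu
  (fun x y => if inbox n (x, y) then 1 else 0)%R b b) => //.
  by rewrite /inbox; mea.
move=> x y; rewrite /inbox /b /=; case: (`|x| <= n)%R; case: (`|y| <= n)%R => /=;
  by rewrite ?normr0 ?normr1 ?mulr1 ?mulr0.
Qed.

Lemma integrable_N2 f : measurable_fun setT f -> N2 f < +oo ->
  leb2.-integrable setT (EFin \o (fun p => f p ^+ 2)%R).
Proof.
move=> mf foo; apply: integrable_ltoo; first by mea.
by under eq_integral do rewrite ger0_norm ?sqr_ge0//.
Qed.

Lemma cl2_integrable f : cl2 f -> leb2.-integrable setT (EFin \o f).
Proof.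
move=> [mf foo [n fn]].
have i1 := integrableD measurableT (integrable_inbox n) (integrable_N2 mf foo).
apply: (@integrable_le _ _ _ leb2 _
  (fun p => ((if inbox n p then 1 else 0) + f p ^+ 2)%R)) => //.
move=> p; have [fp|/fn ->] := eqVneq (f p) 0%R.
  by rewrite fp normr0 expr0n addr0; case: ifP.
by rewrite ler_norml; apply/andP; split; nra.
Qed.

Let KN (N e : R) t : R := (poisson_cut N e t.1 * poisson_cut N e t.2)%R.

Let poisson_cut_ge0 (N e a : R) : (0 < e)%R -> (0 <= poisson_cut N e a)%R.
Proof. by move=> e0; rewrite /poisson_cut; case: ifP => // _; exact: poisson_ge0. Qed.

Let measurable_poisson_cut (N e : R) : measurable_fun setT (poisson_cut N e).
Proof. by rewrite /poisson_cut; have := measurable_poisson e => ?; mea. Qed.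

Let KN_ge0 N e t : (0 < e)%R -> (0 <= KN N e t)%R.
Proof. by move=> e0; rewrite mulr_ge0 ?poisson_cut_ge0. Qed.

Let measurable_KN N e : measurable_fun setT (KN N e).
Proof. by rewrite /KN; have := measurable_poisson_cut N e => ?; mea. Qed.

Let KN_even N e t : KN N e (- t.1, - t.2)%R = KN N e t.
Proof. by rewrite /KN /poisson_cut /poisson /= !normrN !sqrrN. Qed.

Let int_prod_le (F G : R -> R) (A B : R) : measurable_fun setT F ->
  measurable_fun setT G -> (forall x, 0 <= F x)%R -> (forall x, 0 <= G x)%R ->
  \int[mu]_x (F x)%:E = A%:E -> \int[mu]_x (G x)%:E = B%:E ->
  \int[leb2]_p (F p.1 * G p.2)%:E = (A * B)%:E.
Proof.
move=> mF mG F0 G0 FA GB; rewrite leb2_tonelli; [|by mea|]; last first.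
  by move=> p; rewrite lee_fin mulr_ge0.
have B0 : (0 <= B)%R by rewrite -lee_fin -GB; exact: int_ge0.
transitivity (\int[mu]_x (B * F x)%:E).
  by apply: eq_integral => x _; rewrite /= intZ// GB -EFinM mulrC.
by rewrite intZ// FA -EFinM mulrC.
Qed.

Let int_KN N e : (0 < N)%R -> (0 < e)%R ->
  \int[leb2]_t (KN N e t)%:E = ((4 * atan (N / e)) ^+ 2)%:E.
Proof.
move=> N0 e0; have := measurable_poisson_cut N e => ?.
by rewrite expr2; apply: int_prod_le => //; rewrite ?int_poisson_cut// => x; exact: poisson_cut_ge0.
Qed.

Let int_KN_shift N e p : (0 < N)%R -> (0 < e)%R ->
  \int[leb2]_q (KN N e (q.1 - p.1, q.2 - p.2)%R)%:E = ((4 * atan (N / e)) ^+ 2)%:E.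
Proof.
move=> N0 e0; rewrite -int_KN//; have := measurable_KN N e => ?.
by rewrite (int2_shift (- p.1) (- p.2) (f := fun t => (KN N e t)%:E))//; mea.
Qed.

Lemma leb2_swap (F : R * R -> R * R -> R) :
  measurable_fun setT (fun z => F z.1 z.2) -> (forall p q, 0 <= F p q)%R ->
  \int[leb2]_p \int[leb2]_q (F p q)%:E = \int[leb2]_q \int[leb2]_p (F p q)%:E.
Proof.
move=> mF F0; apply: (@tonelli _ _ _ _ R leb2 leb2 (fun p q => (F p q)%:E)); first by mea.
by move=> x y; rewrite lee_fin.
Qed.

Lemma integrable_prod_ge0 (F : R * R -> R * R -> R) :
  measurable_fun setT (fun z => F z.1 z.2) -> (forall p q, 0 <= F p q)%R ->
  \int[leb2]_p \int[leb2]_q (F p q)%:E < +oo ->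
  (leb2 \x leb2)%E.-integrable setT (fun z => (F z.1 z.2)%:E).
Proof.
move=> mF F0 Foo; apply/(integrable12ltyP leb2 leb2); first by mea.
by under eq_integral do under eq_integral do rewrite /= ger0_norm//.
Qed.

Lemma Rintegral_prod_ge0 (F : R * R -> R * R -> R) :
  measurable_fun setT (fun z => F z.1 z.2) -> (forall p q, 0 <= F p q)%R ->
  \int[leb2]_p \int[leb2]_q (F p q)%:E < +oo ->
  (\int[(leb2 \x leb2)%E]_z F z.1 z.2)%R%:E = \int[leb2]_p \int[leb2]_q (F p q)%:E.
Proof.
move=> mF F0 Foo; rewrite Rint_EFin; last exact: integrable_prod_ge0.
apply: (@fubini_tonelli1 _ _ _ _ R leb2 leb2 (fun z => (F z.1 z.2)%:E)); first by mea.
by move=> z; rewrite lee_fin.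
Qed.

Lemma int_damp_ft2_EFin f e : (0 < e)%R -> leb2.-integrable setT (EFin \o f) ->
  (\int[leb2]_k (damp e k * ft2 f k))%R%:E = \int[leb2]_k (damp e k * ft2 f k)%:E.
Proof.
move=> e0 fi.
have mf : measurable_fun setT f.
  by apply/measurable_EFinP; exact: (measurable_int _ fi).
have m1 := measurable_ft2 mf; have m2 := measurable_damp e.
pose A := (\int[leb2]_p `|f p|)%R.
have CA k : (`|FTre f k| <= A)%R.
  by apply: norm_FT_le => //; [mea|move=> p; exact: cos_max].
have SA k : (`|FTsin f k| <= A)%R.
  by apply: norm_FT_le => //; [mea|move=> p; exact: sin_max].
apply: Rint_EFin; apply: (@integrable_le _ _ _ leb2 _ (fun k => ((2 * A ^+ 2) * damp e k)%R)).
- by mea.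
- move=> k; rewrite ger0_norm ?mulr_ge0 ?damp_ge0 ?ft2_ge0// mulrC.
  rewrite ler_wpM2r ?damp_ge0// ft2E.
  have := CA k; have := SA k; rewrite !ler_norml => /andP[? ?] /andP[? ?]; nra.
- exact: (integrableZl measurableT _ (integrable_damp e0)).
Qed.

(** Insert 2 f(p) f(q) = f(p)^2 + f(q)^2 - (f(p) - f(q))^2 into the kernel formula. The two squares
    integrate to the mass of the kernel times [N2 f]; the last term, with p = q + t, is the kernel
    average of [modulus f]. It stands on the left so that every term is nonnegative. *)
Lemma damp_identity f (n e : R) : cl2 f -> (0 < n)%R -> (0 < e)%R ->
  (forall p, f p != 0%R -> inbox n p) ->
  2%:E * \int[leb2]_k (damp e k * ft2 f k)%:E +
    \int[leb2]_t ((KN (2 * n) e t)%:E * modulus f t) =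
  (2 * (4 * atan (2 * n / e)) ^+ 2)%:E * N2 f.
Proof.
move=> cf n0 e0 fn; have fi := cl2_integrable cf; have [mf foo _] := cf.
have N0 : (0 < 2 * n)%R by rewrite mulr_gt0.
set M := (_ ^+ 2)%R; pose K := KN (2 * n) e.
have mK := measurable_KN (2 * n) e; have K0 t : (0 <= K t)%R by exact: KN_ge0.
have Ke p q : K (p.1 - q.1, p.2 - q.2)%R = K (q.1 - p.1, q.2 - p.2)%R.
  by rewrite /K -KN_even /= !opprB.
have M0 : (0 <= M)%R by exact: sqr_ge0.
have [r fr] : exists r, N2 f = r%:E by exists (fine (N2 f)); rewrite fineK// ge0_fin_numE// N2_ge0.
pose a p q := (f p ^+ 2 * K (p.1 - q.1, p.2 - q.2))%R.
pose b p q := (f q ^+ 2 * K (p.1 - q.1, p.2 - q.2))%R.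
pose c p q := (f p * f q * K (p.1 - q.1, p.2 - q.2))%R.
pose d p q := ((f p - f q) ^+ 2 * K (p.1 - q.1, p.2 - q.2))%R.
have ma : measurable_fun setT (fun z : (R * R) * (R * R) => a z.1 z.2) by rewrite /a /K; mea.
have mb : measurable_fun setT (fun z : (R * R) * (R * R) => b z.1 z.2) by rewrite /b /K; mea.
have mc : measurable_fun setT (fun z : (R * R) * (R * R) => c z.1 z.2) by rewrite /c /K; mea.
have md : measurable_fun setT (fun z : (R * R) * (R * R) => d z.1 z.2) by rewrite /d /K; mea.
have a0 p q : (0 <= a p q)%R by rewrite mulr_ge0 ?sqr_ge0.
have b0 p q : (0 <= b p q)%R by rewrite mulr_ge0 ?sqr_ge0.
have d0 p q : (0 <= d p q)%R by rewrite mulr_ge0 ?sqr_ge0.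
have ia : \int[leb2]_p \int[leb2]_q (a p q)%:E = (M * r)%:E.
  transitivity (\int[leb2]_p (M * f p ^+ 2)%:E).
    apply: eq_integral => p _; rewrite /a intZ//; [|by rewrite /K; mea|exact: sqr_ge0].
    under eq_integral do rewrite Ke.
    by rewrite int_KN_shift// -EFinM mulrC.
  by rewrite intZ//; [rewrite -/(N2 f) fr EFinM|mea|move=> p; exact: sqr_ge0].
have ib : \int[leb2]_p \int[leb2]_q (b p q)%:E = (M * r)%:E.
  rewrite (leb2_swap mb b0).
  transitivity (\int[leb2]_q (M * f q ^+ 2)%:E).
    apply: eq_integral => q _; rewrite /b intZ//; [|by rewrite /K; mea|exact: sqr_ge0].
    by rewrite int_KN_shift// -EFinM mulrC.
  by rewrite intZ//; [rewrite -/(N2 f) fr EFinM|mea|move=> p; exact: sqr_ge0].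
have idE : \int[leb2]_p \int[leb2]_q (d p q)%:E = \int[leb2]_t ((K t)%:E * modulus f t).
  rewrite (leb2_swap md d0).
  pose D q t := (K t * (f (q.1 + t.1, q.2 + t.2) - f q) ^+ 2)%R.
  transitivity (\int[leb2]_q \int[leb2]_t (D q t)%:E).
    apply: eq_integral => q _.
    rewrite -(int2_shift q.1 q.2 (f := fun p => (d p q)%:E)); last by rewrite /d /K; mea.
    apply: eq_integral => t _; rewrite /D /d /= !addrK mulrC.
    by rewrite ![(t.1 + _)%R]addrC ![(t.2 + _)%R]addrC; case: t.
  rewrite (@leb2_swap D); last first.
  - by move=> q t; rewrite mulr_ge0 ?sqr_ge0.
  - by rewrite /D /K; mea.
  by apply: eq_integral => t _; rewrite /D intZ//; [mea|move=> p; exact: sqr_ge0].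
have Ia : (leb2 \x leb2)%E.-integrable setT (fun z => (a z.1 z.2)%:E).
  by apply: integrable_prod_ge0 => //; rewrite ia ltry.
have Ib : (leb2 \x leb2)%E.-integrable setT (fun z => (b z.1 z.2)%:E).
  by apply: integrable_prod_ge0 => //; rewrite ib ltry.
have Iab := integrableD measurableT Ia Ib.
have Iab2 := integrableZl measurableT 2%R Iab.
have Id : (leb2 \x leb2)%E.-integrable setT (fun z => (d z.1 z.2)%:E).
  apply: (@integrable_le _ _ _ (leb2 \x leb2)%E (fun z => d z.1 z.2)
    (fun z => (2 * (a z.1 z.2 + b z.1 z.2))%R)) => //.
  move=> z; rewrite ger0_norm// /d /a /b -mulrDl mulrA ler_wpM2r//.
  by have := sqr_ge0 (f z.1 + f z.2)%R; nra.
have Ic : (leb2 \x leb2)%E.-integrable setT (fun z => (c z.1 z.2)%:E).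
  apply: (@integrable_le _ _ _ (leb2 \x leb2)%E (fun z => c z.1 z.2)
    (fun z => (a z.1 z.2 + b z.1 z.2)%R)) => //.
  move=> z; rewrite /c /a /b -mulrDl normrM (ger0_norm (K0 _)) ler_wpM2r// ler_norml.
  have := sqr_ge0 (f z.1 + f z.2)%R; have := sqr_ge0 (f z.1 - f z.2)%R.
  have := sqr_ge0 (f z.1); have := sqr_ge0 (f z.2).
  by move=> ? ? ? ?; apply/andP; split; nra.
have doo : \int[leb2]_p \int[leb2]_q (d p q)%:E < +oo.
  have <- : \int[(leb2 \x leb2)%E]_z (d z.1 z.2)%:E = \int[leb2]_p \int[leb2]_q (d p q)%:E.
    apply: (@fubini_tonelli1 _ _ _ _ R leb2 leb2 (fun z => (d z.1 z.2)%:E)); first by mea.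
    by move=> z; rewrite lee_fin.
  exact: (integrable_lty measurableT Id).
have WE : (\int[leb2]_k (damp e k * ft2 f k) = \int[(leb2 \x leb2)%E]_z c z.1 z.2)%R.
  rewrite Rint_damp_ft2// (Rintegral_prod (m1 := leb2) (m2 := leb2) Ic).
  apply: eq_Rintegral => p _; apply: eq_Rintegral => q _; rewrite /c /K /KN /poisson_cut /=.
  have [->|fp] := eqVneq (f p) 0%R; first by rewrite !mul0r.
  have [->|fq] := eqVneq (f q) 0%R; first by rewrite mulr0 !mul0r.
  (* Where f(p) f(q) is nonzero both points lie in the box, and cutting the kernel at 2 n changes
     nothing. *)
  have /andP[p1 p2] := fn _ fp; have /andP[q1 q2] := fn _ fq.
  have h (x y : R) : (`|x| <= n -> `|y| <= n -> `|x - y| <= 2 * n)%R.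
    by move=> hx hy; rewrite (le_trans (ler_normB _ _))//; lra.
  by rewrite !h.
rewrite -int_damp_ft2_EFin// WE -idE fr -EFinM.
rewrite -(Rintegral_prod_ge0 md d0 doo) -EFinM -EFinD; congr EFin.
have E1 : (\int[(leb2 \x leb2)%E]_z a z.1 z.2 = M * r)%R.
  by apply: EFin_inj; rewrite Rintegral_prod_ge0 ?ia ?ltry.
have E2 : (\int[(leb2 \x leb2)%E]_z b z.1 z.2 = M * r)%R.
  by apply: EFin_inj; rewrite Rintegral_prod_ge0 ?ib ?ltry.
rewrite -RintegralZl//; rewrite -RintegralD//; last exact: (integrableZl measurableT 2%R Ic).
transitivity (\int[(leb2 \x leb2)%E]_z (a z.1 z.2 + b z.1 z.2))%R.
  by apply: eq_Rintegral => z _; rewrite /a /b /c /d; ring.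
by rewrite RintegralD// E1 E2; ring.
Qed.

Lemma ler_atan_pihalf (x : R) : (4 * atan x <= 2 * pi)%R.
Proof. by have := atan_ltpi2 x => h; lra. Qed.

(** The modulus term of [damp_identity] is nonnegative and is dropped, and 4 atan <= 2 pi. On the
    box of half-side N, damping with e = 1 / (2 (N + 1)) is at least exp(-1): this is the factor
    [expR 1]. *)
Lemma plancherel_le f : cl2 f -> \int[leb2]_k (ft2 f k)%:E <= (expR 1 * (2 * pi) ^+ 2)%:E * N2 f.
Proof.
move=> cf; have [mf foo [n0 fn0]] := cf.
pose n := (`|n0| + 1)%R; have n0' : (0 < n)%R by rewrite ltr_wpDl.
have fn p : f p != 0%R -> inbox n p.
  move=> /fn0 /andP[h1 h2]; have := ler_norm n0 => h0.
  by apply/andP; split; rewrite /n; lra.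
have mft := measurable_ft2 mf.
apply: int_le_exhaust => //; first by move=> k; exact: ft2_ge0.
move=> N; pose e : R := (2 * N.+1%:R)^-1%R.
have e0 : (0 < e)%R by rewrite invr_gt0 mulr_gt0.
have eN : (e * N%:R <= 2^-1)%R.
  rewrite /e invfM -mulrA ler_piMr// ler_pdivrMl// mulr1 ler_nat//.
have md := measurable_damp e; have mb := measurable_inbox N%:R.
apply: (@le_trans _ _ (\int[leb2]_k (expR 1 * (damp e k * ft2 f k))%:E)).
  apply: le_int; [by mea|by mea| |].
    by move=> k; case: ifP => // _; exact: ft2_ge0.
  move=> k; case: ifPn => [/andP[k1 k2]|_]; last first.
    by rewrite !mulr_ge0 ?expR_ge0 ?damp_ge0 ?ft2_ge0.
  rewrite mulrA ler_peMl ?ft2_ge0// /damp -!expRD -[leLHS]expR0 ler_expR.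
  have := ler_wpM2l (ltW e0) k1; have := ler_wpM2l (ltW e0) k2; lra.
rewrite intZ ?expR_ge0//; [|by mea|by move=> k; rewrite mulr_ge0 ?damp_ge0 ?ft2_ge0].
rewrite EFinM -muleA lee_pmul2l ?lte_fin ?expR_gt0//.
have := damp_identity cf n0' e0 fn; set I := \int[leb2]_k _; set J := \int[leb2]_k _ => IJ.
have I0 : 0 <= I by apply: int_ge0 => k; rewrite mulr_ge0 ?damp_ge0 ?ft2_ge0.
have J0 : 0 <= J.
  by apply: integral_ge0 => t _; rewrite mule_ge0 ?lee_fin ?KN_ge0// N2_ge0.
have : 2%:E * I <= 2%:E * ((2 * pi) ^+ 2)%:E * N2 f.
  apply: (@le_trans _ _ (2%:E * I + J)); first by rewrite leeDl.
  rewrite IJ -EFinM lee_wpmul2r ?N2_ge0// lee_fin ler_pM2l//.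
  rewrite lerXn2r ?nnegrE ?ler_atan_pihalf ?mulr_ge0 ?pi_ge0//.
  by rewrite -[leLHS]atan0; apply: le_atan; rewrite divr_ge0 ?mulr_ge0// ltW.
by rewrite -muleA lee_pmul2l.
Qed.

(** For e <= 2 n the mass of the kernel is at least (4 atan 1)^2 = pi^2. The modulus term tends to 0
    with e: for small t by continuity of translations, for large t because the kernel is there of
    order e. *)
Lemma plancherel_ge f : cl2 f -> (pi ^+ 2)%:E * N2 f <= \int[leb2]_k (ft2 f k)%:E.
Proof.
move=> cf; have [mf foo [n0 fn0]] := cf.
pose n := (`|n0| + 1)%R; have n0' : (0 < n)%R by rewrite ltr_wpDl.
have fn p : f p != 0%R -> inbox n p.
  move=> /fn0 /andP[h1 h2]; have := ler_norm n0 => h0.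
  by apply/andP; split; rewrite /n; lra.
have mft := measurable_ft2 mf.
have tc : translation_continuous f.
  by apply: (@translation_continuous_L2 _ n) => // p /fn /andP[].
have [r fr] : exists r, N2 f = r%:E by exists (fine (N2 f)); rewrite fineK// ge0_fin_numE// N2_ge0.
have r0 : (0 <= r)%R by rewrite -lee_fin -fr N2_ge0.
set I := \int[leb2]_k _.
suff H : forall g : R, (0 < g)%R -> 2%:E * (pi ^+ 2)%:E * r%:E <= 2%:E * I + g%:E.
  have : 2%:E * ((pi ^+ 2)%:E * r%:E) <= 2%:E * I.
    by rewrite muleA; apply/lee_addgt0Pr => g g0; exact: H.
  by rewrite lee_pmul2l// fr.
move=> g g0.
have p0 : (0 < pi :> R)%R by exact: pi_gt0.
(* The kernel has mass at most (2 pi)^2, so the part with small t contributes at most g / 2. *)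
pose eps := (g / 2 / (2 * pi) ^+ 2)%R.
have eps0 : (0 < eps)%R by rewrite !divr_gt0// exprn_gt0// mulr_gt0.
have [d [d0 dE]] := tc _ eps0.
(* [e * A] will bound the part where some |t_j| exceeds [d]: modulus at most 4 r, one kernel factor
   at most 2 e / d^2, and the mass of [L] below with M <= 2 pi. *)
pose A := (4 * r * (2 / d ^+ 2 * (2 * (2 * pi * (2 * (2 * n))))))%R.
have A0 : (0 <= A)%R by rewrite /A !mulr_ge0 ?invr_ge0 ?sqr_ge0//; lra.
pose e := Order.min (2 * n)%R (g / 2 / (A + 1))%R.
have e0 : (0 < e)%R by rewrite lt_min mulr_gt0//= !divr_gt0// ltr_wpDl.
have eA : (e * A <= g / 2)%R.
  have : (e <= g / 2 / (A + 1))%R by rewrite ge_min lexx orbT.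
  by rewrite ler_pdivlMr ?ltr_wpDl//; nra.
have eN : (e <= 2 * n)%R by rewrite ge_min lexx.
have Nn0 : (0 < 2 * n)%R by rewrite mulr_gt0.
pose M := (4 * atan (2 * n / e))%R.
have M1 : (pi <= M)%R.
  have : (atan 1 <= atan (2 * n / e))%R by apply: le_atan; rewrite ler_pdivlMr// mul1r.
  by rewrite atan1 /M; lra.
have M2 : (M <= 2 * pi)%R by exact: ler_atan_pihalf.
have := damp_identity cf n0' e0 fn; rewrite -/M fr => ID.
pose c (x : R) : R := (if `|x| <= 2 * n then 1 else 0)%R.
have mc : measurable_fun setT c by rewrite /c; mea.
have c0 x : (0 <= c x)%R by rewrite /c; case: ifP.
have intc : \int[mu]_x (c x)%:E = (2 * (2 * n))%:E.
  transitivity (mu `[(- (2 * n))%R, (2 * n)%R]%classic).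
    rewrite -[X in _ = mu X]setIT -integral_indic//; apply: eq_integral => x _.
    by rewrite /= indicE mem_setE in_itv/= -ler_norml /c; case: ifP.
  rewrite lebesgue_measure_itv/= lte_fin ifT; last by lra.
  by rewrite -EFinB; congr EFin; ring.
pose pc := poisson_cut (2 * n) e.
have mpc : measurable_fun setT pc by exact: measurable_poisson_cut.
have pc0 x : (0 <= pc x)%R by exact: poisson_cut_ge0.
have intpc : \int[mu]_x (pc x)%:E = M%:E by exact: int_poisson_cut.
(* Majorant for large t: the coordinate that exceeds [d] keeps only the indicator [c] of the cut,
   the other one its kernel. *)
pose L (t : R * R) := (pc t.1 * c t.2 + c t.1 * pc t.2)%R.
have mL : measurable_fun setT L by rewrite /L; mea.
have L0 t : (0 <= L t)%R by rewrite /L addr_ge0 ?mulr_ge0.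
have intL : \int[leb2]_t (L t)%:E = (2 * (M * (2 * (2 * n))))%:E.
  rewrite /L intD; [|by mea|by mea|by move=> t; rewrite mulr_ge0|by move=> t; rewrite mulr_ge0].
  rewrite (int_prod_le _ _ _ _ intpc intc)//.
  rewrite (int_prod_le _ _ _ _ intc intpc)// -EFinD; congr EFin; ring.
have pcd x : (d < `|x| -> pc x <= 2 * e / d ^+ 2 * c x)%R.
  move=> dx; rewrite /pc /c /poisson_cut; case: ifP; rewrite ?mulr0// mulr1 => _.
  by apply: poisson_tail => //; exact: ltW.
pose B := (2 * e / d ^+ 2)%R.
have B0 : (0 <= B)%R by rewrite /B !mulr_ge0 ?invr_ge0 ?sqr_ge0// ltW.
pose K := KN (2 * n) e.
have mK : measurable_fun setT K by exact: measurable_KN.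
have K0 t : (0 <= K t)%R by exact: KN_ge0.
have KL t : (~~ ((`|t.1| <= d) && (`|t.2| <= d)) -> K t <= B * L t)%R.
  rewrite negb_and -!ltNge => /orP[] /pcd h; rewrite /K /KN -/pc /L mulrDr.
  - apply: (@le_trans _ _ (B * c t.1 * pc t.2)%R); first by rewrite ler_wpM2r.
    by rewrite -mulrA lerDr; apply: mulr_ge0 => //; exact: mulr_ge0.
  - apply: (@le_trans _ _ (pc t.1 * (B * c t.2))%R); first by rewrite ler_wpM2l.
    by rewrite mulrCA lerDl; apply: mulr_ge0 => //; exact: mulr_ge0.
have J1 : \int[leb2]_t ((KN (2 * n) e t)%:E * modulus f t) <= g%:E.
  apply: (@le_trans _ _ (\int[leb2]_t (eps * K t + 4 * r * B * L t)%:E)).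
    apply: ge0_le_integral => //.
    - by move=> t _; rewrite mule_ge0 ?lee_fin ?KN_ge0// N2_ge0.
    - have mm := measurable_modulus mf.
      by apply: emeasurable_funM => //; exact/measurable_EFinP.
    - by mea.
    - move=> t _; case: (boolP ((`|t.1| <= d) && (`|t.2| <= d))%R) => [/andP[t1 t2]|/KL td].
        apply: (@le_trans _ _ ((K t)%:E * eps%:E)).
          by rewrite lee_wpmul2l ?lee_fin ?K0// dE.
        rewrite -EFinM lee_fin mulrC lerDl; apply: mulr_ge0 => //.
        by apply: mulr_ge0 => //; apply: mulr_ge0.
      apply: (@le_trans _ _ ((K t)%:E * (4 * r)%:E)).
        by rewrite lee_wpmul2l ?lee_fin ?K0// EFinM -fr modulus_le.
      rewrite -EFinM lee_fin (@le_trans _ _ (4 * r * B * L t)%R)//.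
        by rewrite mulrC -mulrA ler_wpM2l// mulr_ge0.
      by rewrite lerDr mulr_ge0// ltW.
  rewrite intD//; [|by mea|by mea|by move=> t; rewrite mulr_ge0// ltW|
    by move=> t; apply: mulr_ge0 => //; apply: mulr_ge0 => //; apply: mulr_ge0].
  rewrite intZ//; last exact: ltW.
  rewrite intZ//; last by apply: mulr_ge0 => //; apply: mulr_ge0.
  rewrite intL int_KN// -/M -EFinM -EFinM -EFinD lee_fin.
  have h1 : (eps * M ^+ 2 <= g / 2)%R.
    rewrite /eps mulrAC ler_pdivrMr ?exprn_gt0 ?mulr_gt0//.
    rewrite ler_wpM2l//; first by rewrite ltW// divr_gt0.
    by rewrite lerXn2r// nnegrE; lra.
  have h2 : (4 * r * B * (2 * (M * (2 * (2 * n)))) <= e * A)%R.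
    rewrite [leRHS](_ : _ = 4 * r * B * (2 * ((2 * pi) * (2 * (2 * n)))))%R; last first.
      by rewrite /A /B; field; rewrite gt_eqF.
    apply: ler_wpM2l; first by apply: mulr_ge0 => //; apply: mulr_ge0.
    by rewrite ler_wpM2l// ler_wpM2r//; lra.
  lra.
have I2 : \int[leb2]_k (damp e k * ft2 f k)%:E <= I.
  have mdp := measurable_damp e.
  apply: le_int; [by mea|by mea| |].
    by move=> k; rewrite mulr_ge0 ?damp_ge0 ?ft2_ge0.
  by move=> k; rewrite ler_piMl ?ft2_ge0 ?damp_le1.
apply: (@le_trans _ _ ((2 * M ^+ 2)%:E * r%:E)).
  rewrite -!EFinM lee_fin ler_wpM2r// ler_wpM2l// lerXn2r// nnegrE; lra.
by rewrite -ID leeD// lee_wpmul2l.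
Qed.

End plancherel.

(** * Fourier multipliers and their symbols *)

Section multipliers.
Variable R : realType.
Local Notation mu := (@lebesgue_measure R).
Local Notation leb2 := (@leb2 R).
Implicit Types (f g u : R * R -> R) (t p k : R * R).
Local Open Scope ereal_scope.

(** [m] is the squared modulus of the Fourier multiplier. Boundedness and locality are the two
    properties that let estimates pass from truncations to L^2 functions; the range [rho] may depend
    on the operator. *)
Record multiplier (T : (R * R -> R) -> R * R -> R) (m : R * R -> R) : Prop := Multiplier {
  mult_meas : measurable_fun setT m;
  mult_ge0 : forall k, (0 <= m k)%R;
  mult_bounded : exists B : R, forall k, (m k <= B)%R;
  mult_measurable : forall f, measurable_fun setT f -> measurable_fun setT (T f);
  mult_cl2 : forall f, cl2 f -> cl2 (T f);
  mult_ft2 : forall f k, cl2 f -> ft2 (T f) k = (m k * ft2 f k)%R;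
  mult_local : exists rho : R, forall (n : R) f g,
    (forall p, inbox (n + rho)%R p -> f p = g p) -> forall p, inbox n p -> T f p = T g p }.

Lemma multiplier_comp S T ms mt : multiplier S ms -> multiplier T mt ->
  multiplier (S \o T) (fun k => (ms k * mt k)%R).
Proof.
move=> HS HT; split => /=.
- by have := mult_meas HS; have := mult_meas HT => ? ?; mea.
- by move=> k; rewrite mulr_ge0 ?(mult_ge0 HS) ?(mult_ge0 HT).
- have [B SB] := mult_bounded HS; have [D TD] := mult_bounded HT.
  by exists (B * D)%R => k; rewrite ler_pM ?(mult_ge0 HS) ?(mult_ge0 HT).
- by move=> f mf; apply: (mult_measurable HS); exact: (mult_measurable HT).
- by move=> f cf; apply: (mult_cl2 HS); exact: (mult_cl2 HT).
- by move=> f k cf; rewrite (mult_ft2 HS) ?(mult_ft2 HT) ?mulrA//; exact: (mult_cl2 HT).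
- have [a Sa] := mult_local HS; have [b Tb] := mult_local HT.
  exists (a + b)%R => n f g fg p pn; apply: (Sa n) => // q qn; apply: (Tb (n + a)%R) => // z zn.
  by apply: fg; rewrite addrA.
Qed.

Lemma measurable_trunc u n : measurable_fun setT u -> measurable_fun setT (trunc u n).
Proof. by move=> mu_; rewrite /trunc; mea. Qed.

Lemma cl2_trunc u n : L2 u -> cl2 (trunc u n).
Proof.
move=> [mu_ uoo]; have mt := measurable_trunc n mu_; split => //.
  apply: le_lt_trans uoo; apply: le_int; [by mea|by mea|by move=> p; exact: sqr_ge0|].
  by move=> p; rewrite /trunc; case: ifP => // _; rewrite expr0n/= sqr_ge0.
by exists n%:R => p; rewrite /trunc -/(inbox n%:R p); case: ifP => //; rewrite eqxx.
Qed.

(** On a box, [T u] agrees with [T (trunc u N)] for large N, and the lower Plancherel bound applies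
    to the latter. Replacing the transform of the truncation by that of [u] costs a factor 2, from
    (x + y)^2 <= 2 x^2 + 2 y^2, and an error that tends to 0 because [m] is bounded. *)
Lemma N2_mult_le T m u Fr Fi : multiplier T m -> L2 u -> is_FT u Fr Fi ->
  N2 (T u) <= (2 / pi ^+ 2)%:E * \int[leb2]_k (m k * FTsq Fr Fi k)%:E.
Proof.
move=> HT uL2 [mFr mFi uF]; have [mu_ _] := uL2.
have mm := mult_meas HT; have m0 := mult_ge0 HT; have [B mB] := mult_bounded HT.
have mTu := mult_measurable HT mu_; have [rho loc] := mult_local HT.
have p2 : (0 < pi ^+ 2 :> R)%R by rewrite exprn_gt0// pi_gt0.
apply: int_le_exhaust; [by mea|by move=> p; exact: sqr_ge0|] => n.
set Z := \int[leb2]_k (m k * _)%:E.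
have Z0 : 0 <= Z by apply: int_ge0 => k; rewrite mulr_ge0// /FTsq addr_ge0 ?sqr_ge0.
pose D (N : nat) k := ((Fr k - FTre (trunc u N) k) ^+ 2 + (Fi k - FTim (trunc u N) k) ^+ 2)%R.
have B0 : (0 <= B)%R by rewrite (le_trans (m0 (0, 0)%R)).
have step (N : nat) : (n%:R + rho <= N%:R)%R ->
    \int[leb2]_p (if inbox n%:R p then T u p ^+ 2 else 0)%:E <=
    (2 / pi ^+ 2)%:E * Z + (2 / pi ^+ 2 * B)%:E * \int[leb2]_k (D N k)%:E.
  move=> nN; have cN := cl2_trunc N uL2; have cTN := mult_cl2 HT cN.
  have [mTN _ _] := cTN; have mbn := measurable_inbox (n%:R : R).
  have mN : measurable_fun setT (trunc u N) by have [] := cN.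
  have mc := measurable_FTre mN; have ms := measurable_FTim mN.
  have mD : measurable_fun setT (D N) by rewrite /D; mea.
  have D0 k : (0 <= D N k)%R by rewrite addr_ge0 ?sqr_ge0.
  have mS : measurable_fun setT (FTsq Fr Fi) by rewrite /FTsq; mea.
  have S0 k : (0 <= FTsq Fr Fi k)%R by rewrite /FTsq addr_ge0 ?sqr_ge0.
  apply: (@le_trans _ _ (N2 (T (trunc u N)))).
    apply: le_int; [by mea|by mea|by move=> p; case: ifP => // _; exact: sqr_ge0|].
    move=> p; case: ifPn => [pn|_]; last exact: sqr_ge0.
    rewrite (loc n%:R u (trunc u N))// => q /andP[q1 q2].
    by rewrite /trunc (le_trans q1 nN) (le_trans q2 nN).
  have : (pi ^+ 2)%:E * N2 (T (trunc u N)) <=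
      2%:E * Z + 2%:E * (B%:E * \int[leb2]_k (D N k)%:E).
    apply: (le_trans (plancherel_ge cTN)).
    rewrite /Z -!intZ//; [|by mea|by move=> k; rewrite mulr_ge0|by mea|by move=> k; rewrite mulr_ge0].
    rewrite -intD; [|by mea|by mea|by move=> k; rewrite !mulr_ge0|by move=> k; rewrite !mulr_ge0].
    have mf2 := measurable_ft2 mTN.
    apply: le_int; [by mea|by mea|by move=> k; exact: ft2_ge0|] => k.
    rewrite (mult_ft2 HT)//.
    apply: (@le_trans _ _ (m k * (2 * FTsq Fr Fi k + 2 * D N k))%R).
      apply: ler_wpM2l => //; rewrite /ft2 /FTsq /D.
      have h (x y : R) : (y ^+ 2 <= 2 * x ^+ 2 + 2 * (x - y) ^+ 2)%R.
        by have := sqr_ge0 (2 * x - y)%R; nra.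
      by have := h (Fr k) (FTre (trunc u N) k); have := h (Fi k) (FTim (trunc u N) k); lra.
    by have := mB k; have := D0 k; nra.
  move=> H; rewrite -(@lee_pmul2l _ (pi ^+ 2)%:E)// ?lte_fin//.
  apply: (le_trans H); have D0' := int_ge0 leb2 D0; have q0 : (0 <= 2 / pi ^+ 2 :> R)%R.
    by rewrite divr_ge0// ltW.
  rewrite [leRHS]ge0_muleDr; [|exact: mule_ge0|by apply: mule_ge0 => //; rewrite lee_fin mulr_ge0].
  have pE : (pi ^+ 2 * (2 / pi ^+ 2) = 2 :> R)%R by rewrite mulrC divfK// gt_eqF.
  rewrite !muleA -!EFinM leeD//.
    by rewrite pE.
  by rewrite mulrA pE.
apply/lee_addgt0Pr => e e0.
pose c := (2 / pi ^+ 2 * B)%R; have c0 : (0 <= c)%R by rewrite /c mulr_ge0// divr_ge0// ltW.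
have e1 : (0 < e / (c + 1))%R by rewrite divr_gt0// ltr_wpDl.
have /fine_cvgP[_ /cvgrPdist_lt /(_ _ e1)] := uF; rewrite /= => -[N1 _ HN1].
have /fine_cvgP[[N2 _ HN2] _] := uF.
(* [N1] makes the distance between the transforms small, the index [N2] makes it finite, and the
   last argument puts the enlarged box inside the truncation. *)
pose N := maxn (maxn N1 N2) (Num.truncn (n%:R + rho)).+1.
have nN : (n%:R + rho <= N%:R)%R.
  apply: (@le_trans _ _ (Num.truncn (n%:R + rho)).+1%:R%R); first by rewrite ltW// truncnS_gt.
  by rewrite ler_nat leq_maxr.
have N1N : (N1 <= N)%N by rewrite /N !leq_max leqnn.
have N2N : (N2 <= N)%N by rewrite /N !leq_max leqnn orbT.
apply: (le_trans (step _ nN)); rewrite leeD2l//.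
have fD : \int[leb2]_k (D N k)%:E \is a fin_num by exact: HN2.
have := HN1 _ N1N; rewrite /= sub0r normrN -(fineK fD) -EFinM lee_fin -/c /=.
have D0' : 0 <= \int[leb2]_k (D N k)%:E by apply: int_ge0 => k; rewrite addr_ge0 ?sqr_ge0.
rewrite -/(D N); set d := fine _ => dE; have {}dE : (d < e / (c + 1))%R by apply: le_lt_trans dE; exact: ler_norm.
rewrite ltr_pdivlMr ?ltr_wpDl// in dE.
have d0 : (0 <= d)%R by rewrite fine_ge0.
nra.
Qed.

Lemma Rint_shift2 (a b : R) (h : R * R -> R) : measurable_fun setT h ->
  (\int[leb2]_p h (p.1 + a, p.2 + b) = \int[leb2]_p h p)%R.
Proof.
move=> mh; rewrite /Rintegral; congr fine.
by apply: (int2_shift a b (f := EFin \o h)); rewrite /comp; mea.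
Qed.

Lemma FTre_trans f t k : leb2.-integrable setT (EFin \o f) ->
  (FTre (trans t f) k = cos (t.1 * k.1 + t.2 * k.2) * FTre f k +
    sin (t.1 * k.1 + t.2 * k.2) * FTsin f k)%R.
Proof.
move=> fi; have mf : measurable_fun setT f.
  by apply/measurable_EFinP; exact: (measurable_int _ fi).
rewrite FT_lin// -[RHS](Rint_shift2 t.1 t.2); last by mea.
apply: eq_Rintegral => p _ /=; rewrite /trans; congr (_ * _)%R.
by rewrite -cosB -cosN; congr cos; ring.
Qed.

Lemma FTsin_trans f t k : leb2.-integrable setT (EFin \o f) ->
  (FTsin (trans t f) k = - sin (t.1 * k.1 + t.2 * k.2) * FTre f k +
    cos (t.1 * k.1 + t.2 * k.2) * FTsin f k)%R.
Proof.
move=> fi; have mf : measurable_fun setT f.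
  by apply/measurable_EFinP; exact: (measurable_int _ fi).
rewrite FT_lin// -[RHS](Rint_shift2 t.1 t.2); last by mea.
apply: eq_Rintegral => p _ /=; rewrite /trans; congr (_ * _)%R.
set s := (t.1 * _ + _)%R; set x := (p.1 * _ + _)%R.
rewrite (_ : (p.1 + t.1) * k.1 + _ = x + s)%R; last by rewrite /x /s; ring.
have e : x = (x + s - s)%R by rewrite addrK.
by rewrite {1}e sinB; ring.
Qed.

Definition fdiff t f p : R := (trans t f p - f p)%R.

(** The squared modulus of exp(i t.k) - 1. *)
Definition diff_symbol t k : R := (2 - 2 * cos (t.1 * k.1 + t.2 * k.2))%R.

Lemma integrable_trans t f : leb2.-integrable setT (EFin \o f) ->
  leb2.-integrable setT (EFin \o trans t f).
Proof.
move=> fi; have mf : measurable_fun setT f.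
  by apply/measurable_EFinP; exact: (measurable_int _ fi).
apply: integrable_ltoo; first exact: measurable_trans.
rewrite (int2_shift t.1 t.2 (f := fun p => `|f p|%:E)); last by mea.
by have /integrableP[] := fi.
Qed.

Lemma FTre_diff f t k : leb2.-integrable setT (EFin \o f) ->
  FTre (fdiff t f) k = (FTre (trans t f) k - FTre f k)%R.
Proof.
move=> fi; have ti := integrable_trans t fi.
rewrite /FTre -RintegralB//; [|exact: integrable_cos|exact: integrable_cos].
by apply: eq_Rintegral => p _; rewrite /fdiff mulrBl.
Qed.

Lemma FTsin_diff f t k : leb2.-integrable setT (EFin \o f) ->
  FTsin (fdiff t f) k = (FTsin (trans t f) k - FTsin f k)%R.
Proof.
move=> fi; have ti := integrable_trans t fi.
rewrite /FTsin -RintegralB//; [|exact: integrable_sin|exact: integrable_sin].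
by apply: eq_Rintegral => p _; rewrite /fdiff mulrBl.
Qed.

Lemma measurable_diff f t : measurable_fun setT f -> measurable_fun setT (fdiff t f).
Proof. by move=> mf; have := measurable_trans t mf => ?; rewrite /fdiff; mea. Qed.

Lemma cl2_diff f t : cl2 f -> cl2 (fdiff t f).
Proof.
move=> [mf foo [n fn]]; split; first exact: measurable_diff.
- apply: le_lt_trans (modulus_le t mf) _.
  by rewrite lte_mul_pinfty// ge0_fin_numE// N2_ge0.
- exists (n + `|t.1| + `|t.2|)%R => p.
  have [fp|/fn /andP[p1 p2] _] := eqVneq (f p) 0%R; last first.
    by apply/andP; split; [have := normr_ge0 t.1|have := normr_ge0 t.1]; have := normr_ge0 t.2; lra.
  rewrite /fdiff fp subr0 => /fn /andP[/= p1 p2].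
  have h1 := ler_normB (p.1 + t.1)%R t.1; have h2 := ler_normB (p.2 + t.2)%R t.2.
  rewrite !addrK in h1 h2.
  by apply/andP; split; have := normr_ge0 t.1; have := normr_ge0 t.2; lra.
Qed.

Lemma diff_symbol_ge0 t k : (0 <= diff_symbol t k)%R.
Proof. by rewrite /diff_symbol; have := cos_le1 (t.1 * k.1 + t.2 * k.2); lra. Qed.

Lemma diff_symbol_le4 t k : (diff_symbol t k <= 4)%R.
Proof. by rewrite /diff_symbol; have := cos_geN1 (t.1 * k.1 + t.2 * k.2); lra. Qed.

Lemma multiplier_diff t : multiplier (fdiff t) (diff_symbol t).
Proof.
split.
- by rewrite /diff_symbol; mea.
- exact: diff_symbol_ge0.
- by exists 4%R; exact: diff_symbol_le4.
- by move=> f; exact: measurable_diff.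
- by move=> f; exact: cl2_diff.
- move=> f k /cl2_integrable fi; rewrite !ft2E FTre_diff// FTsin_diff// FTre_trans// FTsin_trans//.
  rewrite /diff_symbol; set s := (t.1 * _ + _)%R; have := cos2Dsin2 s.
  set c := cos s; set d := sin s; set x := FTre f k; set y := FTsin f k => cd.
  transitivity ((c ^+ 2 + d ^+ 2 + 1 - 2 * c) * (x ^+ 2 + y ^+ 2))%R; first ring.
  by rewrite cd; ring.
- exists (`|t.1| + `|t.2|)%R => n f g fg p /andP[p1 p2].
  have := normr_ge0 t.1; have := normr_ge0 t.2 => t2 t1.
  rewrite /fdiff /trans !fg//; apply/andP; split => /=; try lra.
  + by rewrite (le_trans (ler_normD _ _))//; lra.
  + by rewrite (le_trans (ler_normD _ _))//; lra.
Qed.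

(** The range of integration is written as a condition in the integrand, so that joint measurability
    in [t] and [p] follows from that of a single integrand on the whole line. For negative [t] the
    value is 0. *)
Definition primx (t : R) f p : R := (\int[mu]_s (if (0 <= s <= t) then f (p.1 + s, p.2) else 0))%R.

(** The squared modulus of the integral of exp(i s xi) over 0 <= s <= t. In this form it is also
    correct at xi = 0. *)
Definition primx_symbol (t : R) k : R := ((\int[mu]_s (if (0 <= s <= t) then cos (s * k.1) else 0)) ^+ 2 +
  (\int[mu]_s (if (0 <= s <= t) then sin (s * k.1) else 0)) ^+ 2)%R.

Lemma int_if (a b : R) (F : R -> \bar R) :
  \int[mu]_s (if (a <= s <= b)%R then F s else 0) = \int[mu]_(s in `[a, b]) F s.
Proof.
rewrite [RHS]integral_mkcond; apply: eq_integral => s _.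
by rewrite patchE mem_setE in_itv.
Qed.

Lemma Rint_if (a b : R) (F : R -> R) :
  (\int[mu]_s (if (a <= s <= b) then F s else 0) = \int[mu]_(s in `[a, b]) F s)%R.
Proof.
rewrite /Rintegral -(int_if a b (EFin \o F)); congr fine; apply: eq_integral => s _.
by rewrite /=; case: ifP.
Qed.

Lemma mu_itv (a b : R) : (a <= b)%R -> mu `[a, b]%classic = (b - a)%:E.
Proof.
move=> ab; rewrite lebesgue_measure_itv/= lte_fin.
by case: ltgtP ab => [_ _|//|-> _]; rewrite ?subrr// EFinB.
Qed.

Lemma sqr_Rint_if_le (a b : R) (F : R -> R) : (a < b)%R -> measurable_fun setT F ->
  ((\int[mu]_s (if (a <= s <= b) then F s else 0))%R ^+ 2)%:E <=
  (b - a)%:E * \int[mu]_s (if (a <= s <= b)%R then F s ^+ 2 else 0)%:E.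
Proof.
move=> ab mF; rewrite Rint_if.
have -> : \int[mu]_s (if (a <= s <= b)%R then F s ^+ 2 else 0)%:E =
    \int[mu]_(s in `[a, b]) (F s ^+ 2)%:E.
  by rewrite -int_if; apply: eq_integral => s _; case: ifP.
apply: (@sqr_Rintegral_le _ _ _ mu `[a, b]%classic (b - a)%R F) => //; first by rewrite subr_gt0.
by apply: mu_itv; exact: ltW.
Qed.

Lemma int_if_cst (a b c : R) : (a <= b)%R ->
  \int[mu]_s (if (a <= s <= b)%R then c else 0)%:E = (c * (b - a))%:E.
Proof.
move=> ab.
have -> : \int[mu]_s (if (a <= s <= b)%R then c else 0)%:E = \int[mu]_(s in `[a, b]) (cst c%:E) s.
  by rewrite -int_if; apply: eq_integral => s _; case: ifP.
by rewrite integral_cst//= [X in _ * X](mu_itv ab).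
Qed.

Lemma integrable_if_bounded (a b c : R) (F : R -> R) : (a <= b)%R -> measurable_fun setT F ->
  (forall s, (a <= s <= b)%R -> `|F s| <= c)%R ->
  mu.-integrable setT (EFin \o (fun s => if (a <= s <= b)%R then F s else 0%R)).
Proof.
move=> ab mF Fc; apply: (@integrable_le _ _ _ mu _ (fun s => if (a <= s <= b)%R then c else 0%R)).
- by mea.
- by move=> s; case: ifPn => [/Fc//|_]; rewrite normr0.
- apply: integrable_ltoo; first by mea.
  have -> : \int[mu]_s (`|if (a <= s <= b)%R then c else 0%R|)%:E =
      \int[mu]_s (if (a <= s <= b)%R then `|c|%R else 0)%:E.
    by apply: eq_integral => s _; case: ifP => //; rewrite normr0.
  by rewrite int_if_cst// ltry.
Qed.

Lemma measurable_primx f : measurable_fun setT f ->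
  measurable_fun setT (fun z : R * (R * R) => primx z.1 f z.2).
Proof.
move=> mf; apply: (measurable_Rparam_mu
  (F := fun (z : R * (R * R)) s => if (0 <= s <= z.1)%R then f (z.2.1 + s, z.2.2)%R else 0%R)).
by mea.
Qed.

Lemma measurable_primxt f (t : R) : measurable_fun setT f -> measurable_fun setT (primx t f).
Proof.
move=> mf; apply: (measurable_Rparam_mu
  (F := fun p s => if (0 <= s <= t)%R then f (p.1 + s, p.2)%R else 0%R)).
by mea.
Qed.

Lemma sqr_primx_le f (t : R) p : (0 < t)%R -> measurable_fun setT f ->
  (primx t f p ^+ 2)%:E <= t%:E * \int[mu]_s (if (0 <= s <= t)%R then f (p.1 + s, p.2)%R ^+ 2 else 0)%:E.
Proof.
move=> t0 mf; have := @sqr_Rint_if_le 0 t (fun s => f (p.1 + s, p.2)%R) t0.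
by rewrite subr0; apply; mea.
Qed.

(** Cauchy-Schwarz in s gives one factor t; Tonelli and translation invariance give the other. *)
Lemma N2_primx_le f (t : R) : (0 < t)%R -> measurable_fun setT f ->
  N2 (primx t f) <= (t ^+ 2)%:E * N2 f.
Proof.
move=> t0 mf; have mp := measurable_primxt t mf.
pose F p s : \bar R := (if (0 <= s <= t)%R then f (p.1 + s, p.2)%R ^+ 2 else 0)%:E.
have F0 p s : 0 <= F p s by rewrite /F lee_fin; case: ifP => // _; exact: sqr_ge0.
have mF : measurable_fun setT (fun z : (R * R) * R => F z.1 z.2) by rewrite /F; mea.
apply: (@le_trans _ _ (\int[leb2]_p (t%:E * \int[mu]_s F p s))).
  apply: ge0_le_integral => //.
  - by move=> p _; rewrite lee_fin sqr_ge0.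
  - by mea.
  - by apply: emeasurable_funM => //; exact: measurable_param_mu mF.
  - by move=> p _; exact: sqr_primx_le.
rewrite ge0_integralZl//; [|exact: measurable_param_mu mF|by move=> p _; exact: integral_ge0|by rewrite lee_fin ltW].
rewrite expr2 EFinM -muleA lee_pmul2l ?lte_fin//.
rewrite (@tonelli _ _ _ (measurableTypeR R) R leb2 mu F)//.
apply: (@le_trans _ _ (\int[mu]_s (if (0 <= s <= t)%R then N2 f else 0))).
  apply: ge0_le_integral => //.
  - by move=> s _; exact: integral_ge0.
  - apply: (measurable_param_leb2 (F := fun s p => F p s)).
    by rewrite /F; mea.
  - by apply: measurable_fun_ifT => //; mea.
  - move=> s _; rewrite /F; case: ifP => st; last by rewrite integral0.
    rewrite /N2 -(int2_shift s 0%R (f := fun p => (f p ^+ 2)%:E)); last by mea.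
    by under [leRHS]eq_integral do rewrite addr0.
by rewrite int_if integral_cst//= [X in _ * X](mu_itv (ltW t0)) subr0 muleC.
Qed.

Lemma Rint_primx f (h : R * R -> R) (t : R) : (0 < t)%R -> leb2.-integrable setT (EFin \o f) ->
  measurable_fun setT h -> (forall p, `|h p| <= 1)%R ->
  (\int[leb2]_p (primx t f p * h p) =
   \int[mu]_s (if (0 <= s <= t) then \int[leb2]_p (trans (s, 0) f p * h p) else 0))%R.
Proof.
move=> t0 fi mh h1; have mf : measurable_fun setT f.
  by apply/measurable_EFinP; exact: (measurable_int _ fi).
pose F p s := (if (0 <= s <= t) then f (p.1 + s, p.2) * h p else 0)%R.
have mF : measurable_fun setT (fun z : (R * R) * R => F z.1 z.2) by rewrite /F; mea.
have iF : (leb2 \x mu)%E.-integrable setT (fun z => (F z.1 z.2)%:E).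
  apply/(@integrable21ltyP _ _ _ (measurableTypeR R) R leb2 mu); first by mea.
  pose A := \int[leb2]_p `|f p|%:E.
  have Afin : A < +oo by have /integrableP[] := fi.
  have A0 : 0 <= A by apply: int_ge0 => p.
  apply: (@le_lt_trans _ _ (\int[mu]_s (if (0 <= s <= t)%R then A else 0))).
    apply: ge0_le_integral => //.
    - by move=> s _; exact: integral_ge0.
    - by apply: (measurable_param_leb2 (F := fun s p => `|(F p s)%:E|)); rewrite /F; mea.
    - by apply: measurable_fun_ifT => //; mea.
    - move=> s _; rewrite /F; case: ifP => st; last first.
        by under eq_integral do rewrite abse0; rewrite integral0.
      rewrite /A -(int2_shift s 0%R (f := fun p => `|f p|%:E)); last by mea.
      apply: le_int; [by mea|by mea|by []|] => p.
      by rewrite addr0 normrM ler_piMr.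
  rewrite int_if integral_cst//= [X in _ * X](mu_itv (ltW t0)) subr0 muleC.
  by rewrite lte_mul_pinfty// lee_fin ltW.
transitivity (\int[leb2]_p \int[mu]_s F p s)%R.
  rewrite {1}/Rintegral [in RHS]/Rintegral; congr fine; apply: ae_eq_integral => //.
  - by have := measurable_primxt t mf => ?; mea.
  - by apply/measurable_EFinP; exact: (measurable_Rparam_mu mF).
  have := @ae_integrable1 _ _ _ (measurableTypeR R) R leb2 mu _ iF.
  (* Integrability of the slice of [F] yields that of the slice of [f] only where h(p) is nonzero;
     elsewhere both sides are 0. *)
  apply: filterS => p ip _; congr EFin; have [hp|hp] := eqVneq (h p) 0%R.
    rewrite hp mulr0 /Rintegral integral0_eq// => s _; rewrite /F hp mulr0.
    by case: ifP.
  pose G s := (if (0 <= s <= t) then f (p.1 + s, p.2) else 0)%R.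
  have GE s : G s = (F p s * (h p)^-1)%R.
    by rewrite /G /F; case: ifP => _; rewrite ?mul0r ?mulfK.
  have FE s : F p s = (G s * h p)%R by rewrite GE mulfVK.
  have iG : mu.-integrable setT (EFin \o G).
    have := integrableZr measurableT (h p)^-1%R ip.
    by congr (mu.-integrable _ _); apply/funext => s; rewrite /= GE EFinM.
  by under [RHS]eq_Rintegral do rewrite FE; rewrite RintegralZr.
rewrite (@Rfubini _ _ _ (measurableTypeR R) R leb2 mu F iF); apply: eq_Rintegral => s _.
rewrite /F; case: ifP => st; last by rewrite /Rintegral integral0.
by apply: eq_Rintegral => p _; rewrite /trans /= addr0.
Qed.

Let cint (t : R) k : R := (\int[mu]_s (if (0 <= s <= t) then cos (s * k.1) else 0))%R.
Let sint (t : R) k : R := (\int[mu]_s (if (0 <= s <= t) then sin (s * k.1) else 0))%R.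

Let icos (t : R) k : (0 < t)%R ->
  mu.-integrable setT (EFin \o (fun s => if (0 <= s <= t) then cos (s * k.1) else 0)%R).
Proof.
move=> t0; apply: (@integrable_if_bounded 0 t 1); [exact: ltW|by mea|].
by move=> s _; exact: cos_max.
Qed.

Let isin (t : R) k : (0 < t)%R ->
  mu.-integrable setT (EFin \o (fun s => if (0 <= s <= t) then sin (s * k.1) else 0)%R).
Proof.
move=> t0; apply: (@integrable_if_bounded 0 t 1); [exact: ltW|by mea|].
by move=> s _; exact: sin_max.
Qed.

Let rotE (t a b : R) k : (0 < t)%R ->
  (\int[mu]_s (if (0 <= s <= t) then cos (s * k.1) * a + sin (s * k.1) * b else 0) =
   a * cint t k + b * sint t k)%R.
Proof.
move=> t0; have ic := icos k t0; have is_ := isin k t0.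
rewrite /cint /sint -!RintegralZl// -RintegralD//.
- by apply: eq_Rintegral => s _; case: ifP => _; ring.
- exact: (integrableZl measurableT _ ic).
- exact: (integrableZl measurableT _ is_).
Qed.

Lemma ft2_primx f (t : R) k : (0 < t)%R -> leb2.-integrable setT (EFin \o f) ->
  ft2 (primx t f) k = (primx_symbol t k * ft2 f k)%R.
Proof.
move=> t0 fi; rewrite !ft2E; set x := FTre f k; set y := FTsin f k.
have -> : FTre (primx t f) k = (x * cint t k + y * sint t k)%R.
  rewrite /FTre Rint_primx//; [|by mea|by move=> p; exact: cos_max].
  rewrite -rotE//; apply: eq_Rintegral => s _; case: ifP => // _.
  by rewrite -/(FTre (trans (s, 0%R) f) k) FTre_trans//= mul0r addr0.
have -> : FTsin (primx t f) k = (y * cint t k + (- x) * sint t k)%R.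
  rewrite /FTsin Rint_primx//; [|by mea|by move=> p; exact: sin_max].
  rewrite -rotE//; apply: eq_Rintegral => s _; case: ifP => // _.
  by rewrite -/(FTsin (trans (s, 0%R) f) k) FTsin_trans//= mul0r addr0 -/x -/y; ring.
by rewrite /primx_symbol -/(cint t k) -/(sint t k); ring.
Qed.

Lemma primx_symbol_ge0 (t : R) k : (0 <= primx_symbol t k)%R.
Proof. by rewrite addr_ge0 ?sqr_ge0. Qed.

Let norm_if_le (t : R) (F : R -> R) : (0 < t)%R -> measurable_fun setT F ->
  (forall s, `|F s| <= 1)%R ->
  ((\int[mu]_s (if (0 <= s <= t) then F s else 0)) ^+ 2 <= t ^+ 2)%R.
Proof.
move=> t0 mF F1; rewrite -lee_fin; have := @sqr_Rint_if_le 0 t F t0 mF.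
rewrite subr0 => h; apply: (le_trans h).
rewrite expr2 EFinM lee_pmul2l ?lte_fin//.
rewrite -[leRHS](_ : \int[mu]_s (if (0 <= s <= t)%R then 1 else 0)%:E = _).
  apply: le_int; [by mea|by mea|by move=> s; case: ifP => // _; exact: sqr_ge0|].
  move=> s; case: ifP => // _; have := F1 s.
  by rewrite -(real_normK (num_real (F s))) expr_le1.
by rewrite int_if_cst ?ltW// mul1r subr0.
Qed.

Lemma primx_symbol_le (t : R) k : (0 < t)%R -> (primx_symbol t k <= 2 * t ^+ 2)%R.
Proof.
move=> t0; rewrite /primx_symbol mulr_natl mulr2n lerD//; apply: norm_if_le => //.
- by mea.
- by move=> s; exact: cos_max.
- by mea.
- by move=> s; exact: sin_max.
Qed.

Lemma primx_symbolE (t : R) k : (0 < t)%R -> k.1 != 0%R ->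
  primx_symbol t k = (diff_symbol (t, 0) k / k.1 ^+ 2)%R.
Proof.
move=> t0 k0; rewrite /primx_symbol.
have ftc (F f : R -> R) : (forall s, is_derive s (1 : R)%R F (f s)) -> continuous f ->
    (\int[mu]_s (if (0 <= s <= t) then f s else 0) = F t - F 0)%R.
  move=> dF cf; rewrite Rint_if /Rintegral (@continuous_FTC2 _ f F 0 t) //.
  - exact: continuous_subspaceT.
  - have cF : continuous F by move=> s; apply: differentiable_continuous; apply/derivable1_diffP.
    split.
    + by move=> s _.
    + by apply: cvg_at_right_filter; exact: cF.
    + by apply: cvg_at_left_filter; exact: cF.
  - by move=> s _; rewrite derive1E derive_val.
have dS (s : R) : is_derive s (1 : R)%R (fun s => sin (s * k.1) / k.1)%R (cos (s * k.1)).
  by apply: is_derive_eq; rewrite /GRing.scale /=; field.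
have dC (s : R) : is_derive s (1 : R)%R (fun s => - cos (s * k.1) / k.1)%R (sin (s * k.1)).
  by apply: is_derive_eq; rewrite /GRing.scale /=; field.
have cC : continuous (fun s : R => cos (s * k.1)).
  by move=> s; apply: continuous_comp; [exact: mulrr_continuous|exact: continuous_cos].
have cS : continuous (fun s : R => sin (s * k.1)).
  by move=> s; apply: continuous_comp; [exact: mulrr_continuous|exact: continuous_sin].
rewrite (ftc _ _ dS cC) (ftc _ _ dC cS) !mul0r sin0 cos0 /diff_symbol /= !mul0r addr0.
have := cos2Dsin2 (t * k.1)%R; set c := cos _; set d := sin _ => cd.
transitivity ((c ^+ 2 + d ^+ 2 + 1 - 2 * c) / k.1 ^+ 2)%R; first by field.
by rewrite cd; congr (_ / _)%R; ring.
Qed.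

Lemma measurable_primx_symbol :
  measurable_fun setT (fun z : R * (R * R) => primx_symbol z.1 z.2).
Proof.
rewrite /primx_symbol.
have m1 : measurable_fun setT (fun z : R * (R * R) =>
    \int[mu]_s (if (0 <= s <= z.1) then cos (s * z.2.1) else 0))%R.
  apply: (measurable_Rparam_mu
    (F := fun (z : R * (R * R)) s => if (0 <= s <= z.1) then cos (s * z.2.1) else 0)%R).
  by mea.
have m2 : measurable_fun setT (fun z : R * (R * R) =>
    \int[mu]_s (if (0 <= s <= z.1) then sin (s * z.2.1) else 0))%R.
  apply: (measurable_Rparam_mu
    (F := fun (z : R * (R * R)) s => if (0 <= s <= z.1) then sin (s * z.2.1) else 0)%R).
  by mea.
by mea.
Qed.

Lemma eq_primx (t n : R) f g p :
  (forall q, inbox (n + t)%R q -> f q = g q) -> inbox n p -> primx t f p = primx t g p.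
Proof.
move=> fg /andP[p1 p2]; apply: eq_Rintegral => s _; case: ifPn => // /andP[s0 st].
apply: fg; apply/andP; split => /=.
  by rewrite (le_trans (ler_normD _ _))// lerD// ger0_norm.
by rewrite (le_trans p2)// lerDl (le_trans s0).
Qed.

Lemma cl2_primx (t : R) f : (0 < t)%R -> cl2 f -> cl2 (primx t f).
Proof.
move=> t0 [mf foo [n fn]]; split; first exact: measurable_primxt.
- apply: (le_lt_trans (N2_primx_le t0 mf)).
  by rewrite lte_mul_pinfty ?lee_fin ?sqr_ge0// ge0_fin_numE// N2_ge0.
- exists (n + t)%R => p; apply: contraNT => np; apply/eqP.
  rewrite /primx /Rintegral integral0_eq// => s _; case: ifPn => // /andP[s0 st].
  have [->//|/fn /andP[/= h1 h2]] := eqVneq (f (p.1 + s, p.2)%R) 0%R.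
  case/negP: np; apply/andP; split; last by rewrite (le_trans h2)// lerDl ltW.
  have := ler_normB (p.1 + s)%R s; rewrite addrK (ger0_norm s0) => h.
  by rewrite (le_trans h)// lerD.
Qed.

Lemma multiplier_primx (t : R) : (0 < t)%R -> multiplier (primx t) (primx_symbol t).
Proof.
move=> t0; split.
- have m1 : measurable_fun setT (fun k : R * R => (t, k)) by mea.
  exact: (measurableT_comp measurable_primx_symbol m1).
- exact: primx_symbol_ge0.
- by exists (2 * t ^+ 2)%R => k; exact: primx_symbol_le.
- by move=> f; exact: measurable_primxt.
- by move=> f; exact: cl2_primx.
- by move=> f k /cl2_integrable; exact: ft2_primx.
- by exists t => n f g fg p pn; exact: (@eq_primx _ n).
Qed.

End multipliers.

(** * Comparison of symbols with the weights *)

Section symbol_integrals.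
Variable R : realType.
Local Notation mu := (@lebesgue_measure R).
Local Notation leb2 := (@leb2 R).
Implicit Types (f g u : R * R -> R) (t r h L : R) (p k : R * R).
Local Open Scope ereal_scope.

Lemma int_off_axis (F : R * R -> R) : measurable_fun setT F -> (forall k, 0 <= F k)%R ->
  \int[leb2]_k (F k)%:E = \int[leb2]_k (if k.1 == 0%R then 0 else F k)%:E.
Proof.
move=> mF F0; have mG : measurable_fun setT (fun k => if k.1 == 0%R then 0%R else F k) by mea.
rewrite leb2_tonelli2; [|by mea|by move=> k; rewrite lee_fin].
rewrite leb2_tonelli2; [|by mea|by move=> k; rewrite lee_fin; case: ifP].
apply: eq_integral => y _ /=; apply: ae_eq_integral => //=.
- by mea.
- by mea.
exists [set 0%R]; split; [by []|exact: lebesgue_measure_set1|].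
by move=> x /=; apply: contra_notP => /eqP/negPf x0; rewrite x0.
Qed.

Let pc0 : (0 <= 2 / pi ^+ 2 :> R)%R.
Proof. by rewrite divr_ge0// sqr_ge0. Qed.

(** A superposition principle: Tonelli turns bounds for a family of multipliers into one weight, as
    soon as the symbols, integrated against [w], are at most [W]. The comparison is made off the
    null axis xi = 0, where the singular weights live. *)
Lemma int_mult_le (T : R -> (R * R -> R) -> R * R -> R) (m : R -> R * R -> R)
    (w : R -> R) (W : R * R -> R) (L : R) u (Fr Fi : R * R -> R) :
  (forall t : R, (0 < t <= L)%R -> multiplier (T t) (m t)) ->
  measurable_fun setT (fun z => m z.1 z.2) -> measurable_fun setT w ->
  (forall t : R, 0 <= w t)%R -> measurable_fun setT (fun t : R => N2 (T t u)) ->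
  measurable_fun setT W -> (forall k, 0 <= W k)%R ->
  (forall k, k.1 != 0%R ->
    \int[mu]_t (if (0 < t <= L)%R then w t * m t k else 0)%:E <= (W k)%:E) ->
  L2 u -> is_FT u Fr Fi ->
  \int[mu]_t (if (0 < t <= L)%R then (w t)%:E * N2 (T t u) else 0) <=
    (2 / pi ^+ 2)%:E * \int[leb2]_k (W k * FTsq Fr Fi k)%:E.
Proof.
move=> HT mm mw w0 mN mW W0 mwW uL2 uF; have [mFr mFi _] := uF.
have mS : measurable_fun setT (FTsq Fr Fi) by rewrite /FTsq; mea.
have S0 k : (0 <= FTsq Fr Fi k)%R by rewrite /FTsq addr_ge0 ?sqr_ge0.
pose F (t : R) k : R := (if 0 < t <= L then if k.1 == 0 then 0 else w t * m t k * FTsq Fr Fi k else 0)%R.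
have mF : measurable_fun setT (fun z : R * (R * R) => F z.1 z.2).
  by rewrite /F; mea.
have F0 t k : (0 <= F t k)%R.
  rewrite /F; case: ifPn => // tL; case: ifP => // _.
  by rewrite !mulr_ge0// (mult_ge0 (HT _ tL)).
apply: (@le_trans _ _ (\int[mu]_t ((2 / pi ^+ 2)%:E * \int[leb2]_k (F t k)%:E))).
  apply: ge0_le_integral => //.
  - by move=> t _; case: ifPn => // tL; rewrite mule_ge0 ?lee_fin ?w0 ?N2_ge0.
  - apply: measurable_fun_ifT => //; first by mea.
    by apply: emeasurable_funM => //; mea.
  - apply: emeasurable_funM => //; apply: measurable_param_leb2.
    by mea.
  - move=> t _; case: ifPn => [tL|_]; last first.
      by rewrite mule_ge0 ?lee_fin// int_ge0.
    have mt := mult_meas (HT _ tL); have m0 := mult_ge0 (HT _ tL).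
    apply: (@le_trans _ _ ((w t)%:E * ((2 / pi ^+ 2)%:E * \int[leb2]_k (m t k * FTsq Fr Fi k)%:E))).
      by rewrite lee_wpmul2l ?lee_fin// (N2_mult_le (HT _ tL)).
    rewrite muleCA lee_wpmul2l ?lee_fin// -intZ//; [|by mea|by move=> k; rewrite mulr_ge0].
    rewrite (@int_off_axis (fun k => w t * (m t k * FTsq Fr Fi k))%R); [|by mea|by move=> k; rewrite !mulr_ge0].
    by apply: le_int; [by mea|by rewrite /F; mea|by move=> k; case: ifP => // _; rewrite !mulr_ge0|];
      move=> k; rewrite /F tL; case: ifP => // _; rewrite mulrA.
rewrite ge0_integralZl//; [|by apply: measurable_param_leb2; mea|by move=> t _; exact: int_ge0].
apply: lee_wpmul2l => //.
rewrite (@tonelli _ _ (measurableTypeR R) _ R mu leb2 (fun t k => (F t k)%:E)) //; [|by mea].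
apply: ge0_le_integral => //.
- by move=> k _; exact: int_ge0.
- by apply: (measurable_param_mu (F := fun k t => (F t k)%:E)); mea.
- by mea.
move=> k _; have [k0|k0] := eqVneq k.1 0%R.
  rewrite integral0_eq; first by rewrite lee_fin mulr_ge0.
  by move=> t _; rewrite /F k0 eqxx; case: ifP.
apply: (@le_trans _ _ ((FTsq Fr Fi k)%:E * \int[mu]_t (if (0 < t <= L)%R then w t * m t k else 0)%:E)).
  rewrite -ge0_integralZl//; last first.
  - by rewrite lee_fin.
  - by move=> t _; case: ifPn => // tL; rewrite lee_fin mulr_ge0// (mult_ge0 (HT _ tL)).
  - by mea.
  by rewrite le_eqVlt; apply/orP; left; apply/eqP; apply: eq_integral => t _;
   rewrite /F (negPf k0); case: ifP => _; rewrite ?mule0// -EFinM mulrC.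
by rewrite muleC EFinM lee_wpmul2r ?lee_fin// mwW.
Qed.

Lemma sin_mvt (x : R) : exists2 c : R, (`|c| <= `|x|)%R & (sin x = x * cos c)%R.
Proof.
wlog x0 : x / (0 <= x)%R => [H|].
  have [|x0] := leP 0%R x; first exact: H.
  have [|c cx E] := H (- x)%R; first by rewrite oppr_ge0 ltW.
  exists c; first by rewrite -(normrN x).
  by apply: oppr_inj; rewrite -sinN E mulNr.
move: x0; rewrite le_eqVlt => /predU1P[<-|x0].
  by exists 0%R; rewrite ?normr0// sin0 mul0r.
have [|c] := @MVT R sin cos 0%R x x0 (fun c _ => is_derive_sin c).
  by apply: continuous_subspaceT => ?; exact: continuous_sin.
rewrite in_itv/= sin0 !subr0 => /andP[c0 cx] E; exists c; last by rewrite E mulrC.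
by rewrite !gtr0_norm// ltW.
Qed.

Lemma sqr_sin_le (x : R) : (sin x ^+ 2 <= x ^+ 2)%R.
Proof.
have [c _ ->] := sin_mvt x; rewrite exprMn ler_piMr ?sqr_ge0//.
Qed.

Lemma two_minus_cos (x : R) : (2 - 2 * cos x = 4 * sin (x / 2) ^+ 2)%R.
Proof.
have e : (x = x / 2 + x / 2)%R by field.
rewrite {1}e cosD; have := cos2Dsin2 (x / 2)%R; rewrite -!expr2.
by move: (cos _ ^+ 2)%R (sin _ ^+ 2)%R => a b ab; lra.
Qed.

Lemma two_minus_cos_le (x : R) : (2 - 2 * cos x <= x ^+ 2)%R.
Proof. by rewrite two_minus_cos; have := sqr_sin_le (x / 2)%R; rewrite exprMn; lra. Qed.

(** Write sin(x / 2) = (x / 2) cos c with |c| <= 1 / 2. The upper bound applied at c gives cos c >=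
    7 / 8, and the square 49 / 64 exceeds 1 / 2. *)
Lemma two_minus_cos_ge (x : R) : (`|x| <= 1)%R -> (x ^+ 2 / 2 <= 2 - 2 * cos x)%R.
Proof.
move=> x1; rewrite two_minus_cos; have [c cx ->] := sin_mvt (x / 2)%R.
have c1 : (c ^+ 2 <= 1 / 4)%R.
  rewrite -(real_normK (num_real c)).
  have cx' : (`|c| <= 2^-1)%R.
    by rewrite (le_trans cx)// normrM (ger0_norm (_ : 0 <= 2^-1)%R)// ler_piMl.
  by have := normr_ge0 c; nra.
have : (7 / 8 <= cos c)%R by have := two_minus_cos_le c; lra.
rewrite !exprMn => cc.
have : (49 / 64 <= cos c ^+ 2)%R by nra.
by have := sqr_ge0 x; nra.
Qed.

(** With y = t^2 xi^2, the symbol is at most both y and 4, so its product with 1 + y is at most y +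
    4 y = 5 y. The resulting majorant 5 xi^2 / (1 + xi^2 t^2) is a Poisson kernel in t of width 1 /
    |xi|, whose integral is already known. *)
Lemma diff_symbol_quot_le (t : R) k : (0 < t)%R -> k.1 != 0%R ->
  ((t ^+ 2)^-1 * diff_symbol (t, 0) k <= 5 / 2 * `|k.1| * poisson `|k.1|^-1 t)%R.
Proof.
move=> t0 k0; rewrite /diff_symbol /= mul0r addr0 /poisson.
have x0 : (0 < `|k.1|)%R by rewrite normr_gt0.
rewrite (_ : k.1 = (Num.sg k.1 * `|k.1|)%R); last by rewrite -numEsg.
have -> : cos (t * (Num.sg k.1 * `|k.1|)) = cos (t * `|k.1|).
  by case: (ltgtP k.1 0%R) k0 => // k1 _; [rewrite ltr0_sg// mulN1r mulrN cosN|rewrite gtr0_sg// mul1r].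
rewrite -numEsg; move: x0; set x := `|k.1|%R => x0.
have -> : (5 / 2 * x * (2 * x^-1 / (x^-1 ^+ 2 + t ^+ 2)) = (5 * x ^+ 2) / (1 + x ^+ 2 * t ^+ 2))%R.
  by field; rewrite !gt_eqF// ltr_pwDl ?sqr_ge0.
have d0 : (0 < 1 + x ^+ 2 * t ^+ 2)%R by rewrite ltr_pwDl// mulr_ge0 ?sqr_ge0.
rewrite ler_pdivlMr// -mulrA ler_pdivrMl ?exprn_gt0//.
have h1 := two_minus_cos_le (t * x)%R; have h2 := cos_geN1 (t * x)%R.
rewrite exprMn in h1; have : (0 <= t ^+ 2 * x ^+ 2)%R by rewrite mulr_ge0 ?sqr_ge0.
rewrite (mulrC (x ^+ 2)%R); move: h1 h2; set y := (t ^+ 2 * _)%R; set c := cos _ => h1 h2 y0.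
by rewrite [leRHS](_ : _ = 5 * y)%R; [nra|rewrite /y; ring].
Qed.

Lemma int_diff_symbol_le (L : R) k : (0 < L)%R -> k.1 != 0%R ->
  \int[mu]_t (if (0 < t <= L)%R then (t ^+ 2)^-1 * diff_symbol (t, 0) k else 0)%:E <=
  (5 * pi * `|k.1|)%:E.
Proof.
move=> L0 k0; have x0 : (0 < `|k.1|)%R by rewrite normr_gt0.
have mp := measurable_poisson `|k.1|^-1%R.
apply: (@le_trans _ _ (\int[mu]_t ((5 / 2 * `|k.1|) * poisson_cut L `|k.1|^-1 t)%:E)).
  apply: le_int.
  - by rewrite /diff_symbol; mea.
  - by rewrite /poisson_cut; mea.
  - move=> t; case: ifP => // _; rewrite mulr_ge0 ?invr_ge0 ?sqr_ge0//.
    exact: diff_symbol_ge0.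
  - move=> t; rewrite /poisson_cut; case: ifPn => [/andP[t0 tL]|_].
      by rewrite (ger0_norm (ltW t0 : 0 <= (t : R))%R) tL diff_symbol_quot_le.
    by rewrite mulr_ge0//; case: ifP => // _; rewrite poisson_ge0 ?invr_gt0.
rewrite intZ; [|by rewrite /poisson_cut; mea| |by rewrite mulr_ge0]; last first.
  by move=> t; rewrite /poisson_cut; case: ifP => // _; rewrite poisson_ge0 ?invr_gt0.
rewrite int_poisson_cut ?invr_gt0// -EFinM lee_fin.
by have := ler_atan_pihalf (L / `|k.1|^-1)%R; nra.
Qed.

Lemma int_primx_symbol_le (L : R) k : (0 < L)%R -> k.1 != 0%R ->
  \int[mu]_t (if (0 < t <= L)%R then (t ^+ 2)^-1 * primx_symbol t k else 0)%:E <=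
  (5 * pi / `|k.1|)%:E.
Proof.
move=> L0 k0; have x0 : (0 < `|k.1|)%R by rewrite normr_gt0.
have k2 : (0 < k.1 ^+ 2)%R by rewrite exprn_even_gt0.
have -> : \int[mu]_t (if (0 < t <= L)%R then (t ^+ 2)^-1 * primx_symbol t k else 0)%:E =
    (k.1 ^+ 2)^-1%:E * \int[mu]_t (if (0 < t <= L)%R then (t ^+ 2)^-1 * diff_symbol (t, 0) k else 0)%:E.
  rewrite -intZ//; first last.
  - by rewrite invr_ge0 ltW.
  - move=> t; case: ifP => // _; rewrite mulr_ge0 ?invr_ge0 ?sqr_ge0//.
    exact: diff_symbol_ge0.
  - by rewrite /diff_symbol; mea.
  apply: eq_integral => t _; case: ifPn => [/andP[t0 _]|_]; last by rewrite mulr0.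
  by rewrite primx_symbolE// mulrA mulrC.
apply: (@le_trans _ _ ((k.1 ^+ 2)^-1%:E * (5 * pi * `|k.1|)%:E)).
  by rewrite lee_wpmul2l ?lee_fin ?invr_ge0 ?(ltW k2)// int_diff_symbol_le.
rewrite -EFinM lee_fin -(real_normK (num_real k.1)).
by rewrite le_eqVlt; apply/orP; left; apply/eqP; field; rewrite gt_eqF.
Qed.

Lemma is_FT_meas u Fr Fi : is_FT u Fr Fi -> measurable_fun setT (FTsq Fr Fi).
Proof. by move=> [? ? _]; rewrite /FTsq; mea. Qed.

Lemma FTsq_ge0 (Fr Fi : R * R -> R) k : (0 <= FTsq Fr Fi k)%R.
Proof. by rewrite /FTsq addr_ge0 ?sqr_ge0. Qed.

Lemma measurable_N2_diff u : measurable_fun setT u ->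
  measurable_fun setT (fun t => N2 (fdiff (t, 0%R) u)).
Proof.
move=> mf; have m1 : measurable_fun setT (fun t : R => ((t, 0%R) : R * R)) by mea.
exact: (measurableT_comp (measurable_modulus mf) m1).
Qed.

Lemma measurable_N2_primx u : measurable_fun setT u ->
  measurable_fun setT (fun t => N2 (primx t u)).
Proof.
move=> mf; have m1 := measurable_primx mf.
by apply: (measurable_param_leb2 (F := fun t p => (primx t u p ^+ 2)%:E)); mea.
Qed.

Definition cP : R := (2 / pi ^+ 2)%R.

Lemma cP_ge0 : (0 <= cP)%R.
Proof. by rewrite /cP divr_ge0// sqr_ge0. Qed.

Section fourier_side.
Variables (u : R * R -> R) (Fr Fi : R * R -> R).
Hypotheses (uL2 : L2 u) (uF : is_FT u Fr Fi).
Local Notation S := (FTsq Fr Fi).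

Let mu_ : measurable_fun setT u. Proof. by case: uL2. Qed.

Lemma multiplier_id : @multiplier R id (cst 1%R).
Proof.
split => //; try by [mea|move=> *; rewrite mul1r].
- by exists 1%R.
- by exists 0%R => n f g fg p pn; apply: fg; rewrite addr0.
Qed.

Lemma N2_le : N2 u <= cP%:E * \int[leb2]_k (S k)%:E.
Proof.
have := N2_mult_le multiplier_id uL2 uF; rewrite /cP.
by under eq_integral do rewrite mul1r.
Qed.

Lemma int_N2_primx_le L : (0 < L)%R ->
  \int[mu]_t (if (0 < t <= L)%R then 1%:E * N2 (primx t u) else 0) <=
  cP%:E * \int[leb2]_k (2 * L ^+ 3 * S k)%:E.
Proof.
move=> L0; apply: (int_mult_le (T := @primx R) (m := @primx_symbol R) (w := cst 1%R) (W := cst (2 * L ^+ 3)%R)) => //.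
- by move=> t /andP[t0 _]; exact: multiplier_primx.
- exact: measurable_primx_symbol.
- exact: measurable_N2_primx.
- by move=> k; rewrite mulr_ge0// exprn_ge0// ltW.
- move=> k _; apply: (@le_trans _ _ (\int[mu]_t (if (0 <= t <= L)%R then 2 * L ^+ 2 else 0)%:E)).
    have mp := @measurable_primx_symbol R; apply: le_int; [by mea|by mea| |].
      by move=> t; case: ifP => // _; rewrite mulr_ge0// primx_symbol_ge0.
    move=> t; case: ifPn => [/andP[t0 tL]|_]; last by case: ifP => // _; rewrite mulr_ge0 ?sqr_ge0.
    rewrite (ltW t0) tL/= mul1r (le_trans (primx_symbol_le _ _))//.
    by rewrite ler_wpM2l// lerXn2r// ?nnegrE ltW.
  by rewrite (int_if_cst _ (ltW L0)) lee_fin subr0 -mulrA -exprSr.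
Qed.

Lemma int_N2_primx_quot_le L : (0 < L)%R ->
  \int[mu]_t (if (0 < t <= L)%R then ((t ^+ 2)^-1)%:E * N2 (primx t u) else 0) <=
  cP%:E * \int[leb2]_k (2 * L * S k)%:E.
Proof.
move=> L0; apply: (int_mult_le (T := @primx R) (m := @primx_symbol R) (w := fun t => (t ^+ 2)^-1%R) (W := cst (2 * L)%R)) => //.
- by move=> t /andP[t0 _]; exact: multiplier_primx.
- exact: measurable_primx_symbol.
- by mea.
- by move=> t; rewrite invr_ge0 sqr_ge0.
- exact: measurable_N2_primx.
- by move=> k; rewrite mulr_ge0// ltW.
- move=> k _; apply: (@le_trans _ _ (\int[mu]_t (if (0 <= t <= L)%R then 2%R else 0)%:E)).
    have mp := @measurable_primx_symbol R; apply: le_int; [by mea|by mea| |].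
      by move=> t; case: ifP => // _; rewrite mulr_ge0 ?invr_ge0 ?sqr_ge0// primx_symbol_ge0.
    move=> t; case: ifPn => [/andP[t0 tL]|_]; last by case: ifP.
    rewrite (ltW t0) tL/= ler_pdivrMl ?exprn_gt0// mulrC.
    exact: primx_symbol_le.
  by rewrite (int_if_cst _ (ltW L0)) lee_fin subr0.
Qed.

Lemma int_N2_diff_quot_le L : (0 < L)%R ->
  \int[mu]_t (if (0 < t <= L)%R then ((t ^+ 2)^-1)%:E * N2 (fdiff (t, 0%R) u) else 0) <=
  cP%:E * \int[leb2]_k (5 * pi * `|k.1| * S k)%:E.
Proof.
move=> L0; apply: (int_mult_le (T := fun t => fdiff (t, 0%R)) (m := fun t => diff_symbol (t, 0%R)) (w := fun t => (t ^+ 2)^-1%R)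
  (W := fun k => (5 * pi * `|k.1|)%R)) => //.
- by move=> t _; exact: multiplier_diff.
- by rewrite /diff_symbol; mea.
- by mea.
- by move=> t; rewrite invr_ge0 sqr_ge0.
- exact: measurable_N2_diff.
- by mea.
- by move=> k; rewrite !mulr_ge0 ?pi_ge0.
- by move=> k; exact: int_diff_symbol_le.
Qed.

(** The y-difference enters only through its symbol, at most h^2 eta^2; this h^2 later cancels the
    h^-2 lost in replacing eta^2. *)
Lemma int_N2_primx_diff_le (w : R -> R) (W : R * R -> R) L h :
  measurable_fun setT w -> (forall t, 0 <= w t)%R ->
  measurable_fun setT W -> (forall k, 0 <= W k)%R ->
  (forall k, k.1 != 0%R ->
    \int[mu]_t (if (0 < t <= L)%R then w t * primx_symbol t k else 0)%:E <= (W k)%:E) ->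
  \int[mu]_t (if (0 < t <= L)%R then (w t)%:E * N2 (primx t (fdiff (0%R, h) u)) else 0) <=
  cP%:E * \int[leb2]_k (W k * (h ^+ 2 * k.2 ^+ 2) * S k)%:E.
Proof.
move=> mw w0 mW W0 wW.
apply: (int_mult_le (T := fun t => primx t \o fdiff (0%R, h))
  (m := fun t k => (primx_symbol t k * diff_symbol (0%R, h) k)%R) (w := w)
  (W := fun k => (W k * (h ^+ 2 * k.2 ^+ 2))%R)) => //.
- by move=> t /andP[t0 _]; apply: multiplier_comp; [exact: multiplier_primx|exact: multiplier_diff].
- by have mp := @measurable_primx_symbol R; rewrite /diff_symbol; mea.
- by apply: measurable_N2_primx; exact: measurable_diff.
- by mea.
- by move=> k; rewrite mulr_ge0// mulr_ge0 ?sqr_ge0.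
- move=> k k0; have d0 := diff_symbol_ge0 (0%R, h) k.
  have dh : (diff_symbol (0%R, h) k <= h ^+ 2 * k.2 ^+ 2)%R.
    by rewrite /diff_symbol /= mul0r add0r -exprMn two_minus_cos_le.
  have mp := @measurable_primx_symbol R.
  have -> : \int[mu]_t (if (0 < t <= L)%R then w t * (primx_symbol t k * diff_symbol (0%R, h) k) else 0)%:E =
      (diff_symbol (0%R, h) k)%:E * \int[mu]_t (if (0 < t <= L)%R then w t * primx_symbol t k else 0)%:E.
    rewrite -intZ//; first last.
    - by move=> t; case: ifP => // _; rewrite mulr_ge0// primx_symbol_ge0.
    - by mea.
    by apply: eq_integral => t _; case: ifP => _; rewrite ?mulr0// mulrA mulrC.
  apply: (@le_trans _ _ ((h ^+ 2 * k.2 ^+ 2)%:E * (W k)%:E)).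
    apply: lee_pmul; [by rewrite lee_fin| |by rewrite lee_fin|exact: wW].
    by apply: int_ge0 => t; case: ifP => // _; rewrite mulr_ge0// primx_symbol_ge0.
  by rewrite -EFinM mulrC.
Qed.

End fourier_side.

Definition cQ : R := (expR 1 * (2 * pi) ^+ 2)%R.

Lemma cQ_ge0 : (0 <= cQ)%R.
Proof. by rewrite /cQ mulr_ge0 ?expR_ge0 ?sqr_ge0. Qed.

(** For |xi| <= 1 / r the first term suffices. Otherwise 1 / |xi| <= r, and on 0 < t <= 1 / |xi| the
    integrand is at least xi^2 / 2, which integrates to |xi| / 2. *)
Lemma int_diff_symbol_ge (r : R) k : (0 < r)%R ->
  `|k.1|%:E <= (r^-1)%:E + 2%:E *
    \int[mu]_t (if (0 < t <= r)%R then (t ^+ 2)^-1 * diff_symbol (t, 0%R) k else 0)%:E.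
Proof.
move=> r0; set I := integral _ _ _.
have F0 t : (0 <= (if (0 < t <= r)%R then (t ^+ 2)^-1 * diff_symbol (t, 0%R) k else 0))%R.
  by case: ifP => // _; rewrite mulr_ge0 ?invr_ge0 ?sqr_ge0 ?diff_symbol_ge0.
have I0 : 0 <= I by exact: int_ge0.
have [kr|kr] := leP `|k.1|%R r^-1%R.
  by apply: (@le_trans _ _ (r^-1)%:E); rewrite ?lee_fin// leeDl// mule_ge0.
have x0 : (0 < `|k.1|)%R by rewrite (lt_trans _ kr)// invr_gt0.
apply: (@le_trans _ _ (2%:E * (`|k.1| / 2)%:E)).
  by rewrite -EFinM lee_fin mulrC divfK.
rewrite (@le_trans _ _ (2%:E * I))//; last by rewrite leeDr// lee_fin invr_ge0 ltW.
rewrite lee_pmul2l//.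
have xr : (`|k.1|^-1 <= r)%R by rewrite -[leRHS]invrK lef_pV2 ?posrE ?invr_gt0// ltW.
apply: (@le_trans _ _ (\int[mu]_t (if (0 < t <= `|k.1|^-1)%R then k.1 ^+ 2 / 2 else 0)%:E)).
  have -> : \int[mu]_t (if (0 < t <= `|k.1|^-1)%R then k.1 ^+ 2 / 2 else 0)%:E =
      \int[mu]_t (if (0 <= t <= `|k.1|^-1)%R then k.1 ^+ 2 / 2 else 0)%:E.
    apply: ae_eq_integral => //=; [by mea|by mea|].
    exists [set 0%R]; split; [by []|exact: lebesgue_measure_set1|].
    move=> x /=; apply: contra_notP => /eqP x1 _.
    by rewrite lt_neqAle eq_sym x1.
  rewrite int_if_cst ?invr_ge0// subr0 lee_fin -(real_normK (num_real k.1)).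
  by rewrite le_eqVlt; apply/orP; left; apply/eqP; field; rewrite gt_eqF.
apply: le_int => //; first by mea.
- by rewrite /diff_symbol; mea.
- by move=> t; case: ifP => // _; rewrite divr_ge0 ?sqr_ge0.
move=> t; case: ifPn => [/andP[t0 tk]|_]; last exact: F0.
rewrite t0 (le_trans tk xr)/= ler_pdivlMl ?exprn_gt0//.
rewrite /diff_symbol /= mul0r addr0 mulrA -exprMn two_minus_cos_ge//.
rewrite normrM (ger0_norm (ltW t0 : 0 <= (t : R))%R).
by rewrite -(@mulVf _ `|k.1|%R) ?gt_eqF// ler_wpM2r.
Qed.

(** A Gagliardo form of the squared H^(1/2) norm in x, with increments at most [r] so that it
    remains local. *)
Definition Hs (r : R) f : \bar R := (r^-1)%:E * N2 f + 2%:E *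
  \int[mu]_t (if (0 < t <= r)%R then ((t ^+ 2)^-1)%:E * N2 (fdiff (t, 0%R) f) else 0).

Lemma int_abs_ft2_le (r : R) f : (0 < r)%R -> cl2 f ->
  \int[leb2]_k (`|k.1| * ft2 f k)%:E <= cQ%:E * Hs r f.
Proof.
move=> r0 cf; have [mf _ _] := cf; have m2 := measurable_ft2 mf.
have f0 := ft2_ge0 f.
pose D t k : R := (if (0 < t <= r)%R then (t ^+ 2)^-1 * diff_symbol (t, 0%R) k else 0)%R.
have D0 t k : (0 <= D t k)%R.
  by rewrite /D; case: ifP => // _; rewrite mulr_ge0 ?invr_ge0 ?sqr_ge0 ?diff_symbol_ge0.
have mD : measurable_fun setT (fun z : R * (R * R) => D z.1 z.2).
  by rewrite /D /diff_symbol; mea.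
have mD' k : measurable_fun setT (D ^~ k) by rewrite /D /diff_symbol; mea.
have mI : measurable_fun setT (fun k => \int[mu]_t (D t k)%:E).
  by apply: (measurable_param_mu (F := fun k t => (D t k)%:E)); rewrite /D /diff_symbol; mea.
have I0 k : 0 <= \int[mu]_t (D t k)%:E by exact: int_ge0.
apply: (@le_trans _ _ (\int[leb2]_k ((r^-1 * ft2 f k)%:E +
    2%:E * ((ft2 f k)%:E * \int[mu]_t (D t k)%:E)))).
  apply: ge0_le_integral => //.
  - by move=> k _; rewrite lee_fin mulr_ge0.
  - by mea.
  - by apply: emeasurable_funD; mea.
  - move=> k _; rewrite EFinM.
    apply: (@le_trans _ _ (((r^-1)%:E + 2%:E * \int[mu]_t (D t k)%:E) * (ft2 f k)%:E)).
      by rewrite lee_wpmul2r ?lee_fin//; exact: int_diff_symbol_ge.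
    rewrite ge0_muleDl ?lee_fin ?invr_ge0 ?(ltW r0)// ?mule_ge0//.
    by rewrite EFinM -muleA (muleC (\int[mu]_t _)).
rewrite ge0_integralD//; last first.
- by mea.
- by move=> k _; rewrite !mule_ge0 ?lee_fin.
- by mea.
- by move=> k _; rewrite lee_fin mulr_ge0// invr_ge0 ltW.
rewrite intZ ?invr_ge0 ?(ltW r0)// /Hs [leRHS]ge0_muleDr; last first.
- rewrite mule_ge0//; apply: integral_ge0 => t _; case: ifP => // _.
  by rewrite mule_ge0 ?N2_ge0// lee_fin invr_ge0 sqr_ge0.
- by rewrite mule_ge0 ?N2_ge0// lee_fin invr_ge0 ltW.
apply: leeD.
  rewrite muleCA lee_wpmul2l ?lee_fin ?invr_ge0 ?(ltW r0)//.
  exact: plancherel_le.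
rewrite ge0_integralZl//; last first.
- by move=> k _; rewrite mule_ge0// lee_fin.
- by mea.
rewrite muleCA lee_wpmul2l//.
pose G t k : \bar R := (ft2 f k * D t k)%:E.
have -> : \int[leb2]_k ((ft2 f k)%:E * \int[mu]_t (D t k)%:E) = \int[leb2]_k \int[mu]_t G t k.
  by apply: eq_integral => k _; rewrite /G intZ; [by []|exact: mD'|by move=> t; exact: D0|exact: f0].
have mG : measurable_fun setT (fun z : R * (R * R) => G z.1 z.2) by rewrite /G; mea.
have G0 t k : 0 <= G t k by rewrite /G lee_fin mulr_ge0.
rewrite -(@tonelli _ _ (measurableTypeR R) _ R mu leb2 G)//.
have mN : measurable_fun setT (fun t => (if (0 < t <= r)%R then ((t ^+ 2)^-1)%:E * N2 (fdiff (t, 0%R) f) else 0)).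
  by have mN := measurable_N2_diff mf; mea.
have N0 t : 0 <= (if (0 < t <= r)%R then ((t ^+ 2)^-1)%:E * N2 (fdiff (t, 0%R) f) else 0).
  by case: ifP => // _; rewrite mule_ge0 ?N2_ge0// lee_fin invr_ge0 sqr_ge0.
rewrite -ge0_integralZl ?lee_fin ?cQ_ge0//.
apply: ge0_le_integral => //.
- by move=> t _; exact: integral_ge0.
- by apply: (measurable_param_leb2 (F := G)).
- by apply: emeasurable_funM => //; exact: mN.
move=> t _; rewrite /G /D; case: ifPn => [tr|_]; last first.
  by rewrite mule0 integral0_eq// => k _; rewrite mulr0.
have cd := cl2_diff (t, 0%R) cf; have [mdf _ _] := cd; have md2 := measurable_ft2 mdf.
apply: (@le_trans _ _ (((t ^+ 2)^-1)%:E * \int[leb2]_k (ft2 (fdiff (t, 0%R) f) k)%:E)).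
  rewrite -intZ ?invr_ge0 ?sqr_ge0//; last by move=> k; exact: ft2_ge0.
  rewrite le_eqVlt; apply/orP; left; apply/eqP; apply: eq_integral => k _.
  by rewrite (mult_ft2 (multiplier_diff _))// mulrC -mulrA.
rewrite muleCA lee_wpmul2l ?lee_fin ?invr_ge0 ?sqr_ge0//.
exact: plancherel_le.
Qed.

(** On a bounded set of frequencies a difference quotient of small step controls the derivative. *)
Lemma inbox_sqr_le (n h : R) k : (0 < h)%R -> (h * n <= 1)%R -> inbox n k ->
  (k.2 ^+ 2 <= 2 * h ^- 2 * diff_symbol (0%R, h) k)%R.
Proof.
move=> h0 hn /andP[_ k2]; rewrite /diff_symbol /= mul0r add0r.
have : ((h * k.2) ^+ 2 / 2 <= 2 - 2 * cos (h * k.2))%R.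
  apply: two_minus_cos_ge; rewrite normrM (gtr0_norm h0) (le_trans _ hn)//.
  by rewrite ler_wpM2l// ltW.
set c := (2 - _)%R => hc; rewrite mulrAC mulrC ler_pdivlMl ?exprn_gt0//.
by rewrite -exprMn; lra.
Qed.

Section eta_derivative.
Variables (f g : R * R -> R) (n h r : R).
Hypotheses (cf : cl2 f) (cg : cl2 g) (h0 : (0 < h)%R) (hn : (h * n <= 1)%R) (r0 : (0 < r)%R).
Hypothesis fg : forall k, ft2 g k = (k.1 ^+ 2 * ft2 f k)%R.

Let w (F : R -> R) k := (if inbox n k then k.2 ^+ 2 / F k.1 * ft2 g k else 0)%R.

Let h20 : (0 <= 2 * h ^- 2)%R.
Proof. by rewrite mulr_ge0// invr_ge0 sqr_ge0. Qed.

Let mf : measurable_fun setT f. Proof. by case: cf. Qed.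
Let mg : measurable_fun setT g. Proof. by case: cg. Qed.
Let mh : measurable_fun setT (fdiff (0%R, h) f). Proof. exact: measurable_diff. Qed.

(** The relation between [g] and its potential [f] turns eta^2 / |xi| on g^ into eta^2 |xi| on f^.
    In the frequency box, eta^2 becomes the symbol of the y-difference, and |xi| is then handled by
    [Hs]. *)
Lemma int_eta2_abs_le : \int[leb2]_k (w (fun x => `|x|%R) k)%:E <=
  (2 * h ^- 2 * cQ)%:E * Hs r (fdiff (0%R, h) f).
Proof.
have m1 := measurable_ft2 mh; have m2 := measurable_ft2 mg; have mb := measurable_inbox n.
rewrite EFinM -muleA.
apply: (@le_trans _ _ ((2 * h ^- 2)%:E * \int[leb2]_k (`|k.1| * ft2 (fdiff (0%R, h) f) k)%:E)); last first.
  by rewrite lee_wpmul2l ?lee_fin//; apply: int_abs_ft2_le => //; exact: cl2_diff.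
rewrite -intZ; [|by mea|by move=> k; rewrite mulr_ge0 ?ft2_ge0|exact: h20].
apply: le_int => //; [by rewrite /w; mea|by mea| |].
  by move=> k; rewrite /w; case: ifP => // _; rewrite mulr_ge0 ?ft2_ge0// divr_ge0 ?sqr_ge0.
move=> k; rewrite /w; case: ifPn => [kn|_]; last first.
  by apply: mulr_ge0 => //; apply: mulr_ge0 => //; exact: ft2_ge0.
rewrite fg (mult_ft2 (multiplier_diff _))//.
(* On the axis division by 0 gives 0, and both sides vanish. *)
have [->|k0] := eqVneq k.1 0%R; first by rewrite normr0 expr0n/= !mul0r !mulr0.
have x0 : (0 < `|k.1|)%R by rewrite normr_gt0.
rewrite (_ : k.2 ^+ 2 / `|k.1| * _ = k.2 ^+ 2 * (`|k.1| * ft2 f k))%R; last first.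
  by rewrite -(real_normK (num_real k.1)); field; rewrite gt_eqF.
rewrite (_ : 2 * h ^- 2 * _ = 2 * h ^- 2 * diff_symbol (0%R, h) k * (`|k.1| * ft2 f k))%R; last by ring.
by rewrite ler_wpM2r ?mulr_ge0 ?ft2_ge0//; exact: inbox_sqr_le kn.
Qed.

Lemma int_eta2_sqr_le : \int[leb2]_k (w (fun x => x ^+ 2)%R k)%:E <=
  (2 * h ^- 2 * cQ)%:E * N2 (fdiff (0%R, h) f).
Proof.
have m1 := measurable_ft2 mh; have m2 := measurable_ft2 mg; have mb := measurable_inbox n.
rewrite EFinM -muleA.
apply: (@le_trans _ _ ((2 * h ^- 2)%:E * \int[leb2]_k (ft2 (fdiff (0%R, h) f) k)%:E)); last first.
  by rewrite lee_wpmul2l ?lee_fin//; apply: plancherel_le => //; exact: cl2_diff.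
rewrite -intZ; [|by mea|by move=> k; exact: ft2_ge0|exact: h20].
apply: le_int => //; [by rewrite /w; mea|by mea| |].
  by move=> k; rewrite /w; case: ifP => // _; rewrite mulr_ge0 ?ft2_ge0// divr_ge0 ?sqr_ge0.
move=> k; rewrite /w; case: ifPn => [kn|_]; last first.
  by apply: mulr_ge0 => //; exact: ft2_ge0.
rewrite fg (mult_ft2 (multiplier_diff _))//.
have [->|k0] := eqVneq k.1 0%R.
  by rewrite expr0n/= mul0r mulr0 !mulr_ge0 ?invr_ge0 ?sqr_ge0 ?ft2_ge0 ?diff_symbol_ge0.
rewrite (_ : k.2 ^+ 2 / k.1 ^+ 2 * _ = k.2 ^+ 2 * ft2 f k)%R; last by field.
by rewrite mulrA ler_wpM2r ?ft2_ge0//; exact: inbox_sqr_le kn.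
Qed.

End eta_derivative.

End symbol_integrals.

(** * Cut-off functions *)

Section bump.
Variable R : realType.
Implicit Types a r x y z : R.

(** [d] is the derivative of [c]. One constant [K] bounds both functions and their Lipschitz
    constants; only first differences of [c] and [d] are ever taken, so no second derivative
    occurs. *)
Record cutoff (a r K : R) (c d : R -> R) : Prop := Cutoff {
  cutoff_derive : forall x, is_derive x 1 c (d x);
  cutoff_cont : continuous d;
  cutoff_in : forall x, a <= x <= a + r -> c x = 1 /\ d x = 0;
  cutoff_out : forall x, ~~ (a - r < x < a + 2 * r) -> c x = 0 /\ d x = 0;
  cutoff_le : forall x, `|c x| <= K;
  cutoff_dle : forall x, `|d x| <= K;
  cutoff_lip : forall x y, `|c x - c y| <= K * `|x - y|;
  cutoff_dlip : forall x y, `|d x - d y| <= K * `|x - y| }.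

Let ramp z : R := Num.max z 0.

Let ramp_lip x y : `|ramp x - ramp y| <= `|x - y|.
Proof.
rewrite /ramp; case: (leP x 0) => x0; case: (leP y 0) => y0; rewrite ?subrr//.
- by rewrite normr0.
- by rewrite sub0r normrN distrC !ger0_norm; lra.
- by rewrite subr0 !ger0_norm; lra.
Qed.

Let ramp_le0 z : z <= 0 -> ramp z = 0. Proof. by move=> z0; rewrite /ramp max_r. Qed.
Let ramp_ge0 z : 0 <= z -> ramp z = z. Proof. by move=> z0; rewrite /ramp max_l. Qed.

(** The ramp has a corner at 0 but its square does not: the difference quotient at step h is within
    |h| of 2 [ramp z], by cases on the signs. *)
Let is_derive_ramp2 z : is_derive z 1 (fun z => ramp z ^+ 2) (2 * ramp z).
Proof.
have H : h^-1 *: ((ramp (h *: 1 + z) ^+ 2) - ramp z ^+ 2) @[h --> (0 : R)^'] --> (2 * ramp z : R).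
  apply/cvgrPdist_le => e e0; near=> h.
  have h0 : h != 0 by near: h; exact: nbhs_dnbhs_neq.
  apply: (@le_trans _ _ `|h|); last first.
    near: h; apply: dnbhs0_le => //.
  rewrite /GRing.scale/= mulr1.
  rewrite (_ : _ - _ = h^-1 * (h * (2 * ramp z) - (ramp (h + z) ^+ 2 - ramp z ^+ 2))); last first.
    by rewrite [RHS]mulrBr mulKf.
  rewrite normrM normfV ler_pdivrMl ?normr_gt0// -expr2 real_normK ?num_real//.
  rewrite /ramp; case: (leP z 0) => z0; case: (leP (h + z) 0) => hz; rewrite ler_norml; apply/andP; split; nra.
have D : derivable (fun z => ramp z ^+ 2) z 1 by apply/cvg_ex; exists (2 * ramp z); exact: H.
by apply: DeriveDef => //; exact/cvg_lim.
Unshelve. all: by end_near. Qed.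

(* A piecewise quadratic C^1 step from 0 to 1: a Lipschitz derivative suffices. *)
Let psi z : R := 2 * (ramp z ^+ 2 - 2 * ramp (z - 2^-1) ^+ 2 + ramp (z - 1) ^+ 2).
Let dpsi z : R := 4 * (ramp z - 2 * ramp (z - 2^-1) + ramp (z - 1)).

Let is_derive_shift (f df : R -> R) (t z : R) : (forall z, is_derive z (1 : R) f (df z)) ->
  is_derive z 1 (fun z => f (z + t)) (df (z + t)).
Proof.
move=> fd; have := fd (z + t) => ?.
have -> : (fun z => f (z + t)) = f \o (fun z => z + t) by [].
by apply: is_derive_eq; rewrite addr0 [LHS]mulr1.
Qed.

Let is_derive_psi z : is_derive z 1 psi (dpsi z).
Proof.
have h1 := is_derive_ramp2 z.
have h2 := is_derive_shift (- 2^-1) z is_derive_ramp2.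
have h3 := is_derive_shift (- 1) z is_derive_ramp2.
rewrite /psi /dpsi; apply: is_derive_eq.
by rewrite /GRing.scale /=; ring.
Qed.

(** Rises from 0 to 1 on [-1, 0] and falls back to 0 on [1, 2]. *)
Let beta z : R := psi (z + 1) - psi (z - 1).
Let dbeta z : R := dpsi (z + 1) - dpsi (z - 1).

Let is_derive_beta z : is_derive z 1 beta (dbeta z).
Proof.
have h2 := is_derive_shift 1 z is_derive_psi.
have h3 := is_derive_shift (- 1) z is_derive_psi.
exact: is_deriveB.
Qed.

Let psi_le0 z : z <= 0 -> psi z = 0 /\ dpsi z = 0.
Proof.
move=> z0; rewrite /psi /dpsi !ramp_le0; [by split; ring|lra|lra|lra].
Qed.

Let psi_ge1 z : 1 <= z -> psi z = 1 /\ dpsi z = 0.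
Proof.
move=> z0; rewrite /psi /dpsi !ramp_ge0; [by split; field|lra|lra|lra].
Qed.

Let dbeta_lip x y : `|dbeta x - dbeta y| <= 32 * `|x - y|.
Proof.
have dpsi_lip s t : `|dpsi s - dpsi t| <= 16 * `|s - t|.
  have h1 := ramp_lip s t; have h2 := ramp_lip (s - 2^-1) (t - 2^-1).
  have h3 := ramp_lip (s - 1) (t - 1).
  rewrite !opprB !addrA !subrK in h2 h3.
  move: h1 h2 h3; rewrite /dpsi !ler_norml => /andP[? ?] /andP[? ?] /andP[? ?].
  by apply/andP; split; lra.
have h1 := dpsi_lip (x + 1) (y + 1); have h2 := dpsi_lip (x - 1) (y - 1).
rewrite (_ : x + 1 - (y + 1) = x - y) in h1; last by ring.
rewrite (_ : x - 1 - (y - 1) = x - y) in h2; last by ring.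
move: h1 h2; rewrite /dbeta !ler_norml => /andP[? ?] /andP[? ?].
by apply/andP; split; lra.
Qed.

Let beta_out z : ~~ (- 1 < z < 2) -> beta z = 0 /\ dbeta z = 0.
Proof.
rewrite negb_and -!leNgt /beta /dbeta => /orP[z1|z2].
  have [-> ->] : psi (z + 1) = 0 /\ dpsi (z + 1) = 0 by apply: psi_le0; lra.
  have [-> ->] : psi (z - 1) = 0 /\ dpsi (z - 1) = 0 by apply: psi_le0; lra.
  by rewrite subr0.
have [-> ->] : psi (z + 1) = 1 /\ dpsi (z + 1) = 0 by apply: psi_ge1; lra.
have [-> ->] : psi (z - 1) = 1 /\ dpsi (z - 1) = 0 by apply: psi_ge1; lra.
by rewrite !subrr.
Qed.

Let beta_in z : 0 <= z <= 1 -> beta z = 1 /\ dbeta z = 0.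
Proof.
move=> /andP[z0 z1]; rewrite /beta /dbeta.
have [-> ->] : psi (z + 1) = 1 /\ dpsi (z + 1) = 0 by apply: psi_ge1; lra.
have [-> ->] : psi (z - 1) = 0 /\ dpsi (z - 1) = 0 by apply: psi_le0; lra.
by rewrite !subr0.
Qed.

Let dbeta_le z : `|dbeta z| <= 96.
Proof.
have [/andP[z1 z2]|/beta_out[_ ->]] := boolP (- 1 < z < 2); last by rewrite normr0 ler0n.
have := dbeta_lip z (- 1); have [_ ->] : beta (- 1) = 0 /\ dbeta (- 1) = 0.
  by apply: beta_out; rewrite ltxx.
by rewrite subr0 => h; rewrite (le_trans h)// opprK ger0_norm; lra.
Qed.

Let beta_lip x y : `|beta x - beta y| <= 96 * `|x - y|.
Proof.
wlog xy : x y / x < y => [H|].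
  have [xy|xy|->] := ltgtP x y; [exact: H| |by rewrite !subrr normr0 mulr0].
  by rewrite distrC [X in _ * X]distrC; exact: H.
have cb : continuous beta.
  move=> z; have [dz _] := is_derive_beta z.
  by apply: differentiable_continuous; exact/derivable1_diffP.
have [|c _] := @MVT R beta dbeta x y xy (fun c _ => is_derive_beta c).
  exact: continuous_subspaceT.
rewrite distrC => ->; rewrite normrM [X in _ * X <= _]distrC ler_wpM2r//.
Qed.

Let beta_le z : `|beta z| <= 288.
Proof.
have [/andP[z1 z2]|/beta_out[-> _]] := boolP (- 1 < z < 2); last by rewrite normr0 ler0n.
have := beta_lip z (- 1); have [-> _] : beta (- 1) = 0 /\ dbeta (- 1) = 0.
  by apply: beta_out; rewrite ltxx.
by rewrite subr0 => h; rewrite (le_trans h)// opprK ger0_norm; lra.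
Qed.

(** All cut-offs are translates of one rescaled profile, so [K] depends on [r] alone. This is what
    makes the estimates uniform over the squares. *)
Lemma cutoff_exists r : 0 < r -> exists K, 0 <= K /\
  forall a, exists c d, cutoff a r K c d.
Proof.
(* 288 = 96 * 3 bounds [beta] on its support of length 3 and exceeds the other constants 96 and 32;
   the square dominates 1, 1 / r and 1 / r^2, the factors produced by rescaling. *)
move=> r0; pose K := 288 * (1 + r^-1) ^+ 2; have s0 : 0 < r^-1 by rewrite invr_gt0.
exists K; split; first by rewrite /K mulr_ge0 ?sqr_ge0 ?ler0n.
move=> a; exists (fun x => beta ((x - a) / r)), (fun x => dbeta ((x - a) / r) / r).
have K1 : 288 <= K by rewrite /K; nra.
have K2 : 288 * r^-1 <= K by rewrite /K; nra.
have K3 : 288 * r^-1 * r^-1 <= K by rewrite /K; nra.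
have sc x y : `|(x - a) / r - (y - a) / r| = `|x - y| * r^-1.
  by rewrite -mulrBl normrM (gtr0_norm s0); congr (`|_| * _); ring.
split.
- move=> x; have := is_derive_beta ((x - a) / r) => ?.
  have -> : (fun x => beta ((x - a) / r)) = beta \o (fun x => (x - a) / r) by [].
  by apply: is_derive_eq; rewrite /GRing.scale/=; ring.
- move=> x; apply/cvgrPdist_le => e e0; near=> y.
  rewrite -mulrBl normrM (gtr0_norm s0).
  apply: (@le_trans _ _ (K * `|x - y|)).
    have := dbeta_lip ((x - a) / r) ((y - a) / r); rewrite sc => h.
    by have := normr_ge0 (x - y); nra.
  rewrite mulrC -ler_pdivlMr; last by lra.
  near: y; apply: cvgr_dist_le => //; rewrite divr_gt0//; lra.
- move=> x /andP[x1 x2]; have [|-> ->] := @beta_in ((x - a) / r); last by rewrite mul0r.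
  by rewrite divr_ge0 ?subr_ge0 ?(ltW r0)//= ler_pdivrMr// mul1r lerBlDl.
- move=> x xo; have [|-> ->] := @beta_out ((x - a) / r); last by rewrite mul0r.
  apply: contra xo => /andP[]; rewrite ltr_pdivlMr// ltr_pdivrMr// => ? ?.
  by apply/andP; split; lra.
- by move=> x; rewrite (le_trans (beta_le _)).
- move=> x; rewrite normrM (gtr0_norm s0); have := dbeta_le ((x - a) / r) => h; nra.
- move=> x y; rewrite (le_trans (beta_lip _ _))// sc.
  by have := normr_ge0 (x - y); nra.
- move=> x y; rewrite -mulrBl normrM (gtr0_norm s0).
  have := dbeta_lip ((x - a) / r) ((y - a) / r); rewrite sc => h.
  by have := normr_ge0 (x - y); nra.
Unshelve. all: by end_near. Qed.

End bump.

(** * Primitives and local extensions *)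

Section primitive.
Variable R : realType.
Local Notation mu := (@lebesgue_measure R).
Local Notation leb2 := (@leb2 R).
Implicit Types (v : R * R -> R) (a c e r t h x y : R) (p q : R * R).
Local Open Scope ereal_scope.

Lemma Rint_ae1 (c : R) (F G : R -> R) : measurable_fun setT F -> measurable_fun setT G ->
  (forall s, s != c -> F s = G s) -> (\int[mu]_s F s = \int[mu]_s G s)%R.
Proof.
move=> mF mG FG; rewrite /Rintegral; congr fine; apply: ae_eq_integral => //; [by mea|by mea|].
exists [set c]; split; [by []|exact: lebesgue_measure_set1|].
by move=> x /=; apply: contra_notP => /eqP xc _; rewrite FG.
Qed.

Lemma Rint_shift1 (c : R) (F : R -> R) : measurable_fun setT F ->
  (\int[mu]_s F (s + c) = \int[mu]_s F s)%R.
Proof.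
move=> mF; rewrite /Rintegral; congr fine.
by apply: (int_shift c (f := EFin \o F)); rewrite /comp; mea.
Qed.

(** Required of every slice, not almost every one, so that identities between primitives hold
    pointwise. *)
Definition sliceL2 v := forall y, \int[mu]_s (v (s, y) ^+ 2)%:E < +oo.

Lemma integrable_if_sqr (c e : R) (F : R -> R) : (c <= e)%R -> measurable_fun setT F ->
  \int[mu]_s (F s ^+ 2)%:E < +oo ->
  mu.-integrable setT (EFin \o (fun s => if (c <= s <= e)%R then F s else 0%R)).
Proof.
move=> ce mF Foo.
have i2 : mu.-integrable setT (EFin \o (fun s => F s ^+ 2)%R).
  apply: integrable_ltoo; first by mea.
  by under eq_integral do rewrite ger0_norm ?sqr_ge0//.
have i1 : mu.-integrable setT (EFin \o (fun s => if (c <= s <= e)%R then 1%R else 0%R)).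
  apply: (@integrable_if_bounded _ c e 1%R (cst 1%R)) => //.
  by move=> s _; rewrite normr1.
apply: (@integrable_le _ _ _ mu _ (fun s => (if (c <= s <= e)%R then 1%R else 0%R) + F s ^+ 2)%R).
- by mea.
- move=> s; case: ifP => _; last by rewrite normr0 add0r sqr_ge0.
  by rewrite ler_norml; apply/andP; split; nra.
- exact: (integrableD measurableT i1 i2).
Qed.

Lemma slice_shift v t y : measurable_fun setT v -> sliceL2 v ->
  \int[mu]_s (v (t + s, y)%R ^+ 2)%:E < +oo.
Proof.
move=> mv sv; have := sv y; rewrite -(int_shift t (f := fun s => (v (s, y) ^+ 2)%:E)); last by mea.
by under [X in X < _ -> _]eq_integral do rewrite addrC.
Qed.

Lemma integrable_slice v c e t y : (c <= e)%R -> measurable_fun setT v -> sliceL2 v ->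
  mu.-integrable setT (EFin \o (fun s => if (c <= s <= e)%R then v (t + s, y)%R else 0%R)).
Proof.
move=> ce mv sv; apply: (@integrable_if_sqr c e (fun s => v (t + s, y)%R)) => //; first by mea.
exact: slice_shift.
Qed.

Lemma primx0 v p : measurable_fun setT v -> primx 0 v p = 0%R.
Proof.
move=> mv; rewrite /primx (@Rint_ae1 0 _ (cst 0%R)) //; first by rewrite /Rintegral integral0.
- by mea.
- by move=> s s0; case: ifP => // /andP[h1 h2]; case/eqP: s0; apply/eqP; rewrite eq_le h1 h2.
Qed.

Lemma primxD v s t p : (0 <= s)%R -> (0 <= t)%R -> measurable_fun setT v -> sliceL2 v ->
  primx (s + t) v p = (primx s v p + primx t v (p.1 + s, p.2))%R.
Proof.
move=> s0 t0 mv sv; rewrite /primx /=.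
pose F x := (if (0 <= x <= t) then v (p.1 + s + x, p.2) else 0)%R.
have mF : measurable_fun setT F by rewrite /F; mea.
rewrite -/F -(Rint_shift1 (- s) mF).
have i1 := @integrable_slice v 0 s p.1 p.2 s0 mv sv.
have hE (x : R) : (p.1 + s + (x - s) = p.1 + x)%R by ring.
have i2 : mu.-integrable setT (EFin \o (fun x => F (x - s)%R)).
  have st : (s <= s + t)%R by rewrite lerDl.
  have := @integrable_slice v s (s + t)%R p.1 p.2 st mv sv.
  congr (mu.-integrable _ _); apply/funext => x; rewrite /F /= subr_ge0 lerBlDl.
  by rewrite hE.
rewrite -RintegralD//.
(* The point [s] belongs to both intervals of integration and must be discarded. *)
apply: (@Rint_ae1 s); [by mea|by mea|] => x xs; rewrite /F subr_ge0 lerBlDl.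
rewrite hE; case: (ltgtP x s) xs => // xs _.
- have -> : (x <= s + t)%R by rewrite (le_trans (ltW xs))// lerDl.
  by rewrite !andbT addr0.
- by rewrite (le_trans s0 (ltW xs)) /= add0r.
Qed.

Lemma sliceL2_diff v h : measurable_fun setT v -> sliceL2 v -> sliceL2 (fdiff (0%R, h) v).
Proof.
move=> mv sv y; have h1 := sv y; have h2 := sv (y + h)%R.
apply: (@le_lt_trans _ _ (\int[mu]_s (2 * v (s, y + h)%R ^+ 2 + 2 * v (s, y) ^+ 2)%:E)).
  have md := measurable_diff (0%R, h) mv; apply: le_int; [by mea|by mea|by move=> s; exact: sqr_ge0|].
  move=> s; rewrite /fdiff /trans /= addr0; move: (v (s, y + h)%R) (v (s, y)) => A B.
  by have := sqr_ge0 (A + B)%R; clear; nra.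
rewrite intD; [|by mea|by mea|by move=> s; rewrite mulr_ge0 ?sqr_ge0|by move=> s; rewrite mulr_ge0 ?sqr_ge0].
have fin y' : \int[mu]_s (v (s, y') ^+ 2)%:E < +oo -> 2%:E * \int[mu]_s (v (s, y') ^+ 2)%:E < +oo.
  by move=> ?; rewrite lte_mul_pinfty// ge0_fin_numE// int_ge0// => s; exact: sqr_ge0.
rewrite intZ//; [|by mea|by move=> s; exact: sqr_ge0].
rewrite intZ//; [|by mea|by move=> s; exact: sqr_ge0].
by rewrite lte_add_pinfty ?fin.
Qed.

Lemma primx_diff v h t p : (0 <= t)%R -> measurable_fun setT v -> sliceL2 v ->
  primx t (fdiff (0%R, h) v) p = (primx t v (p.1, p.2 + h) - primx t v p)%R.
Proof.
move=> t0 mv sv; rewrite /primx -RintegralB//=; [|exact: integrable_slice|exact: integrable_slice].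
apply: eq_Rintegral => s _; rewrite /fdiff /trans /=.
by case: ifP => _; rewrite ?subrr// addr0.
Qed.

Section at_c.
Variables (c r : R) (r0 : (0 < r)%R).

(** The primitive in x starting at the line x = c; to the left of that line the interval is empty
    and the value is 0. *)
Definition prim v p : R := primx (p.1 - c) v (c, p.2).

Definition primavg v y : R := (r^-1 * \int[mu]_x (if (c <= x <= c + r) then prim v (x, y) else 0))%R.

(* Removing the mean over the strip makes the primitive, on bounded regions to
   the right of the strip, an average of [primx t v] with [t] bounded: no
   integration over a half-line is involved. *)
Definition cprim v p : R := (prim v p - primavg v p.2)%R.

Lemma measurable_prim v : measurable_fun setT v -> measurable_fun setT (prim v).
Proof.
move=> mv; have mp := measurable_primx mv.
have m1 : measurable_fun setT (fun p : R * R => ((p.1 - c)%R, (c, p.2))) by mea.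
exact: (measurableT_comp mp m1).
Qed.

Lemma measurable_cprim v : measurable_fun setT v -> measurable_fun setT (cprim v).
Proof.
move=> mv; have mp := measurable_prim mv.
have ma : measurable_fun setT (primavg v).
  have mi : measurable_fun setT (fun y => \int[mu]_x (if (c <= x <= c + r) then prim v (x, y) else 0))%R.
    by apply: (measurable_Rparam_mu (F := fun y x => if (c <= x <= c + r)%R then prim v (x, y) else 0%R)); mea.
  by rewrite /primavg; mea.
exact: (measurable_funB mp (measurableT_comp ma measurable_snd)).
Qed.

Lemma primB v x t y : measurable_fun setT v -> sliceL2 v -> (c <= x)%R -> (0 <= t)%R ->
  (prim v (x + t, y) - prim v (x, y) = primx t v (x, y))%R.
Proof.
move=> mv sv cx t0; rewrite /prim /=.
have -> : (x + t - c = (x - c) + t)%R by ring.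
rewrite primxD ?subr_ge0//= addrC addKr; congr (primx _ _ (_, _)); ring.
Qed.

Lemma cprimB v x t y : measurable_fun setT v -> sliceL2 v -> (c <= x)%R -> (0 <= t)%R ->
  (cprim v (x + t, y) - cprim v (x, y) = primx t v (x, y))%R.
Proof.
by move=> mv sv cx t0; rewrite /cprim /= -(@primB v x t y)//; ring.
Qed.

Lemma integrable_prim v e y : (c <= e)%R -> measurable_fun setT v -> sliceL2 v ->
  mu.-integrable setT (EFin \o (fun x => if (c <= x <= e)%R then prim v (x, y) else 0%R)).
Proof.
move=> ce mv sv; have mp := measurable_prim mv.
have ni : mu.-integrable setT (EFin \o (fun s => `|if (0 <= s <= e - c)%R then v (c + s, y)%R else 0%R|%R)).
  by apply: integrable_norm; apply: integrable_slice; rewrite ?subr_ge0.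
apply: (@integrable_if_bounded _ c e
  (\int[mu]_s `|if (0 <= s <= e - c) then v (c + s, y) else 0|)%R (fun x => prim v (x, y))) => //; first by mea.
move=> x /andP[cx xe]; rewrite /prim /primx /=.
have ix := @integrable_slice v 0 (x - c)%R c y ltac:(by rewrite subr_ge0) mv sv.
apply: (le_trans (le_normr_Rintegral _ ix)) => //.
apply: le_Rintegral => //; first exact: integrable_norm.
move=> s _; case: ifPn => [/andP[s0 sx]|_]; last by rewrite normr0.
by rewrite s0 (le_trans sx)// lerD2r.
Qed.

Lemma cprim_diff v h p : (c <= p.1)%R -> measurable_fun setT v -> sliceL2 v ->
  cprim (fdiff (0%R, h) v) p = (cprim v (p.1, p.2 + h) - cprim v p)%R.
Proof.
move=> cp mv sv.
have E q : (c <= q.1)%R -> prim (fdiff (0%R, h) v) q = (prim v (q.1, q.2 + h) - prim v q)%R.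
  by move=> cq; rewrite /prim primx_diff ?subr_ge0.
have cr : (c <= c + r)%R by rewrite lerDl ltW.
have EA : (\int[mu]_x (if (c <= x <= c + r) then prim (fdiff (0%R, h) v) (x, p.2) else 0) =
   \int[mu]_x (if (c <= x <= c + r) then prim v (x, p.2 + h) else 0) -
   \int[mu]_x (if (c <= x <= c + r) then prim v (x, p.2) else 0))%R.
  rewrite -RintegralB//; [|exact: integrable_prim|exact: integrable_prim].
  by apply: eq_Rintegral => x _; case: ifPn => [/andP[cx _]|_]; rewrite ?subrr// E.
rewrite /cprim (E p cp) /primavg EA; set A := prim v _; set B := prim v p.
by set S := Rintegral _ _ _; set T := Rintegral _ _ _; ring.
Qed.

Lemma cprim_avg v p : (c + r <= p.1)%R -> measurable_fun setT v -> sliceL2 v ->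
  cprim v p = (r^-1 * \int[mu]_x (if (c <= x <= c + r) then primx (p.1 - x) v (x, p.2) else 0))%R.
Proof.
move=> cp mv sv; have cr : (c <= c + r)%R by rewrite lerDl ltW.
have ip : mu.-integrable setT (EFin \o (fun x => if (c <= x <= c + r)%R then prim v p else 0%R)).
  exact: (@integrable_if_bounded _ c (c + r)%R `|prim v p| (cst (prim v p))).
transitivity (r^-1 * (\int[mu]_x (if (c <= x <= c + r) then prim v p else 0) -
   \int[mu]_x (if (c <= x <= c + r) then prim v (x, p.2) else 0)))%R.
  rewrite mulrBr /cprim /primavg; congr (_ - _)%R.
  rewrite Rint_if Rintegral_cst// [X in fine X](mu_itv cr) /= addrAC subrr add0r.
  by field; rewrite gt_eqF.
congr (_ * _)%R; rewrite -RintegralB//; last exact: integrable_prim.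
apply: eq_Rintegral => x _; case: ifPn => [/andP[cx xr]|_]; last by rewrite subrr.
rewrite -(@primB v x (p.1 - x)%R p.2)//; last by rewrite subr_ge0 (le_trans xr).
by rewrite [(x + _)%R]addrC subrK; case: (p).
Qed.

Lemma sqr_cprim_le v p : (c + r <= p.1)%R -> measurable_fun setT v -> sliceL2 v ->
  (cprim v p ^+ 2)%:E <= (r^-1)%:E *
    \int[mu]_x (if (c <= x <= c + r)%R then primx (p.1 - x) v (x, p.2) ^+ 2 else 0)%:E.
Proof.
move=> cp mv sv; rewrite cprim_avg// exprMn EFinM.
pose F x := primx (p.1 - x) v (x, p.2).
have mF : measurable_fun setT F.
  have m1 : measurable_fun setT (fun x : R => ((p.1 - x)%R, (x, p.2))) by mea.
  exact: (measurableT_comp (measurable_primx mv) m1).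
have := @sqr_Rint_if_le R c (c + r)%R F ltac:(by rewrite ltrDl) mF.
rewrite addrAC subrr add0r => h.
apply: (@le_trans _ _ (((r^-1) ^+ 2)%:E * (r%:E * \int[mu]_x (if (c <= x <= c + r)%R then F x ^+ 2 else 0)%:E))).
  by rewrite lee_pmul2l ?lte_fin ?exprn_gt0 ?invr_gt0//; exact: h.
by rewrite muleA -EFinM expr2 -mulrA mulVf ?mulr1// gt_eqF.
Qed.

(** Cauchy-Schwarz in the average, then the change of variable x = x' + t, where x' runs over the
    strip and x to its right. What remains are primitives of length t <= L starting in the enlarged
    rectangle, which includes the strip. *)
Lemma int_sqr_cprim_le v (b L : R) : measurable_fun setT v -> sliceL2 v ->
  \int[leb2]_p (if (c + r <= p.1 <= c + L) && (b - L <= p.2 <= b + L) then cprim v p ^+ 2 else 0)%:E <=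
  (r^-1)%:E * \int[mu]_t (if (0 < t <= L)%R then
    \int[leb2]_p (if (c <= p.1 <= c + L) && (b - L <= p.2 <= b + L) then primx t v p ^+ 2 else 0)%:E else 0).
Proof.
move=> mv sv; have mc := measurable_cprim mv; have mp := measurable_primx mv.
pose Y y := (b - L <= y <= b + L)%R.
have mY : measurable_fun setT Y by rewrite /Y; mea.
pose F x' x y : R := (if (c <= x' <= c + r) && (c + r <= x <= c + L) && Y y then
  primx (x - x') v (x', y) ^+ 2 else 0)%R.
have F0 x' x y : (0 <= F x' x y)%R by rewrite /F; case: ifP => // _; exact: sqr_ge0.
have mP : measurable_fun setT (fun z : R * (R * R) => primx (z.2.1 - z.1) v (z.1, z.2.2)).
  have m1 : measurable_fun setT (fun z : R * (R * R) => ((z.2.1 - z.1)%R, (z.1, z.2.2))) by mea.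
  exact: (measurableT_comp mp m1).
have mF : measurable_fun setT (fun z : R * (R * R) => F z.1 z.2.1 z.2.2).
  by rewrite /F /Y; mea.
have mF' : measurable_fun setT (fun z : (R * R) * R => F z.2 z.1.1 z.1.2).
  have m1 : measurable_fun setT (fun z : (R * R) * R => (z.2, (z.1.1, z.1.2))) by mea.
  exact: (measurableT_comp mF m1).
have r1 : (0 <= r^-1)%R by rewrite invr_ge0 ltW.
have i0 p : 0 <= \int[mu]_x' (F x' p.1 p.2)%:E by exact: int_ge0.
have mi : measurable_fun setT (fun p : R * R => \int[mu]_x' (F x' p.1 p.2)%:E).
  by apply: (measurable_param_mu (F := fun p x' => (F x' p.1 p.2)%:E)); mea.
apply: (@le_trans _ _ (\int[leb2]_p ((r^-1)%:E * \int[mu]_x' (F x' p.1 p.2)%:E))).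
  apply: ge0_le_integral; [by []|by move=> p _; case: ifP => // _; rewrite lee_fin sqr_ge0|
    by rewrite -/(Y _); mea|by apply: emeasurable_funM; [mea|exact: mi]|].
  move=> p _; case: ifPn => [/andP[/andP[x1 x2] yY]|_]; last by rewrite mule_ge0.
  have {}yY : Y p.2 by [].
  apply: (le_trans (@sqr_cprim_le v p x1 mv sv)).
  rewrite le_eqVlt; apply/orP; left; apply/eqP; congr (_ * _).
  by apply: eq_integral => x' _; rewrite /F x1 x2 yY /= !andbT.
rewrite ge0_integralZl//; apply: lee_wpmul2l => //.
rewrite (@tonelli _ _ _ (measurableTypeR R) R leb2 mu (fun p x' => (F x' p.1 p.2)%:E)); [|by mea|by move=> p x'; rewrite lee_fin].
pose H t (q : R * R) : R := (if (0 < t <= L) && ((c <= q.1 <= c + L) && Y q.2) then primx t v q ^+ 2 else 0)%R.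
have H0 t q : (0 <= H t q)%R by rewrite /H; case: ifP => // _; exact: sqr_ge0.
have mH : measurable_fun setT (fun z : R * (R * R) => H z.1 z.2) by rewrite /H /Y; mea.
have mH' : measurable_fun setT (fun z : (R * R) * R => H z.2 z.1).
  have m1 : measurable_fun setT (fun z : (R * R) * R => (z.2, z.1)) by mea.
  exact: (measurableT_comp mH m1).
have step x' y : \int[mu]_x (F x' x y)%:E <= \int[mu]_t (H t (x', y))%:E.
  rewrite -(int_shift x' (f := fun x => (F x' x y)%:E)); last first.
    have m1 : measurable_fun setT (fun x : R => (x', (x, y))) by mea.
    by have := measurableT_comp mF m1 => ?; mea.
  have m2 : measurable_fun setT (fun t : R => (x', ((t + x')%R, y))) by mea.
  have m3 : measurable_fun setT (fun t : R => (t, (x', y))) by mea.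
  have h2 := measurableT_comp mF m2; have h3 := measurableT_comp mH m3.
  apply: le_int; [exact: h2|exact: h3|by []|].
  move=> t; rewrite /F addrK; case: ifPn => [|_]; last exact: H0.
  move=> /andP[/andP[/andP[x1 x2] /andP[x3 x4]] yY].
  (* The value t = 0 occurs when x and x' are both c + r; the primitive is then 0. *)
  have [->|t0] := eqVneq t 0%R; first by rewrite primx0// expr0n/=; exact: H0.
  have tp : (0 < t)%R by rewrite lt_neqAle eq_sym t0 /=; lra.
  rewrite /H tp /= x1 yY /= andbT.
  by rewrite ifT//; apply/andP; split; [lra|lra].
apply: (@le_trans _ _ (\int[mu]_x' \int[mu]_y \int[mu]_t (H t (x', y))%:E)).
  apply: ge0_le_integral => //.
  - by move=> x' _; apply: integral_ge0 => p _; rewrite lee_fin.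
  - by apply: (measurable_param_leb2 (F := fun x' p => (F x' p.1 p.2)%:E)); mea.
  - have m1 := @measurable_param_mu R _ _ (fun q t => (H t q)%:E) (measurableT_comp (@EFin_measurable _ _) mH').
    exact: (@measurable_param_mu R _ _ (fun x' y => \int[mu]_t (H t (x', y))%:E) m1).
  move=> x' _.
  have -> : \int[leb2]_p (F x' p.1 p.2)%:E = \int[mu]_y \int[mu]_x (F x' x y)%:E.
    have m1 : measurable_fun setT (fun p : R * R => (x', p)) by mea.
    apply: (@leb2_tonelli2 R (fun p => (F x' p.1 p.2)%:E)).
      exact: (measurableT_comp (@EFin_measurable _ _) (measurableT_comp mF m1)).
    by move=> p; rewrite lee_fin.
  apply: ge0_le_integral; first exact: measurableT.
  - by move=> y _; exact: int_ge0.
  - have m1 : measurable_fun setT (fun z : R * R => (x', (z.2, z.1))) by mea.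
    have h1 := measurableT_comp mF m1.
    by apply: (@measurable_param_mu R _ _ (fun y x => (F x' x y)%:E)); mea.
  - have m1 : measurable_fun setT (fun z : R * R => (z.2, (x', z.1))) by mea.
    have h1 := measurableT_comp mH m1.
    by apply: (@measurable_param_mu R _ _ (fun y t => (H t (x', y))%:E)); mea.
  - by move=> y _; exact: step.
have m1 := @measurable_param_mu R _ _ (fun q t => (H t q)%:E) (measurableT_comp (@EFin_measurable _ _) mH').
have := @leb2_tonelli R (fun q => \int[mu]_t (H t q)%:E) m1 (fun q => int_ge0 mu (fun t => H0 t q)) => <-.
rewrite -(@tonelli _ _ (measurableTypeR R) _ R mu leb2 (fun t q => (H t q)%:E)); [|by mea|by move=> t q; rewrite lee_fin].
rewrite le_eqVlt; apply/orP; left; apply/eqP; apply: eq_integral => t _.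
rewrite /H; case: (0 < t <= L)%R => //=.
by rewrite integral0.
Qed.

Lemma ftc_if (k k' : R -> R) s e : (s <= e)%R -> (forall x, is_derive x (1 : R)%R k (k' x)) ->
  continuous k' -> (\int[mu]_x (if (s <= x <= e) then k' x else 0) = k e - k s)%R.
Proof.
rewrite le_eqVlt => /predU1P[<- dk ck|se dk ck].
  have mk : measurable_fun setT k' by exact: continuous_measurable_fun.
  rewrite (@Rint_ae1 s _ (cst 0%R)) ?subrr//; [by rewrite /Rintegral integral0|by mea|].
  by move=> x xs; case: ifP => // /andP[h1 h2]; case/eqP: xs; apply/eqP; rewrite eq_le h1 h2.
rewrite Rint_if /Rintegral (@continuous_FTC2 _ k' k s e) //.
- exact: continuous_subspaceT.
- have cF : continuous k.
    by move=> x; have [dx _] := dk x; apply: differentiable_continuous; apply/derivable1_diffP.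
  split.
  + by move=> x _; have [] := dk x.
  + by apply: cvg_at_right_filter; exact: cF.
  + by apply: cvg_at_left_filter; exact: cF.
- by move=> x _; rewrite derive1E; have [_ ->] := dk x.
Qed.

Lemma integrable_bmul (F h : R -> R) M : mu.-integrable setT (EFin \o F) ->
  measurable_fun setT h -> (forall x, `|h x| <= M)%R ->
  mu.-integrable setT (EFin \o (fun x => h x * F x)%R).
Proof.
move=> iF mh hM; have mF : measurable_fun setT F.
  by apply/measurable_EFinP; exact: (measurable_int _ iF).
apply: (@integrable_le _ _ _ mu _ (fun x => M * `|F x|)%R).
- by mea.
- by move=> x; rewrite normrM ler_wpM2r.
- exact: (integrableZl measurableT _ (integrable_norm iF)).
Qed.

Lemma integrable_cprim v e y : (c <= e)%R -> measurable_fun setT v -> sliceL2 v ->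
  mu.-integrable setT (EFin \o (fun x => if (c <= x <= e)%R then cprim v (x, y) else 0%R)).
Proof.
move=> ce mv sv.
have i1 : mu.-integrable setT (EFin \o (fun x => if (c <= x <= e)%R then primavg v y else 0%R)).
  exact: (@integrable_if_bounded _ c e `|primavg v y| (cst (primavg v y))).
have := integrableB measurableT (@integrable_prim v e y ce mv sv) i1.
congr (mu.-integrable _ _); apply/funext => x /=.
by rewrite -EFinB; case: ifP; rewrite ?subrr.
Qed.

(** [v] is merely square integrable on slices, so integration by parts is Fubini on the triangle c
    <= s <= x <= e: the integral of k' from s to e is -k(s). The subtracted mean disappears because
    k' has integral k(e) - k(c) = 0. *)
Lemma cprim_parts v (k k' : R -> R) e y M : (c <= e)%R -> measurable_fun setT v -> sliceL2 v ->
  (forall x, is_derive x (1 : R)%R k (k' x)) -> continuous k' -> (forall x, `|k' x| <= M)%R ->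
  (forall x, `|k x| <= M)%R -> k c = 0%R -> k e = 0%R ->
  (\int[mu]_x (if (c <= x <= e) then k' x * cprim v (x, y) else 0) =
   - \int[mu]_x (if (c <= x <= e) then k x * v (x, y) else 0))%R.
Proof.
move=> ce mv sv dk ck kM kM0 kc ke.
have mk' : measurable_fun setT k' by exact: continuous_measurable_fun.
have mk : measurable_fun setT k.
  apply: continuous_measurable_fun => x; have [dx _] := dk x.
  by apply: differentiable_continuous; apply/derivable1_diffP.
have ip := integrable_bmul (@integrable_prim v e y ce mv sv) mk' kM.
have ik : mu.-integrable setT (EFin \o (fun x => if (c <= x <= e)%R then k' x else 0%R)).
  exact: (@integrable_if_bounded _ c e M).
transitivity (\int[mu]_x (k' x * (if (c <= x <= e) then prim v (x, y) else 0)) -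
    \int[mu]_x (primavg v y * (if (c <= x <= e) then k' x else 0)))%R.
  rewrite -RintegralB//; last exact: (integrableZl measurableT _ ik).
  by apply: eq_Rintegral => x _; rewrite /cprim /=; case: ifP => _; ring.
rewrite RintegralZl// ftc_if// kc ke subrr mulr0 subr0.
pose F x s : R := (if (c <= x <= e) && (c <= s <= x) then k' x * v (s, y) else 0)%R.
have iv : mu.-integrable setT (EFin \o (fun s => if (c <= s <= e)%R then `|v (s, y)|%R else 0%R)).
  have := integrable_norm (@integrable_slice v c e 0%R y ce mv sv).
  by congr (mu.-integrable _ _); apply/funext => s /=; rewrite add0r; case: ifP => //; rewrite normr0.
have i1 : mu.-integrable setT (EFin \o (fun x => if (c <= x <= e)%R then M else 0%R)).
  exact: (@integrable_if_bounded _ c e `|M| (cst M)).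
have iF : (mu \x mu).-integrable setT (fun z => (F z.1 z.2)%:E).
  apply: (@integrable_prod _ _ (measurableTypeR R) (measurableTypeR R) R mu mu F _ _ _ i1 iv).
    by rewrite /F; mea.
  move=> x s; rewrite /F; case: ifPn => [/andP[/andP[cx xe] /andP[cs sx]]|_].
    by rewrite cx xe cs (le_trans sx xe) /= normrM ler_wpM2r.
  rewrite normr0 mulr_ge0//; last by case: ifP.
  by case: ifP => // _; rewrite (le_trans _ (kM 0%R)).
transitivity (\int[mu]_x \int[mu]_s F x s)%R.
  apply: eq_Rintegral => x _; case: ifPn => [xce|nx]; last first.
    by rewrite mulr0 /Rintegral integral0_eq// => s _; rewrite /F (negPf nx).
  have /andP[cx xe] := xce.
  rewrite /prim /primx /=.
  pose P s := (if (c <= s <= x) then v (s, y) else 0)%R.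
  have mP : measurable_fun setT P by rewrite /P; mea.
  have iP : mu.-integrable setT (EFin \o P).
    have := @integrable_slice v c x 0%R y cx mv sv.
    by congr (mu.-integrable _ _); apply/funext => s /=; rewrite add0r.
  rewrite (_ : Rintegral mu setT (fun s => if (0 <= s <= x - c)%R then v (c + s, y)%R else 0%R) =
    \int[mu]_s P s)%R; last first.
    rewrite -(Rint_shift1 c mP); apply: eq_Rintegral => s _; rewrite /P.
    by rewrite lerDr -lerBrDr [(s + c)%R]addrC.
  rewrite -RintegralZl//; apply: eq_Rintegral => s _; rewrite /F /P cx xe /=.
  by case: ifP => _; rewrite ?mulr0.
rewrite (@Rfubini _ _ (measurableTypeR R) (measurableTypeR R) R mu mu F iF).
have ikv : mu.-integrable setT (EFin \o (fun s => if (c <= s <= e)%R then (k s * v (s, y))%R else 0%R)).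
  have := integrable_bmul (@integrable_slice v c e 0%R y ce mv sv) mk kM0.
  by congr (mu.-integrable _ _); apply/funext => s /=; rewrite add0r; case: ifP; rewrite ?mulr0.
rewrite -mulN1r -RintegralZl//.
apply: eq_Rintegral => s _; case: ifPn => [/andP[cs se]|ns]; last first.
  rewrite mulr0 /Rintegral integral0_eq// => x _; rewrite /F; case: ifPn => //.
  move=> /andP[/andP[cx xe] /andP[cs sx]]; case/negP: ns.
  by rewrite cs (le_trans sx xe).
have is_ : mu.-integrable setT (EFin \o (fun x => if (s <= x <= e)%R then k' x else 0%R)).
  exact: (@integrable_if_bounded _ s e M).
transitivity (v (s, y) * \int[mu]_x (if (s <= x <= e) then k' x else 0))%R.
  rewrite -RintegralZl//; apply: eq_Rintegral => x _; rewrite /F cs /=.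
  have [sx|] := leP s x; last by rewrite andbF mulr0.
  rewrite (le_trans cs sx) /= andbT.
  by case: ifP; rewrite ?mulr0// mulrC.
by rewrite ftc_if// ke sub0r mulrN mulN1r mulrC.
Qed.

End at_c.

End primitive.

(** * The local extension and its finite differences *)

Section localization.
Variable R : realType.
Local Notation mu := (@lebesgue_measure R).
Local Notation leb2 := (@leb2 R).
Implicit Types (v : R * R -> R) (t h x y : R) (p q : R * R).
Variables (a b r K : R) (c d th dth : R -> R).
Hypotheses (r0 : (0 < r)%R) (K0 : (0 <= K)%R) (cc : cutoff a r K c d) (ct : cutoff b r K th dth).
Local Open Scope ereal_scope.

(** The mean is taken over [a - 3r, a - 2r]. The cut-off starts at a - r, and its translates by t <=
    r start no further left than a - 2r = a0 + r, the right edge of that strip. *)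
Let a0 : R := (a - 3 * r)%R.
Local Notation Phi := (cprim a0 r).

(* [loc v] is the x-derivative of [loc_pot v]. *)
Definition loc_pot v p : R := (c p.1 * th p.2 * Phi v p)%R.
Definition loc v p : R := (th p.2 * (c p.1 * v p + d p.1 * Phi v p))%R.

Let mc : measurable_fun setT c.
Proof.
apply: continuous_measurable_fun => x; have [dx _] := cutoff_derive cc x.
by apply: differentiable_continuous; apply/derivable1_diffP.
Qed.

Let md : measurable_fun setT d.
Proof. by apply: continuous_measurable_fun; exact: (cutoff_cont cc). Qed.

Let mth : measurable_fun setT th.
Proof.
apply: continuous_measurable_fun => x; have [dx _] := cutoff_derive ct x.
by apply: differentiable_continuous; apply/derivable1_diffP.
Qed.

Lemma measurable_loc_pot v : measurable_fun setT v -> measurable_fun setT (loc_pot v).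
Proof. by move=> mv; have := measurable_cprim a0 r mv => mp; rewrite /loc_pot; mea. Qed.

Lemma measurable_loc v : measurable_fun setT v -> measurable_fun setT (loc v).
Proof. by move=> mv; have := measurable_cprim a0 r mv => mp; rewrite /loc; mea. Qed.

Let e0 : R := (a + 3 * r)%R.

Let a0e0 : (a0 <= e0)%R.
Proof. by rewrite /a0 /e0; have := r0; lra. Qed.

Let cut_if x : (if (a0 <= x <= e0)%R then c x else 0%R) = c x /\
  (if (a0 <= x <= e0)%R then d x else 0%R) = d x.
Proof.
case: ifPn => // nx; have [|-> ->] := @cutoff_out _ _ _ _ _ _ cc x; last by [].
apply: contra nx => /andP[h1 h2]; have r' := r0.
by apply/andP; split; rewrite /a0 /e0; lra.
Qed.

(** [loc] as the x-derivative of [loc_pot], tested on one slice. With k = c w one has k' = d w + z c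
    w'; integration by parts cancels k v + k' Phi and leaves the term with -z c w'. *)
Lemma slice_parts v (w w' : R -> R) (z y : R) : measurable_fun setT v -> sliceL2 v ->
  (forall x, is_derive x (1 : R)%R w (z * w' x)%R) -> continuous w' ->
  (forall x, `|w x| <= 1)%R -> (forall x, `|w' x| <= 1)%R ->
  (\int[mu]_x (loc v (x, y) * w x) = \int[mu]_x (- z * (loc_pot v (x, y) * w' x)))%R.
Proof.
move=> mv sv dw cw w1 w'1.
pose k x := (c x * w x)%R; pose k' x := (d x * w x + c x * (z * w' x))%R.
have cw0 : continuous w.
  by move=> x; have [dx _] := dw x; apply: differentiable_continuous; apply/derivable1_diffP.
have cc0 : continuous c.
  move=> x; have [dx _] := cutoff_derive cc x.
  by apply: differentiable_continuous; apply/derivable1_diffP.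
have dk x : is_derive x (1 : R)%R k (k' x).
  have := cutoff_derive cc x; have := dw x => ? ?.
  by apply: is_derive_eq; rewrite /k' /GRing.scale /=; ring.
have ck : continuous k'.
  move=> x; rewrite /k'; apply: (@continuousD _ _ _ (fun x => d x * w x)%R (fun x => c x * (z * w' x))%R).
    by apply: continuousM; [exact: (cutoff_cont cc)|exact: cw0].
  apply: continuousM; first exact: cc0.
  by apply: continuousM; [exact: cst_continuous|exact: cw].
have cK := cutoff_le cc; have dK := cutoff_dle cc.
pose M := (K + K * `|z|)%R.
have kM x : (`|k' x| <= M)%R.
  rewrite /k' (le_trans (ler_normD _ _))// lerD//.
    rewrite normrM; have := dK x; have := w1 x; have := normr_ge0 (w x); have := normr_ge0 (d x); nra.
  by rewrite mulrA normrM -[leRHS]mulr1 ler_pM// normrM ler_wpM2r.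
have kM0 x : (`|k x| <= M)%R.
  rewrite /k normrM /M; have := cK x; have := w1 x; have := normr_ge0 (w x); have := normr_ge0 (c x).
  by have : (0 <= K * `|z|)%R by [rewrite mulr_ge0|]; nra.
have ka : k a0 = 0%R.
  rewrite /k; have [|-> _] := @cutoff_out _ _ _ _ _ _ cc a0; last by rewrite mul0r.
  by rewrite negb_and -!leNgt /a0; apply/orP; left; have := r0; lra.
have ke : k e0 = 0%R.
  rewrite /k; have [|-> _] := @cutoff_out _ _ _ _ _ _ cc e0; last by rewrite mul0r.
  by rewrite negb_and -!leNgt /e0; apply/orP; right; have := r0; lra.
have P := @cprim_parts R a0 r v k k' e0 y M a0e0 mv sv dk ck kM kM0 ka ke.
have mw : measurable_fun setT w by exact: continuous_measurable_fun.
have mw' : measurable_fun setT w' by exact: continuous_measurable_fun.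
have mk : measurable_fun setT k by rewrite /k; mea.
have mk' : measurable_fun setT k' by rewrite /k'; mea.
pose vi x := (if (a0 <= x <= e0) then v (x, y) else 0)%R.
pose pi_ x := (if (a0 <= x <= e0) then Phi v (x, y) else 0)%R.
have iv : mu.-integrable setT (EFin \o vi).
  have := @integrable_slice R v a0 e0 0%R y a0e0 mv sv.
  by congr (mu.-integrable _ _); apply/funext => s /=; rewrite add0r.
have ip : mu.-integrable setT (EFin \o pi_) by exact: integrable_cprim.
have ikv := integrable_bmul iv mk kM0; have ikp := integrable_bmul ip mk' kM.
have mcw : measurable_fun setT (fun x => c x * w' x)%R by mea.
have icp : mu.-integrable setT (EFin \o (fun x => (c x * w' x) * pi_ x)%R).
  apply: (@integrable_bmul _ _ _ K) => // x.
  by rewrite normrM; have := cK x; have := w'1 x; have := normr_ge0 (w' x); have := normr_ge0 (c x); nra.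
have E1 x : (loc v (x, y) * w x = th y * (k x * vi x + k' x * pi_ x) +
    (- z * th y) * (c x * w' x * pi_ x))%R.
  have [E2 E3] := cut_if x; rewrite /loc /k /k' /vi /pi_ /=; move: E2 E3.
  case: ifP => _ E2 E3; first by ring.
  by rewrite -E2 -E3; ring.
have E4 x : (loc_pot v (x, y) * w' x = th y * (c x * w' x * pi_ x))%R.
  have [E2 E3] := cut_if x; rewrite /loc_pot /pi_ /=; move: E2 E3.
  case: ifP => _ E2 E3; first by ring.
  by rewrite -E2; ring.
have ikk := integrableD measurableT ikv ikp.
transitivity (\int[mu]_x (th y * (k x * vi x + k' x * pi_ x)) +
   \int[mu]_x (- z * th y * (c x * w' x * pi_ x)))%R.
  rewrite -RintegralD//; [|exact: (integrableZl measurableT _ ikk)|exact: (integrableZl measurableT _ icp)].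
  by apply: eq_Rintegral => x _; exact: E1.
have -> : (\int[mu]_x (- z * (loc_pot v (x, y) * w' x)) =
    \int[mu]_x (- z * th y * (c x * w' x * pi_ x)))%R.
  by apply: eq_Rintegral => x _; rewrite E4; ring.
rewrite [X in (X + _)%R]RintegralZl// RintegralD//.
have -> : (\int[mu]_x (k x * vi x) = \int[mu]_x (if (a0 <= x <= e0) then k x * v (x, y) else 0))%R.
  by apply: eq_Rintegral => x _; rewrite /vi; case: ifP; rewrite ?mulr0.
have -> : (\int[mu]_x (k' x * pi_ x) = \int[mu]_x (if (a0 <= x <= e0) then k' x * Phi v (x, y) else 0))%R.
  by apply: eq_Rintegral => x _; rewrite /pi_; case: ifP; rewrite ?mulr0.
by rewrite P subrr mulr0 add0r.
Qed.

Lemma Rint_leb2_swap (f : R * R -> R) : leb2.-integrable setT (EFin \o f) ->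
  (\int[leb2]_p f p = \int[mu]_y \int[mu]_x f (x, y))%R.
Proof.
move=> fi; pose F x y := f (x, y).
have iF : (mu \x mu).-integrable setT (fun z => (F z.1 z.2)%:E).
  by move: fi; congr ((mu \x mu).-integrable _ _); apply/funext => -[].
rewrite -(@Rfubini _ _ (measurableTypeR R) (measurableTypeR R) R mu mu F iF).
rewrite -(@Rintegral_prod _ _ (measurableTypeR R) (measurableTypeR R) R mu mu F iF).
by apply: eq_Rintegral => -[].
Qed.

Lemma ft2_loc v k : measurable_fun setT v -> sliceL2 v ->
  leb2.-integrable setT (EFin \o loc v) -> leb2.-integrable setT (EFin \o loc_pot v) ->
  ft2 (loc v) k = (k.1 ^+ 2 * ft2 (loc_pot v) k)%R.
Proof.
move=> mv sv ig iG; rewrite !ft2E.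
have H (w w' : R -> R -> R) (z : R) :
    (forall y x, is_derive x (1 : R)%R (w y) (z * w' y x)%R) -> (forall y, continuous (w' y)) ->
    (forall y x, `|w y x| <= 1)%R -> (forall y x, `|w' y x| <= 1)%R ->
    leb2.-integrable setT (EFin \o (fun p => loc v p * w p.2 p.1)%R) ->
    leb2.-integrable setT (EFin \o (fun p => loc_pot v p * w' p.2 p.1)%R) ->
    (\int[leb2]_p (loc v p * w p.2 p.1) = - z * \int[leb2]_p (loc_pot v p * w' p.2 p.1))%R.
  move=> dw cw w1 w1' i1 i2; rewrite -RintegralZl//.
  rewrite (Rint_leb2_swap i1) (@Rint_leb2_swap (fun p => - z * (loc_pot v p * w' p.2 p.1))%R); last first.
    exact: (integrableZl measurableT _ i2).
  apply: eq_Rintegral => y _ /=.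
  exact: slice_parts.
have dph (y x : R) : is_derive x (1 : R)%R (fun x => x * k.1 + y * k.2)%R k.1.
  by apply: is_derive_eq; rewrite /GRing.scale /=; ring.
have cph (y : R) : continuous (fun x : R => x * k.1 + y * k.2)%R.
  by move=> x; have [dx _] := dph y x; apply: differentiable_continuous; apply/derivable1_diffP.
have Ec : (FTre (loc v) k = k.1 * FTsin (loc_pot v) k)%R.
  rewrite -[in RHS](opprK k.1).
  apply: (H (fun y x => cos (x * k.1 + y * k.2)%R) (fun y x => sin (x * k.1 + y * k.2)%R) (- k.1)%R).
  - move=> y x; have := dph y x => ?; apply: is_derive_eq; rewrite /GRing.scale /=; ring.
  - by move=> y x; apply: continuous_comp; [exact: cph|exact: continuous_sin].
  - by move=> y x; exact: cos_max.
  - by move=> y x; exact: sin_max.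
  - exact: integrable_cos.
  - exact: integrable_sin.
have Es : (FTsin (loc v) k = - k.1 * FTre (loc_pot v) k)%R.
  apply: (H (fun y x => sin (x * k.1 + y * k.2)%R) (fun y x => cos (x * k.1 + y * k.2)%R) k.1).
  - move=> y x; have := dph y x => ?; apply: is_derive_eq; rewrite /GRing.scale /=; ring.
  - by move=> y x; apply: continuous_comp; [exact: cph|exact: continuous_cos].
  - by move=> y x; exact: sin_max.
  - by move=> y x; exact: cos_max.
  - exact: integrable_sin.
  - exact: integrable_cos.
by rewrite Ec Es; ring.
Qed.

(** The region on which [v] influences the estimates: x from the left edge of the strip, and
    primitives of length up to 6 r. [Q'] below omits the strip, so that the averaged formula for Phi
    is valid on it. *)
Definition nbhd p : bool := (a0 <= p.1 <= a0 + 6 * r)%R && (b - 6 * r <= p.2 <= b + 6 * r)%R.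

Let Q' p : bool := (a0 + r <= p.1 <= a0 + 6 * r)%R && (b - 6 * r <= p.2 <= b + 6 * r)%R.

Definition EQ (f : R * R -> R) : \bar R := \int[leb2]_p (if nbhd p then f p ^+ 2 else 0)%:E.

Let EQ' (f : R * R -> R) : \bar R := \int[leb2]_p (if Q' p then f p ^+ 2 else 0)%:E.

(** The local quantity that controls Phi on [Q']. *)
Definition AQ v : \bar R := \int[mu]_t (if (0 < t <= 6 * r)%R then EQ (primx t v) else 0).

Lemma EQ_ge0 f : 0 <= EQ f.
Proof. by apply: int_ge0 => p; case: ifP => // _; exact: sqr_ge0. Qed.

Lemma AQ_ge0 v : 0 <= AQ v.
Proof. by apply: integral_ge0 => t _; case: ifP => // _; exact: EQ_ge0. Qed.

Lemma measurable_nbhd : measurable_fun setT nbhd.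
Proof. by rewrite /nbhd; mea. Qed.

Let mQ' : measurable_fun setT Q'. Proof. by rewrite /Q'; mea. Qed.

Let k0 : R := (1 + r^-1)%R.

Let k1 : (1 <= k0)%R.
Proof. by rewrite /k0 lerDl invr_ge0 ltW. Qed.

Let EQ'_le f : measurable_fun setT f -> EQ' f <= k0%:E * EQ f.
Proof.
move=> mf; have mn := measurable_nbhd; apply: (@le_trans _ _ (EQ f)); last first.
  by rewrite -[leLHS]mul1e lee_wpmul2r ?lee_fin ?EQ_ge0.
apply: le_int; [by mea|by mea|by move=> p; case: ifP => // _; exact: sqr_ge0|].
move=> p; case: ifPn => [/andP[/andP[h1 h2] h3]|_]; last by case: ifP => // _; exact: sqr_ge0.
by rewrite /nbhd h2 h3 (le_trans _ h1)// lerDl ltW.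
Qed.

Let EQ'_Phi v : measurable_fun setT v -> sliceL2 v -> EQ' (Phi v) <= k0%:E * AQ v.
Proof.
move=> mv sv; apply: (le_trans (@int_sqr_cprim_le R a0 r r0 v b (6 * r)%R mv sv)).
rewrite lee_wpmul2r//; first exact: AQ_ge0.
by rewrite lee_fin /k0 lerDr.
Qed.

Let lin4 (M c1 c2 c3 c4 s1 s2 s3 s4 x1 x2 x3 x4 : R) : (0 <= M)%R ->
  (`|c1| <= M * s1)%R -> (`|c2| <= M * s2)%R -> (`|c3| <= M * s3)%R -> (`|c4| <= M * s4)%R ->
  ((c1 * x1 + c2 * x2 + c3 * x3 + c4 * x4) ^+ 2 <=
   4 * M ^+ 2 * (s1 ^+ 2 * x1 ^+ 2 + s2 ^+ 2 * x2 ^+ 2 + s3 ^+ 2 * x3 ^+ 2 + s4 ^+ 2 * x4 ^+ 2))%R.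
Proof.
move=> M0 h1 h2 h3 h4.
have sq (z s x : R) : (`|z| <= M * s)%R -> ((z * x) ^+ 2 <= M ^+ 2 * (s ^+ 2 * x ^+ 2))%R.
  move=> h; rewrite exprMn mulrA ler_wpM2r ?sqr_ge0// -exprMn -(real_normK (num_real z)).
  by rewrite lerXn2r// nnegrE// (le_trans _ h).
have := sq _ _ x1 h1; have := sq _ _ x2 h2; have := sq _ _ x3 h3; have := sq _ _ x4 h4.
set y1 := (c1 * x1)%R; set y2 := (c2 * x2)%R; set y3 := (c3 * x3)%R; set y4 := (c4 * x4)%R.
have := sqr_ge0 (y1 - y2)%R; have := sqr_ge0 (y1 - y3)%R; have := sqr_ge0 (y1 - y4)%R.
have := sqr_ge0 (y2 - y3)%R; have := sqr_ge0 (y2 - y4)%R; have := sqr_ge0 (y3 - y4)%R.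
rewrite -(mulrA 4%R) !mulrDr.
move: (M ^+ 2 * (s1 ^+ 2 * x1 ^+ 2))%R (M ^+ 2 * (s2 ^+ 2 * x2 ^+ 2))%R
  (M ^+ 2 * (s3 ^+ 2 * x3 ^+ 2))%R (M ^+ 2 * (s4 ^+ 2 * x4 ^+ 2))%R => z1 z2 z3 z4.
by move: y1 y2 y3 y4 => y1 y2 y3 y4; lra.
Qed.

Definition cL : R := (4 * (K ^+ 2) ^+ 2 * (1 + r^-1))%R.

Lemma cL_ge0 : (0 <= cL)%R.
Proof. by rewrite /cL -/k0 !mulr_ge0 ?sqr_ge0// (le_trans ler01 k1). Qed.

(** The common shape of the bounds below: [X] vanishes off [Q'] and is there a combination of four
    functions with coefficients at most K^2 s_j, where s_j carries the powers of [t] and [h]. The 4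
    in [cL] comes from squaring four terms, and 1 + 1 / r covers both plain functions (factor 1) and
    Phi (factor 1 / r). Spare slots are filled with 0. *)
Let int_lin4 (X x1 x2 x3 x4 : R * R -> R) (s1 s2 s3 s4 : R) (E1 E2 E3 E4 : \bar R) :
  measurable_fun setT X -> measurable_fun setT x1 -> measurable_fun setT x2 ->
  measurable_fun setT x3 -> measurable_fun setT x4 ->
  EQ' x1 <= k0%:E * E1 -> EQ' x2 <= k0%:E * E2 -> EQ' x3 <= k0%:E * E3 -> EQ' x4 <= k0%:E * E4 ->
  0 <= E1 -> 0 <= E2 -> 0 <= E3 -> 0 <= E4 ->
  (forall p, ~~ Q' p -> X p = 0%R) ->
  (forall p, Q' p -> exists c1 c2 c3 c4, [/\ (`|c1| <= K ^+ 2 * s1)%R, (`|c2| <= K ^+ 2 * s2)%R,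
     (`|c3| <= K ^+ 2 * s3)%R, (`|c4| <= K ^+ 2 * s4)%R &
     X p = (c1 * x1 p + c2 * x2 p + c3 * x3 p + c4 * x4 p)%R]) ->
  N2 X <= cL%:E * ((s1 ^+ 2)%:E * E1 + (s2 ^+ 2)%:E * E2 + (s3 ^+ 2)%:E * E3 + (s4 ^+ 2)%:E * E4).
Proof.
move=> mX m1 m2 m3 m4 h1 h2 h3 h4 p1 p2 p3 p4 Xo Xi.
pose ind (x : R * R -> R) p : R := (if Q' p then x p ^+ 2 else 0)%R.
have ind0 (x : R * R -> R) p : (0 <= ind x p)%R by rewrite /ind; case: ifP => // _; exact: sqr_ge0.
have mind (x : R * R -> R) : measurable_fun setT x -> measurable_fun setT (ind x) by move=> mx; rewrite /ind; mea.
have i1 := mind _ m1; have i2 := mind _ m2; have i3 := mind _ m3; have i4 := mind _ m4.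
have s0 (s : R) (x : R * R -> R) p : (0 <= s ^+ 2 * ind x p)%R by rewrite mulr_ge0 ?sqr_ge0.
have c40 : (0 <= 4 * (K ^+ 2) ^+ 2)%R by rewrite mulr_ge0 ?sqr_ge0.
apply: (@le_trans _ _ (\int[leb2]_p (4 * (K ^+ 2) ^+ 2 * (s1 ^+ 2 * ind x1 p + s2 ^+ 2 * ind x2 p +
    s3 ^+ 2 * ind x3 p + s4 ^+ 2 * ind x4 p))%:E)).
  apply: le_int; [by mea|by mea|by move=> p; exact: sqr_ge0|] => p.
  rewrite /ind; have [/Xi[c1 [c2 [c3 [c4 [b1 b2 b3 b4 ->]]]]]|/Xo ->] := boolP (Q' p).
    by apply: lin4 => //; exact: sqr_ge0.
  by rewrite expr0n/= !mulr0 !addr0 mulr0.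
rewrite intZ//; [|by mea|by move=> p; rewrite !addr_ge0].
rewrite [cL%:E](_ : _ = (4 * (K ^+ 2) ^+ 2)%:E * k0%:E); last by rewrite -EFinM.
rewrite -muleA; apply: lee_wpmul2l; first by rewrite lee_fin.
rewrite intD; [|by mea|by mea|by move=> p; rewrite !addr_ge0|by []].
rewrite intD; [|by mea|by mea|by move=> p; rewrite !addr_ge0|by []].
rewrite intD; [|by mea|by mea|by []|by []].
rewrite !intZ ?sqr_ge0//.
have E0 (s : R) E : 0 <= E -> 0 <= (s ^+ 2)%:E * E by move=> ?; rewrite mule_ge0// lee_fin sqr_ge0.
have le1 (s : R) (x : R * R -> R) E : EQ' x <= k0%:E * E ->
    (s ^+ 2)%:E * \int[leb2]_p (ind x p)%:E <= k0%:E * ((s ^+ 2)%:E * E).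
  by move=> h; rewrite muleCA lee_wpmul2l// lee_fin sqr_ge0.
rewrite [leRHS]ge0_muleDr ?adde_ge0 ?E0// [in leRHS]ge0_muleDr ?adde_ge0 ?E0//.
by rewrite [in leRHS]ge0_muleDr ?E0// !leeD// le1.
Qed.

Let co x t : (0 <= t <= r)%R -> ~~ (a0 + r <= x <= a0 + 6 * r)%R ->
  c (x + t) = 0%R /\ d (x + t) = 0%R.
Proof.
move=> /andP[t0 tr] nx; apply: (cutoff_out cc); apply: contra nx => /andP[h1 h2].
by have r' := r0; apply/andP; split; rewrite /a0; lra.
Qed.

Let to y h : (0 <= h <= r)%R -> ~~ (b - 6 * r <= y <= b + 6 * r)%R -> th (y + h) = 0%R.
Proof.
move=> /andP[t0 tr] nx; have [|//] := @cutoff_out _ _ _ _ _ _ ct (y + h)%R; apply: contra nx => /andP[h1 h2].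
by have r' := r0; apply/andP; split; lra.
Qed.

Let co0 x : ~~ (a0 + r <= x <= a0 + 6 * r)%R -> c x = 0%R /\ d x = 0%R.
Proof. by move=> nx; rewrite -{1 2}(addr0 x); apply: co => //; rewrite lexx ltW. Qed.

Let to0 y : ~~ (b - 6 * r <= y <= b + 6 * r)%R -> th y = 0%R.
Proof. by move=> nx; rewrite -(addr0 y); apply: to => //; rewrite lexx ltW. Qed.

Let cK := cutoff_le cc.
Let dK := cutoff_dle cc.
Let tK := cutoff_le ct.

Let prodK (x y s t : R) : (0 <= s)%R -> (0 <= t)%R ->
  (`|x| <= K * s)%R -> (`|y| <= K * t)%R -> (`|x * y| <= K ^+ 2 * (s * t))%R.
Proof.
move=> s0 t0 hx hy; rewrite normrM expr2 mulrACA ler_pM//.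
Qed.

Let lipK (f : R -> R) (x t : R) : (0 <= t)%R -> (forall x y, `|f x - f y| <= K * `|x - y|)%R ->
  (`|f (x + t) - f x| <= K * t)%R.
Proof.
move=> t0 H; have := H (x + t)%R x.
have -> : (x + t - x = t)%R by ring.
by rewrite (ger0_norm t0).
Qed.

Let E00 : EQ' (cst 0%R) <= k0%:E * 0.
Proof. by rewrite mule0 /EQ' integral0_eq// => p _; case: ifP => _; rewrite ?expr0n. Qed.

Section bounds.
Variables (v : R * R -> R) (t h : R).
Hypotheses (mv : measurable_fun setT v) (sv : sliceL2 v) (t0 : (0 < t <= r)%R) (h0 : (0 < h <= r)%R).

Let mP : measurable_fun setT (Phi v). Proof. exact: measurable_cprim. Qed.
Let md_h : measurable_fun setT (fdiff (0%R, h) v). Proof. exact: measurable_diff. Qed.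
Let sd : sliceL2 (fdiff (0%R, h) v). Proof. exact: sliceL2_diff. Qed.
Let mG : measurable_fun setT (loc_pot v). Proof. exact: measurable_loc_pot. Qed.
Let mg : measurable_fun setT (loc v). Proof. exact: measurable_loc. Qed.
Let m0 : measurable_fun setT (cst 0%R : R * R -> R). Proof. exact: measurable_cst. Qed.
Let t00 : (0 <= t)%R. Proof. by case/andP: t0 => /ltW. Qed.
Let h00 : (0 <= h)%R. Proof. by case/andP: h0 => /ltW. Qed.
Let t01 : (0 <= t <= r)%R. Proof. by case/andP: t0 => /ltW -> ->. Qed.
Let h01 : (0 <= h <= r)%R. Proof. by case/andP: h0 => /ltW -> ->. Qed.
Let a0x x : (a0 + r <= x)%R -> (a0 <= x)%R.
Proof. by move=> h'; rewrite (le_trans _ h')// lerDl ltW. Qed.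
Let cK1 x : (`|c x| <= K * 1)%R. Proof. by rewrite mulr1. Qed.
Let dK1 x : (`|d x| <= K * 1)%R. Proof. by rewrite mulr1. Qed.
Let tK1 x : (`|th x| <= K * 1)%R. Proof. by rewrite mulr1. Qed.
Let n0 : (`|0 : R| <= K ^+ 2 * 0)%R. Proof. by rewrite normr0 mulr0. Qed.

Lemma N2_loc_le : N2 (loc v) <= cL%:E * (EQ v + AQ v).
Proof.
have := @int_lin4 (loc v) v (Phi v) (cst 0%R) (cst 0%R) (1 * 1) (1 * 1) 0 0 (EQ v) (AQ v) 0 0
  mg mv mP m0 m0 (EQ'_le mv) (EQ'_Phi mv sv) E00 E00 (EQ_ge0 v) (AQ_ge0 v) (lexx _) (lexx _).
rewrite !mulr1 expr1n expr0n/= !mul0e !mul1e !adde0; apply.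
  move=> p; rewrite negb_and => /orP[/co0[cx dx]|/to0 ty]; last by rewrite /loc ty mul0r.
  by rewrite /loc cx dx !mul0r addr0 mulr0.
move=> p _; exists (th p.2 * c p.1)%R, (th p.2 * d p.1)%R, 0%R, 0%R; split => //.
- by have := prodK ler01 ler01 (tK1 p.2) (cK1 p.1); rewrite !mulr1.
- by have := prodK ler01 ler01 (tK1 p.2) (dK1 p.1); rewrite !mulr1.
- by rewrite /loc /=; ring.
Qed.

Lemma N2_loc_pot_le : N2 (loc_pot v) <= cL%:E * AQ v.
Proof.
have := @int_lin4 (loc_pot v) (Phi v) (cst 0%R) (cst 0%R) (cst 0%R) (1 * 1) 0 0 0 (AQ v) 0 0 0
  mG mP m0 m0 m0 (EQ'_Phi mv sv) E00 E00 E00 (AQ_ge0 v) (lexx _) (lexx _) (lexx _).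
rewrite !mulr1 expr1n expr0n/= !mul0e !mul1e !adde0; apply.
  move=> p; rewrite negb_and => /orP[/co0[cx dx]|/to0 ty]; last by rewrite /loc_pot ty mulr0 mul0r.
  by rewrite /loc_pot cx !mul0r.
move=> p _; exists (c p.1 * th p.2)%R, 0%R, 0%R, 0%R; split => //.
- by have := prodK ler01 ler01 (cK1 p.1) (tK1 p.2); rewrite !mulr1.
- by rewrite /loc_pot /=; ring.
Qed.

(** Discrete product rule for c v + d Phi. The differences of [c] and [d] give a factor t by the
    Lipschitz bounds, and the x-difference of Phi is the primitive [primx t v], in which the average
    has cancelled. *)
Lemma N2_fdiff_loc_le : N2 (fdiff (t, 0%R) (loc v)) <=
  cL%:E * (EQ (fdiff (t, 0%R) v) + (t ^+ 2)%:E * EQ v + EQ (primx t v) + (t ^+ 2)%:E * AQ v).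
Proof.
have mX := measurable_diff (t, 0%R) mg; have mdv := measurable_diff (t, 0%R) mv.
have mJ := measurable_primxt t mv.
have := @int_lin4 _ _ _ _ _ (1 * 1) (1 * t) (1 * 1) (1 * t) _ _ _ _
  mX mdv mv mJ mP (EQ'_le mdv) (EQ'_le mv) (EQ'_le mJ) (EQ'_Phi mv sv)
  (EQ_ge0 _) (EQ_ge0 _) (EQ_ge0 _) (AQ_ge0 _).
rewrite mulr1 mul1r expr1n !mul1e; apply.
  move=> p; rewrite negb_and /fdiff /trans /loc /= addr0 => /orP[px|/to0 ->]; last by rewrite !mul0r subrr.
  have [-> ->] := co0 px; have [-> ->] := co t01 px.
  by rewrite !mul0r !addr0 mulr0 subrr.
move=> p /andP[/andP[px _] _].
exists (th p.2 * c (p.1 + t))%R, (th p.2 * (c (p.1 + t) - c p.1))%R,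
  (th p.2 * d (p.1 + t))%R, (th p.2 * (d (p.1 + t) - d p.1))%R; split.
- by have := prodK ler01 ler01 (tK1 p.2) (cK1 (p.1 + t)%R); rewrite !mulr1.
- by have := prodK ler01 t00 (tK1 p.2) (lipK p.1 t00 (cutoff_lip cc)); rewrite mul1r.
- by have := prodK ler01 ler01 (tK1 p.2) (dK1 (p.1 + t)%R); rewrite !mulr1.
- by have := prodK ler01 t00 (tK1 p.2) (lipK p.1 t00 (cutoff_dlip cc)); rewrite mul1r.
have J := @cprimB R a0 r v p.1 t p.2 mv sv (a0x px) t00.
have -> : primx t v p = (Phi v (p.1 + t, p.2) - Phi v p)%R by rewrite J; case: (p).
by rewrite /fdiff /trans /loc /= addr0; ring.
Qed.

(** A y-difference of Phi is Phi of the y-difference, since primitive and average act in x only. *)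
Lemma N2_fdiff_loc_pot_le : N2 (fdiff (0%R, h) (loc_pot v)) <=
  cL%:E * (AQ (fdiff (0%R, h) v) + (h ^+ 2)%:E * AQ v).
Proof.
have mX := measurable_diff (0%R, h) mG.
have mD := measurable_cprim a0 r md_h.
have := @int_lin4 _ _ _ _ _ (1 * 1) (1 * h) 0 0 _ _ _ _
  mX mD mP m0 m0 (EQ'_Phi md_h sd) (EQ'_Phi mv sv) E00 E00 (AQ_ge0 _) (AQ_ge0 _) (lexx _) (lexx _).
rewrite mulr1 mul1r expr1n expr0n/= !mul0e !mul1e !adde0; apply.
  move=> p; rewrite negb_and /fdiff /trans /loc_pot /= addr0 => /orP[/co0[-> _]|py].
    by rewrite !mul0r subrr.
  move: (Phi v (p.1, p.2 + h)%R) (Phi v p) => A B.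
  by rewrite (to0 py) (to h01 py) !mulr0 !mul0r subrr.
move=> p /andP[/andP[px _] _].
exists (c p.1 * th (p.2 + h))%R, (c p.1 * (th (p.2 + h) - th p.2))%R, 0%R, 0%R; split => //.
- by have := prodK ler01 ler01 (cK1 p.1) (tK1 (p.2 + h)%R); rewrite !mulr1.
- by have := prodK ler01 h00 (cK1 p.1) (lipK p.2 h00 (cutoff_lip ct)); rewrite mul1r.
rewrite (@cprim_diff R a0 r r0 v h p (a0x px) mv sv).
rewrite /fdiff /trans /loc_pot /= addr0.
move: (Phi v (p.1, p.2 + h)%R) (Phi v p) (c p.1) (th p.2) (th (p.2 + h)%R) => A B C D E.
by ring.
Qed.

(** The discrete product rule in both variables: each difference falls either on Phi, giving
    [primx t] or a y-difference of [v], or on a cut-off, giving a factor t or h. When both fall on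
    cut-offs the full Phi remains, with factor t h. *)
Lemma N2_fdiff2_loc_pot_le : N2 (fdiff (t, 0%R) (fdiff (0%R, h) (loc_pot v))) <=
  cL%:E * (EQ (primx t (fdiff (0%R, h) v)) + (t ^+ 2)%:E * AQ (fdiff (0%R, h) v) +
    (h ^+ 2)%:E * EQ (primx t v) + ((t * h) ^+ 2)%:E * AQ v).
Proof.
have mX := measurable_diff (t, 0%R) (measurable_diff (0%R, h) mG).
have mD := measurable_cprim a0 r md_h.
have mJ := measurable_primxt t mv; have mJD := measurable_primxt t md_h.
have := @int_lin4 _ _ _ _ _ (1 * 1) (t * 1) (1 * h) (t * h) _ _ _ _
  mX mJD mD mJ mP (EQ'_le mJD) (EQ'_Phi md_h sd) (EQ'_le mJ) (EQ'_Phi mv sv)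
  (EQ_ge0 _) (AQ_ge0 _) (EQ_ge0 _) (AQ_ge0 _).
rewrite !mulr1 mul1r expr1n !mul1e; apply.
  move=> p; rewrite negb_and /fdiff /trans /loc_pot /= !addr0 => /orP[px|py].
    by have [-> _] := co0 px; have [-> _] := co t01 px; rewrite !mul0r !subrr.
  move: (Phi v (p.1 + t, p.2 + h)%R) (Phi v (p.1 + t, p.2)%R) (Phi v (p.1, p.2 + h)%R) (Phi v p) => A B D E.
  by rewrite (to0 py) (to h01 py) !mulr0 !mul0r !subrr.
move=> p /andP[/andP[px _] _].
exists (c (p.1 + t) * th (p.2 + h))%R, ((c (p.1 + t) - c p.1) * th (p.2 + h))%R,
  (c (p.1 + t) * (th (p.2 + h) - th p.2))%R, ((c (p.1 + t) - c p.1) * (th (p.2 + h) - th p.2))%R.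
have tl := lipK p.2 h00 (cutoff_lip ct); have cl := lipK p.1 t00 (cutoff_lip cc).
split.
- by have := prodK ler01 ler01 (cK1 (p.1 + t)%R) (tK1 (p.2 + h)%R); rewrite !mulr1.
- by have := prodK t00 ler01 cl (tK1 (p.2 + h)%R); rewrite mulr1.
- by have := prodK ler01 h00 (cK1 (p.1 + t)%R) tl; rewrite mul1r.
- exact: prodK t00 h00 cl tl.
have J := @cprimB R a0 r v p.1 t p.2 mv sv (a0x px) t00.
have JD := @cprimB R a0 r _ p.1 t p.2 md_h sd (a0x px) t00.
have px' : (a0 <= (p.1 + t, p.2).1)%R by rewrite /= (le_trans (a0x px))// lerDl.
have D1 := @cprim_diff R a0 r r0 v h p (a0x px) mv sv.
have D2 := @cprim_diff R a0 r r0 v h (p.1 + t, p.2)%R px' mv sv.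
have -> : primx t v p = (Phi v (p.1 + t, p.2) - Phi v p)%R by rewrite J; case: (p).
have -> : primx t (fdiff (0%R, h) v) p = (Phi (fdiff (0%R, h) v) (p.1 + t, p.2) - Phi (fdiff (0%R, h) v) p)%R.
  by rewrite JD; case: (p).
rewrite D1 D2 /fdiff /trans /loc_pot /= !addr0.
move: (Phi v (p.1 + t, p.2 + h)%R) (Phi v (p.1 + t, p.2)%R) (Phi v (p.1, p.2 + h)%R) (Phi v p) => A B D E.
by move: (c p.1) (c (p.1 + t)%R) (th p.2) (th (p.2 + h)%R) => x y z w; ring.
Qed.

End bounds.

Lemma EQ_le f : measurable_fun setT f -> EQ f <= N2 f.
Proof.
move=> mf; have mn := measurable_nbhd.
apply: le_int; [by mea|by mea|by move=> p; case: ifP => // _; exact: sqr_ge0|].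
by move=> p; case: ifP => // _; exact: sqr_ge0.
Qed.

Lemma measurable_EQ_primx v : measurable_fun setT v -> measurable_fun setT (fun t => EQ (primx t v)).
Proof.
move=> mv; have mp := measurable_primx mv; have mn := measurable_nbhd.
apply: (measurable_param_leb2 (F := fun t p => (if nbhd p then primx t v p ^+ 2 else 0)%:E)).
have mn' : measurable_fun setT (fun z : R * (R * R) => nbhd z.2) by exact: (measurableT_comp mn measurable_snd).
by mea.
Qed.

Lemma AQ_fin v : L2 v -> AQ v < +oo.
Proof.
move=> [mv voo]; pose L := (6 * r)%R; have L0 : (0 < L)%R by rewrite mulr_gt0.
have fN : N2 v \is a fin_num by rewrite ge0_fin_numE ?N2_ge0.
apply: (@le_lt_trans _ _ (\int[mu]_t (if (0 <= t <= L)%R then (L ^+ 2 * fine (N2 v))%R else 0%R)%:E)).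
  apply: ge0_le_integral => //.
  - by move=> t _; case: ifP => // _; exact: EQ_ge0.
  - have := measurable_EQ_primx mv => ?; mea.
  - by mea.
  move=> t _; case: ifPn => [/andP[t0 tL]|_]; last first.
    by rewrite lee_fin; case: ifP => // _; rewrite mulr_ge0 ?sqr_ge0 ?fine_ge0 ?N2_ge0.
  rewrite (ltW t0) tL /=; apply: (le_trans (EQ_le (measurable_primxt t mv))).
  apply: (le_trans (N2_primx_le t0 mv)); rewrite [leRHS]EFinM fineK// lee_wpmul2r ?N2_ge0// lee_fin.
  by rewrite lerXn2r// nnegrE ltW.
by rewrite (int_if_cst _ (ltW L0)) ltry.
Qed.

Let out_box p : ~~ Q' p -> loc_pot ^~ p =1 cst 0%R /\ loc ^~ p =1 cst 0%R.
Proof.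
rewrite negb_and => /orP[/co0[cx dx]|/to0 ty]; split => v; rewrite /loc_pot /loc /=.
- by rewrite cx !mul0r.
- by rewrite cx dx !mul0r addr0 mulr0.
- by rewrite ty mulr0 mul0r.
- by rewrite ty mul0r.
Qed.

Let Q'_box p : Q' p -> inbox (`|a| + `|b| + 10 * r)%R p.
Proof.
move=> /andP[/andP[h1 h2] /andP[h3 h4]]; have r' := r0; rewrite /a0 in h1 h2.
have := ler_norm a; have := ler_norm (- a)%R; have := ler_norm b; have := ler_norm (- b)%R.
rewrite !normrN => n1 n2 n3 n4.
by apply/andP; split; rewrite ler_norml; apply/andP; split; lra.
Qed.

Lemma cl2_loc_pot v : L2 v -> sliceL2 v -> cl2 (loc_pot v).
Proof.
move=> vL sv; have [mv voo] := vL; split; first exact: measurable_loc_pot.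
- apply: (le_lt_trans (N2_loc_pot_le mv sv)).
  by rewrite lte_mul_pinfty ?lee_fin ?cL_ge0// ?AQ_fin.
- exists (`|a| + `|b| + 10 * r)%R => p np; apply: Q'_box.
  by apply: contraNT np => /out_box[/(_ v) -> _].
Qed.

Lemma cl2_loc v : L2 v -> sliceL2 v -> cl2 (loc v).
Proof.
move=> vL sv; have [mv voo] := vL; split; first exact: measurable_loc.
- apply: (le_lt_trans (N2_loc_le mv sv)).
  rewrite lte_mul_pinfty ?lee_fin ?cL_ge0//.
  by rewrite lte_add_pinfty ?AQ_fin// (le_lt_trans (EQ_le mv)).
- exists (`|a| + `|b| + 10 * r)%R => p np; apply: Q'_box.
  by apply: contraNT np => /out_box[_ /(_ v) ->].
Qed.

Lemma loc_in v p : (a <= p.1 <= a + r)%R -> (b <= p.2 <= b + r)%R -> loc v p = v p.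
Proof.
move=> /(cutoff_in cc)[c1 d1] /(cutoff_in ct)[t1 _].
by rewrite /loc c1 d1 t1 !mul1r mul0r addr0.
Qed.

End localization.

(** * Summation over the squares *)

Section overlap.
Variable R : realType.
Local Notation mu := (@lebesgue_measure R).
Local Notation leb2 := (@leb2 R).
Implicit Types (p : R * R).
Local Open Scope ereal_scope.

Lemma int_sum (F : nat -> R * R -> R) N : (forall i, measurable_fun setT (F i)) ->
  (forall i p, 0 <= F i p)%R ->
  \int[leb2]_p (\sum_(0 <= i < N) F i p)%R%:E = \sum_(0 <= i < N) \int[leb2]_p (F i p)%:E.
Proof.
move=> mF F0; elim: N => [|N IH].
  by rewrite big_geq// integral0_eq// => p _; rewrite big_geq.
rewrite big_nat_recr//= -IH -intD//.
- by apply: eq_integral => p _; rewrite big_nat_recr.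
- exact: measurable_sum.
- exact: mF.
- by move=> p; exact: sumr_ge0.
Qed.

Variables (a b : nat -> R) (r : R).
Hypothesis r0 : (0 < r)%R.

Let sq i p : bool := (a i < p.1 < a i + r)%R && (b i < p.2 < b i + r)%R.

Hypothesis sq3 : forall p (s : seq nat), uniq s -> (forall i, i \in s -> sq i p) -> (size s <= 3)%N.

(* If [p] is in the enlarged square of index [i], the i-th square contains a
   point of this 40 x 40 grid, whence the overlap bound [4800 = 3 * 40 ^ 2]. *)
Let grid p (m n : 'I_40) : R * R :=
  (p.1 + (m%:R - 20) * r / 2, p.2 + (n%:R - 20) * r / 2)%R.

Let grid1 (x y : R) : (- 6 * r <= y - x <= 6 * r)%R ->
  exists m : 'I_40, (y < x + (m%:R - 20) * r / 2 < y + r)%R.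
Proof.
(* [z] is the real index at which the grid meets the edge y. With spacing r / 2 the index just above
   it, the integer part plus 1, lies strictly inside (y, y + r); z <= 32 keeps it below 40. *)
move=> /andP[h1 h2]; pose z := (2 * (y - x) / r + 20)%R.
have zr : (z * r = 2 * (y - x) + 20 * r)%R by rewrite /z mulrDl divfK// gt_eqF.
have z0 : (0 <= z)%R by rewrite -(pmulr_lge0 _ r0) zr; have := r0; lra.
have /andP[t1 t2] := truncn_itv z0; set j := Num.truncn z in t1 t2.
have z32 : (z <= 32)%R by rewrite -(ler_pM2r r0) zr; lra.
have jlt : (j.+1 < 40)%N.
  have : (j%:R <= 32%:R :> R)%R by rewrite (le_trans t1).
  by rewrite ler_nat => jj; exact: (@leq_ltn_trans 32 j 39 jj).
have nE : (j.+1%:R = j%:R + 1 :> R)%R by rewrite natr1.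
rewrite -(ler_pM2r r0) zr in t1.
have {}t2 : (z * r < j%:R * r + r)%R.
  by rewrite -[X in (_ < _ + X)%R]mul1r -mulrDl -nE ltr_pM2r.
rewrite zr in t2.
exists (Ordinal jlt); rewrite [nat_of_ord _]/= nE.
have -> : ((j%:R + 1 - 20) * r / 2 = (j%:R * r - 19 * r) / 2)%R by field.
move: t1 t2; set w := (j%:R * r)%R => t1 t2.
by apply/andP; split; lra.
Qed.

Lemma overlap_le N p : (\sum_(0 <= i < N) (nbhd (a i) (b i) r p : nat) <= 4800)%N.
Proof.
have H i : ((nbhd (a i) (b i) r p : nat) <= \sum_(m < 40) \sum_(n < 40) (sq i (grid p m n) : nat))%N.
  case: (boolP (nbhd _ _ _ _)) => //= /andP[/andP[h1 h2] /andP[h3 h4]]; have r' := r0.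
  have [m hm] := @grid1 p.1 (a i) ltac:(by apply/andP; split; lra).
  have [n hn] := @grid1 p.2 (b i) ltac:(by apply/andP; split; lra).
  rewrite (bigD1 m)//= (bigD1 n)//= /sq /grid /= hm hn.
  by rewrite -addnA leq_addr.
apply: (@leq_trans (\sum_(0 <= i < N) \sum_(m < 40) \sum_(n < 40) (sq i (grid p m n) : nat))%N).
  exact: leq_sum.
rewrite exchange_big /=; apply: (@leq_trans (\sum_(m < 40) 120)%N); last by rewrite sum_nat_const card_ord.
apply: leq_sum => m _; rewrite exchange_big /=; apply: (@leq_trans (\sum_(n < 40) 3)%N); last by rewrite sum_nat_const card_ord.
apply: leq_sum => n _; rewrite (eq_bigr (fun i => if sq i (grid p m n) then 1 else 0)%N); last first.
  by move=> i _; case: sq.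
rewrite -big_mkcond /= sum1_count -size_filter.
apply: (sq3 (p := grid p m n)); first by rewrite filter_uniq// iota_uniq.
by move=> i; rewrite mem_filter => /andP[].
Qed.

(** The integrand summed over i is f^2 times the number of enlarged squares containing the point. *)
Lemma sum_EQ_le N (f : R * R -> R) : measurable_fun setT f ->
  \sum_(0 <= i < N) EQ (a i) (b i) r f <= 4800%:E * N2 f.
Proof.
move=> mf; have mn i := @measurable_nbhd R (a i) (b i) r.
pose F i p : R := (if nbhd (a i) (b i) r p then f p ^+ 2 else 0)%R.
have mF i : measurable_fun setT (F i) by have := mn i => ?; rewrite /F; mea.
have F0 i p : (0 <= F i p)%R by rewrite /F; case: ifP => // _; exact: sqr_ge0.
apply: (@le_trans _ _ (\int[leb2]_p (\sum_(0 <= i < N) F i p)%:E)).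
  by rewrite (int_sum N mF F0).
rewrite /N2 -intZ; [|by mea|by move=> p; exact: sqr_ge0|exact: ler0n].
apply: le_int; [by apply: measurable_sum|by mea|by move=> p; exact: sumr_ge0|] => p.
have -> : (\sum_(0 <= i < N) F i p = (\sum_(0 <= i < N) (nbhd (a i) (b i) r p : nat))%N%:R * f p ^+ 2)%R.
  rewrite natr_sum mulr_suml; apply: eq_bigr => i _; rewrite /F.
  by case: ifP => _; rewrite ?mul1r ?mul0r.
by rewrite ler_wpM2r ?sqr_ge0// ler_nat overlap_le.
Qed.

End overlap.

(** * Summing quadratic bounds *)

Section summation.
Variable R : realType.
Local Notation mu := (@lebesgue_measure R).
Local Notation leb2 := (@leb2 R).
Implicit Types (p k : R * R).
Local Open Scope ereal_scope.

Lemma le_scale (x S S' : \bar R) (e e' : R) : x <= e%:E * S -> (0 <= e)%R -> (e <= e')%R ->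
  0 <= S -> S <= S' -> x <= e'%:E * S'.
Proof.
move=> xS e0 ee S0 SS; apply: (le_trans xS); apply: lee_pmul => //; by rewrite lee_fin.
Qed.

Lemma leD_scale (x y S : \bar R) (e f : R) : (0 <= e)%R -> (0 <= f)%R ->
  x <= e%:E * S -> y <= f%:E * S -> x + y <= (e + f)%:E * S.
Proof. by move=> e0 f0 xS yS; rewrite EFinD ge0_muleDl ?lee_fin// leeD. Qed.

Lemma leM_scale (x S : \bar R) (e f : R) : (0 <= f)%R -> x <= e%:E * S -> f%:E * x <= (f * e)%:E * S.
Proof. by move=> f0 xS; rewrite EFinM -muleA lee_wpmul2l ?lee_fin. Qed.

Lemma sum_lin4 N (C M s1 s2 s3 s4 : R) (X A1 A2 A3 A4 : nat -> \bar R) (B1 B2 B3 B4 : \bar R) :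
  (0 <= C)%R -> (0 <= M)%R -> (0 <= s1)%R -> (0 <= s2)%R -> (0 <= s3)%R -> (0 <= s4)%R ->
  (forall i, 0 <= A1 i) -> (forall i, 0 <= A2 i) -> (forall i, 0 <= A3 i) -> (forall i, 0 <= A4 i) ->
  0 <= B1 -> 0 <= B2 -> 0 <= B3 -> 0 <= B4 ->
  \sum_(0 <= i < N) A1 i <= M%:E * B1 -> \sum_(0 <= i < N) A2 i <= M%:E * B2 ->
  \sum_(0 <= i < N) A3 i <= M%:E * B3 -> \sum_(0 <= i < N) A4 i <= M%:E * B4 ->
  (forall i, X i <= C%:E * (s1%:E * A1 i + s2%:E * A2 i + s3%:E * A3 i + s4%:E * A4 i)) ->
  \sum_(0 <= i < N) X i <= (C * M)%:E * (s1%:E * B1 + s2%:E * B2 + s3%:E * B3 + s4%:E * B4).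
Proof.
move=> C0 M0 s10 s20 s30 s40 a1 a2 a3 a4 b1 b2 b3 b4 h1 h2 h3 h4 HX.
have sA (s : R) (A : nat -> \bar R) i : (0 <= s)%R -> (forall i, 0 <= A i) -> 0 <= s%:E * A i.
  by move=> s0 A0; rewrite mule_ge0.
have sB (s : R) (B : \bar R) : (0 <= s)%R -> 0 <= B -> 0 <= s%:E * B.
  by move=> s0 B0; rewrite mule_ge0.
apply: (@le_trans _ _ (\sum_(0 <= i < N) C%:E * (s1%:E * A1 i + s2%:E * A2 i + s3%:E * A3 i + s4%:E * A4 i))).
  by apply: lee_sum => i _; exact: HX.
rewrite -ge0_sume_distrr; last by move=> i _; rewrite !adde_ge0 ?sA.
rewrite EFinM -muleA lee_wpmul2l// !big_split /=.
have le1 (s : R) (A : nat -> \bar R) (B : \bar R) : (0 <= s)%R -> (forall i, 0 <= A i) ->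
    \sum_(0 <= i < N) A i <= M%:E * B -> \sum_(0 <= i < N) s%:E * A i <= M%:E * (s%:E * B).
  by move=> s0 A0 AB; rewrite -ge0_sume_distrr// muleCA lee_wpmul2l.
rewrite [leRHS]ge0_muleDr ?adde_ge0 ?sB// [in leRHS]ge0_muleDr ?adde_ge0 ?sB//.
by rewrite [in leRHS]ge0_muleDr ?sB// !leeD// le1.
Qed.

Variables (r : R) (r0 : (0 < r)%R).

Let Ir (P : R -> \bar R) : \bar R := \int[mu]_t (if (0 < t <= r)%R then ((t ^+ 2)^-1)%:E * P t else 0).

Let ti0 (t : R) : (0 <= (t ^+ 2)^-1)%R. Proof. by rewrite invr_ge0 sqr_ge0. Qed.

Let int_cst_le (E S : \bar R) (e : R) : 0 <= E -> E <= e%:E * S -> (0 <= e)%R ->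
  \int[mu]_t (if (0 < t <= r)%R then E else 0) <= (r * e)%:E * S.
Proof.
move=> E0 ES e0; apply: (@le_trans _ _ (\int[mu]_t (if (0 <= t <= r)%R then E else 0))).
  apply: ge0_le_integral => //.
  - by move=> t _; case: ifP.
  - by mea.
  - by mea.
  - by move=> t _; case: ifPn => [/andP[t0 ->]|_]; [rewrite (ltW t0)|case: ifP].
rewrite int_if integral_cst//= [X in _ * X](mu_itv (ltW r0)) subr0 muleC.
by apply: leM_scale => //; exact: ltW.
Qed.

(** Dividing the difference bound by t^2 leaves constants in the two terms with factor t^2, which
    integrate to r times their value over (0, r], and the weighted integrals of [P1] and [P3] in the
    others. The last factor is (1 / r) 2 + 2 (1 + r + 1 + r). *)
Lemma sum_Hs_le N (f : nat -> R * R -> R) (C1 q : R) (P1 P3 : R -> \bar R) (e2 e4 S : \bar R) :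
  (forall i, measurable_fun setT (f i)) -> (0 <= C1)%R -> (0 <= q)%R -> 0 <= S ->
  measurable_fun setT P1 -> measurable_fun setT P3 ->
  (forall t, 0 <= P1 t) -> (forall t, 0 <= P3 t) -> 0 <= e2 -> 0 <= e4 ->
  (forall t, (0 < t <= r)%R -> \sum_(0 <= i < N) N2 (fdiff (t, 0%R) (f i)) <=
     C1%:E * (P1 t + (t ^+ 2)%:E * e2 + P3 t + (t ^+ 2)%:E * e4)) ->
  \sum_(0 <= i < N) N2 (f i) <= (C1 * (2 * q))%:E * S ->
  Ir P1 <= q%:E * S -> e2 <= q%:E * S -> Ir P3 <= q%:E * S -> e4 <= q%:E * S ->
  \sum_(0 <= i < N) Hs r (f i) <= (C1 * q * (2 / r + 4 + 4 * r))%:E * S.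
Proof.
move=> mf C10 q0 S0 mP1 mP3 p1 p3 h2 h4 Ht HN h1 he2 h3 he4.
pose I i := Ir (fun t => N2 (fdiff (t, 0%R) (f i))).
have N0 i (t : R) : 0 <= (if (0 < t <= r)%R then ((t ^+ 2)^-1)%:E * N2 (fdiff (t, 0%R) (f i)) else 0).
  by case: ifP => // _; rewrite mule_ge0 ?N2_ge0// lee_fin.
have I0 i : 0 <= I i by exact: integral_ge0.
have r1 : (0 <= r^-1)%R by rewrite invr_ge0 ltW.
rewrite /Hs big_split /= -!ge0_sume_distrr//; last by move=> i _; exact: N2_ge0.
have HI : \sum_(0 <= i < N) I i <= (C1 * (q + r * q + q + r * q))%:E * S.
  rewrite /I /Ir -ge0_integral_sum//; last first.
    move=> i; have mN := measurable_N2_diff (mf i); mea.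
  pose Q (e : \bar R) (t : R) : \bar R := if (0 < t <= r)%R then e else 0.
  pose J (P : R -> \bar R) (t : R) : \bar R := if (0 < t <= r)%R then ((t ^+ 2)^-1)%:E * P t else 0.
  have J0 P t : (forall t, 0 <= P t) -> 0 <= J P t.
    by move=> P0; rewrite /J; case: ifP => // _; rewrite mule_ge0 ?lee_fin.
  have Q0 e t : 0 <= e -> 0 <= Q e t by move=> e0; rewrite /Q; case: ifP.
  have mJ P : measurable_fun setT P -> measurable_fun setT (J P) by move=> mP; rewrite /J; mea.
  have mQ e : measurable_fun setT (Q e) by rewrite /Q; mea.
  have m12 : measurable_fun setT (fun t => J P1 t + Q e2 t) by apply: emeasurable_funD; [exact: mJ|].
  have m123 : measurable_fun setT (fun t => J P1 t + Q e2 t + J P3 t) by apply: emeasurable_funD; [|exact: mJ].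
  have m1234 : measurable_fun setT (fun t => J P1 t + Q e2 t + J P3 t + Q e4 t).
    exact: emeasurable_funD.
  apply: (@le_trans _ _ (\int[mu]_t (C1%:E * (J P1 t + Q e2 t + J P3 t + Q e4 t)))).
    apply: ge0_le_integral => //.
    - by move=> t _; apply: sume_ge0 => i _; exact: N0.
    - apply: emeasurable_sum => i; have mN := measurable_N2_diff (mf i); mea.
    - exact: emeasurable_funM.
    move=> t _; rewrite /J /Q; case: ifPn => [tr|_]; last first.
      by rewrite big1// !adde0 mule0.
    have t2 : (0 < t ^+ 2)%R by case/andP: tr => t0 _; rewrite exprn_gt0.
    rewrite -ge0_sume_distrr; last by move=> i _; exact: N2_ge0.
    apply: (@le_trans _ _ (((t ^+ 2)^-1)%:E * (C1%:E * (P1 t + (t ^+ 2)%:E * e2 + P3 t + (t ^+ 2)%:E * e4)))).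
      by rewrite lee_wpmul2l ?lee_fin//; exact: Ht.
    rewrite muleCA lee_wpmul2l ?lee_fin//.
    have te0 e : 0 <= e -> 0 <= (t ^+ 2)%:E * e by move=> ?; rewrite mule_ge0// lee_fin ltW.
    rewrite ge0_muleDr ?adde_ge0 ?te0// ge0_muleDr ?adde_ge0 ?te0// ge0_muleDr ?te0//.
    by rewrite !muleA -EFinM mulVf ?gt_eqF// !mul1e.
  rewrite ge0_integralZl ?lee_fin//; last by move=> t _; rewrite !adde_ge0 ?J0 ?Q0.
  apply: leM_scale => //.
  have iD (A B : R -> \bar R) : (forall t, 0 <= A t) -> measurable_fun setT A ->
      (forall t, 0 <= B t) -> measurable_fun setT B ->
      \int[mu]_t (A t + B t) = \int[mu]_t A t + \int[mu]_t B t.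
    by move=> A0 mA B0 mB; apply: ge0_integralD.
  have a1 t : 0 <= J P1 t by exact: J0.
  have a2 t : 0 <= Q e2 t by exact: Q0.
  have a3 t : 0 <= J P3 t by exact: J0.
  have a4 t : 0 <= Q e4 t by exact: Q0.
  have a12 t : 0 <= J P1 t + Q e2 t by rewrite adde_ge0.
  have a123 t : 0 <= J P1 t + Q e2 t + J P3 t by rewrite !adde_ge0.
  have -> : \int[mu]_t (J P1 t + Q e2 t + J P3 t + Q e4 t) =
      \int[mu]_t J P1 t + \int[mu]_t Q e2 t + \int[mu]_t J P3 t + \int[mu]_t Q e4 t.
    rewrite -(iD _ _ a1 (mJ _ mP1) a2 (mQ e2)) -(iD _ _ a12 m12 a3 (mJ _ mP3)).
    exact: (iD _ _ a123 m123 a4 (mQ e4)).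
  have rq : (0 <= r * q)%R by rewrite mulr_ge0// ltW.
  apply: leD_scale; rewrite ?addr_ge0//; last exact: int_cst_le.
  apply: leD_scale; rewrite ?addr_ge0//.
  by apply: leD_scale => //; exact: int_cst_le.
have -> : (C1 * q * (2 / r + 4 + 4 * r) = r^-1 * (C1 * (2 * q)) + 2 * (C1 * (q + r * q + q + r * q)))%R.
  by field; rewrite gt_eqF.
have rq : (0 <= r * q)%R by rewrite mulr_ge0// ltW.
by apply: leD_scale; [by rewrite !mulr_ge0|by rewrite !mulr_ge0// !addr_ge0|exact: leM_scale|exact: leM_scale].
by move=> i _; exact: I0.
Qed.

End summation.

(** * The four weighted sums *)

Section square_sum.
Variable R : realType.
Local Notation mu := (@lebesgue_measure R).
Local Notation leb2 := (@leb2 R).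
Implicit Types (p k : R * R) (v : R * R -> R).
Local Open Scope ereal_scope.
Variables (a b : nat -> R) (r K : R) (c d th dth : nat -> R -> R).
Hypotheses (r0 : (0 < r)%R) (K0 : (0 <= K)%R).
Hypothesis cc : forall i, cutoff (a i) r K (c i) (d i).
Hypothesis ct : forall i, cutoff (b i) r K (th i) (dth i).
Hypothesis sq3 : forall p (s : seq nat), uniq s ->
  (forall i, i \in s -> (a i < p.1 < a i + r)%R && (b i < p.2 < b i + r)%R) -> (size s <= 3)%N.
Variables (u Fr Fi : R * R -> R).
Hypotheses (uL2 : L2 u) (us : sliceL2 u) (uF : is_FT u Fr Fi).

Let g i := loc (a i) r (c i) (d i) (th i) u.
Let G i := loc_pot (a i) r (c i) (th i) u.
Let S := FTsq Fr Fi.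

Let mu_ : measurable_fun setT u. Proof. by case: uL2. Qed.
Let mS : measurable_fun setT S. Proof. exact: is_FT_meas uF. Qed.
Let S_ge0 k : (0 <= S k)%R. Proof. exact: FTsq_ge0. Qed.
Let cg i : cl2 (g i). Proof. exact: (cl2_loc r0 K0 (cc i) (ct i)). Qed.
Let cG i : cl2 (G i). Proof. exact: (cl2_loc_pot r0 K0 (cc i) (ct i)). Qed.
Let mg i : measurable_fun setT (g i). Proof. by case: (cg i). Qed.
Let mG i : measurable_fun setT (G i). Proof. by case: (cG i). Qed.
Let gG i k : ft2 (g i) k = (k.1 ^+ 2 * ft2 (G i) k)%R.
Proof. exact: (ft2_loc r0 K0 (cc i) k mu_ us (cl2_integrable (cg i)) (cl2_integrable (cG i))). Qed.

Let L : R := (6 * r)%R.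
Let L0 : (0 < L)%R. Proof. by rewrite mulr_gt0. Qed.
(** The global counterpart of [AQ], left after summation over the squares. *)
Let A v : \bar R := \int[mu]_t (if (0 < t <= L)%R then N2 (primx t v) else 0).
Let A0 v : 0 <= A v.
Proof. by apply: integral_ge0 => t _; case: ifP => // _; exact: N2_ge0. Qed.

Let M : R := 4800.
Let M0 : (0 <= M)%R. Proof. exact: ler0n. Qed.

Let sumEQ N v : measurable_fun setT v -> \sum_(0 <= i < N) EQ (a i) (b i) r v <= M%:E * N2 v.
Proof. exact: sum_EQ_le. Qed.

Let sumAQ N v : measurable_fun setT v -> \sum_(0 <= i < N) AQ (a i) (b i) r v <= M%:E * A v.
Proof.
move=> mv; have mE i := @measurable_EQ_primx R (a i) (b i) r v mv.
have mN := measurable_N2_primx mv.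
rewrite /AQ -ge0_integral_sum//; last first.
- by move=> i t _; case: ifP => // _; exact: EQ_ge0.
- by move=> i; have := mE i => ?; mea.
rewrite /A -ge0_integralZl//; last first.
- by move=> t _; case: ifP => // _; exact: N2_ge0.
- by mea.
apply: ge0_le_integral => //.
- by move=> t _; apply: sume_ge0 => i _; case: ifP => // _; exact: EQ_ge0.
- by apply: emeasurable_sum => i; have := mE i => ?; mea.
- by apply: emeasurable_funM => //; mea.
move=> t _; case: ifPn => [t0|_]; last first.
  by rewrite mule0 big1.
by apply: sumEQ; exact: measurable_primxt.
Qed.

Let C1 : R := (cL r K * M)%R.
Let C10 : (0 <= C1)%R. Proof. by rewrite mulr_ge0// cL_ge0. Qed.

Let int_mule_ge0 (F : R * R -> R) : (forall k, 0 <= F k)%R -> 0 <= \int[leb2]_k (F k * S k)%:E.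
Proof. by move=> F0; apply: int_ge0 => k; rewrite mulr_ge0. Qed.

Let S0 : \bar R := \int[leb2]_k (S k)%:E.
Let S1 : \bar R := \int[leb2]_k (`|k.1| * S k)%:E.
Let S2 : \bar R := \int[leb2]_k (k.2 ^+ 2 / `|k.1| * S k)%:E.
Let S3 : \bar R := \int[leb2]_k (k.2 ^+ 2 / k.1 ^+ 2 * S k)%:E.
Let S00 : 0 <= S0. Proof. exact: int_ge0. Qed.
Let S10 : 0 <= S1. Proof. exact: int_mule_ge0. Qed.
Let S20 : 0 <= S2. Proof. by apply: int_mule_ge0 => k; rewrite mulr_ge0 ?sqr_ge0 ?invr_ge0. Qed.
Let S30 : 0 <= S3. Proof. by apply: int_mule_ge0 => k; rewrite mulr_ge0 ?sqr_ge0 ?invr_ge0 ?sqr_ge0. Qed.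

Let pi0 : (0 <= pi :> R)%R. Proof. exact: pi_ge0. Qed.

(** The constants, apart from [cP], in the bounds of [u] by its weights: [q1] for the integrated
    primitives, [q2] and [q3] for the integrals against dt / t^2, [q4] and [q5] for the primitives
    of y-differences against the two singular weights. The single majorant [kk] then passes through
    all sums. *)
Let q1 : R := (2 * L ^+ 3)%R.
Let q2 : R := (2 * r)%R.
Let q3 : R := (5 * pi)%R.
Let q4 : R := (L ^+ 2 * (5 * pi))%R.
Let q5 : R := (4 * L)%R.
Let q10 : (0 <= q1)%R. Proof. by rewrite mulr_ge0// exprn_ge0// ltW. Qed.
Let q20 : (0 <= q2)%R. Proof. by rewrite mulr_ge0// ltW. Qed.
Let q30 : (0 <= q3)%R. Proof. by rewrite mulr_ge0. Qed.
Let q40 : (0 <= q4)%R. Proof. by rewrite mulr_ge0// sqr_ge0. Qed.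
Let q50 : (0 <= q5)%R. Proof. by rewrite mulr_ge0// ltW. Qed.
Let kk : R := (cP R * (1 + q1 + q2 + q3 + q4 + q5))%R.
Let kk0 : (0 <= kk)%R. Proof. by rewrite mulr_ge0 ?cP_ge0// !addr_ge0. Qed.
Let kle (q : R) : (q <= 1 + q1 + q2 + q3 + q4 + q5)%R -> (cP R * q <= kk)%R.
Proof. by move=> h; rewrite ler_wpM2l// cP_ge0. Qed.

Let pull (q : R) (F : R * R -> R) : (0 <= q)%R -> (forall k, 0 <= F k)%R -> measurable_fun setT F ->
  (cP R)%:E * \int[leb2]_k (q * F k)%:E = (cP R * q)%:E * \int[leb2]_k (F k)%:E.
Proof. by move=> q0 F0 mF; rewrite intZ// muleA EFinM. Qed.

Let bound (x : \bar R) (q : R) (F : R * R -> R) (S' : \bar R) : (0 <= q)%R ->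
  (q <= 1 + q1 + q2 + q3 + q4 + q5)%R ->
  (forall k, 0 <= F k)%R -> measurable_fun setT F -> \int[leb2]_k (F k)%:E <= S' ->
  x <= (cP R)%:E * \int[leb2]_k (q * F k)%:E -> x <= kk%:E * S'.
Proof.
move=> q0 qk F0 mF FS; rewrite pull// => h.
by apply: (le_scale h) => //; [rewrite mulr_ge0 ?cP_ge0|exact: kle|exact: int_ge0].
Qed.

Let m1 : measurable_fun setT (fun k => `|k.1| * S k)%R. Proof. by mea. Qed.

(** The bounds [b1] to [b7] cover every global quantity left by the summed local estimates. The free
    majorant [S'] allows sums such as S0 + S2 to be inserted at once. *)
Let b1 S' : S0 <= S' -> N2 u <= kk%:E * S'.
Proof.
move=> h; apply: (@bound _ 1 S) => //; first by rewrite -!addrA lerDl !addr_ge0.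
by have := N2_le uL2 uF; under [X in _ -> _ <= _ * X]eq_integral do rewrite mul1r.
Qed.

Let b2 S' : S0 <= S' -> A u <= kk%:E * S'.
Proof.
move=> h; apply: (@bound _ q1 S) => //; first by have := q20; have := q30; have := q40; have := q50; lra.
have := int_N2_primx_le uL2 uF L0; rewrite /A.
by under [X in X <= _ -> _]eq_integral do rewrite mul1e.
Qed.

Let b3 S' : S1 <= S' ->
  \int[mu]_t (if (0 < t <= r)%R then ((t ^+ 2)^-1)%:E * N2 (fdiff (t, 0%R) u) else 0) <= kk%:E * S'.
Proof.
move=> h; apply: (@bound _ q3 (fun k => `|k.1| * S k)%R) => //.
- by have := q10; have := q20; have := q40; have := q50; lra.
- by move=> k; rewrite mulr_ge0.
have := int_N2_diff_quot_le uL2 uF r0.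
by under [X in _ <= _ * X -> _]eq_integral do rewrite -mulrA.
Qed.

Let b4 S' : S0 <= S' ->
  \int[mu]_t (if (0 < t <= r)%R then ((t ^+ 2)^-1)%:E * N2 (primx t u) else 0) <= kk%:E * S'.
Proof.
move=> h; apply: (@bound _ q2 S) => //; first by have := q10; have := q30; have := q40; have := q50; lra.
exact: int_N2_primx_quot_le.
Qed.

Let h2_le (x : \bar R) (h : R) (W F : R * R -> R) (q : R) (S' : \bar R) : (0 <= q)%R ->
  (q <= 1 + q1 + q2 + q3 + q4 + q5)%R ->
  (forall k, 0 <= F k)%R -> measurable_fun setT F -> \int[leb2]_k (F k)%:E <= S' ->
  (forall k, W k * (h ^+ 2 * k.2 ^+ 2) * S k = h ^+ 2 * (q * F k))%R ->
  x <= (cP R)%:E * \int[leb2]_k (W k * (h ^+ 2 * k.2 ^+ 2) * S k)%:E ->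
  x <= (h ^+ 2 * kk)%:E * S'.
Proof.
move=> q0 qk F0 mF FS WF; under eq_integral do rewrite WF.
rewrite intZ ?sqr_ge0//; [|by mea|by move=> k; rewrite mulr_ge0].
rewrite muleCA => h'; apply: (le_trans h'); apply: leM_scale; first exact: sqr_ge0.
exact: (bound q0 qk F0 mF FS).
Qed.

Let F2 k : R := (k.2 ^+ 2 / `|k.1| * S k)%R.
Let F20 k : (0 <= F2 k)%R. Proof. by rewrite /F2 mulr_ge0// mulr_ge0 ?sqr_ge0 ?invr_ge0. Qed.
Let mF2 : measurable_fun setT F2. Proof. by rewrite /F2; mea. Qed.
Let F3 k : R := (k.2 ^+ 2 / k.1 ^+ 2 * S k)%R.
Let F30 k : (0 <= F3 k)%R. Proof. by rewrite /F3 mulr_ge0// mulr_ge0 ?sqr_ge0 ?invr_ge0 ?sqr_ge0. Qed.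
Let mF3 : measurable_fun setT F3. Proof. by rewrite /F3; mea. Qed.

Let b5 h S' : S2 <= S' ->
  \int[mu]_t (if (0 < t <= r)%R then ((t ^+ 2)^-1)%:E * N2 (primx t (fdiff (0%R, h) u)) else 0) <=
  (h ^+ 2 * kk)%:E * S'.
Proof.
move=> hS; apply: (@h2_le _ h (fun k => 5 * pi / `|k.1|)%R F2 q3) => //.
- by have := q10; have := q20; have := q40; have := q50; lra.
- by move=> k; rewrite /F2 /q3; ring.
apply: (int_N2_primx_diff_le uL2 uF) => //.
- by mea.
- by move=> t; rewrite invr_ge0 sqr_ge0.
- by mea.
- by move=> k; apply: mulr_ge0 => //; rewrite invr_ge0.
- by move=> k; exact: int_primx_symbol_le.
Qed.

Let Aw v : A v = \int[mu]_t (if (0 < t <= L)%R then 1%:E * N2 (primx t v) else 0).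
Proof. by apply: eq_integral => t _; rewrite mul1e. Qed.

Let mps := @measurable_primx_symbol R.

Let b6 h S' : S2 <= S' -> A (fdiff (0%R, h) u) <= (h ^+ 2 * kk)%:E * S'.
Proof.
move=> hS; apply: (@h2_le _ h (fun k => L ^+ 2 * (5 * pi / `|k.1|))%R F2 q4) => //.
- by have := q10; have := q20; have := q30; have := q50; lra.
- by move=> k; rewrite /F2 /q4; ring.
rewrite Aw; apply: (int_N2_primx_diff_le uL2 uF (w := cst 1%R)) => //.
- by mea.
- by move=> k; apply: mulr_ge0; [exact: sqr_ge0|apply: mulr_ge0 => //; rewrite invr_ge0].
(* On (0, L] one has 1 <= L^2 / t^2, which reduces this to the integral against dt / t^2. *)
move=> k k0; apply: (@le_trans _ _ ((L ^+ 2)%:E * \int[mu]_t (if (0 < t <= L)%R then (t ^+ 2)^-1 * primx_symbol t k else 0)%:E)); last first.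
  rewrite [leRHS]EFinM; apply: lee_wpmul2l; first by rewrite lee_fin sqr_ge0.
  exact: int_primx_symbol_le.
rewrite -intZ; [|by mea|by move=> t; case: ifP => // _; rewrite mulr_ge0 ?invr_ge0 ?sqr_ge0 ?primx_symbol_ge0|exact: sqr_ge0].
apply: le_int; [by mea|by mea|by move=> t; case: ifP => // _; rewrite mulr_ge0 ?primx_symbol_ge0|].
move=> t; case: ifPn => [/andP[t0 tL]|_]; last by rewrite mulr0.
rewrite mulrA ler_wpM2r ?primx_symbol_ge0// ler_pdivlMr ?exprn_gt0// mul1r.
by rewrite lerXn2r// nnegrE ltW.
Qed.

(** Against the weight eta^2 / xi^2 the symbol of the primitive may be bounded by 4 / xi^2 for each
    t separately. *)
Let b7 h S' : S3 <= S' -> A (fdiff (0%R, h) u) <= (h ^+ 2 * kk)%:E * S'.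
Proof.
move=> hS; apply: (@h2_le _ h (fun k => 4 * L / k.1 ^+ 2)%R F3 q5) => //.
- by have := q10; have := q20; have := q30; have := q40; lra.
- by move=> k; rewrite /F3 /q5; ring.
rewrite Aw; apply: (int_N2_primx_diff_le uL2 uF (w := cst 1%R)) => //.
- by mea.
- by move=> k; apply: mulr_ge0 => //; rewrite invr_ge0 sqr_ge0.
move=> k k0; have k2 : (0 < k.1 ^+ 2)%R by rewrite exprn_even_gt0.
apply: (@le_trans _ _ (\int[mu]_t (if (0 <= t <= L)%R then 4 / k.1 ^+ 2 else 0)%:E)).
  apply: le_int; [by mea|by mea|by move=> t; case: ifP => // _; rewrite mulr_ge0 ?primx_symbol_ge0|].
  move=> t; case: ifPn => [/andP[t0 tL]|_]; last by case: ifP => // _; rewrite divr_ge0 ?sqr_ge0.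
  rewrite (ltW t0) tL /= mul1r primx_symbolE// ler_wpM2r ?invr_ge0 ?(ltW k2)//.
  exact: diff_symbol_le4.
by rewrite (int_if_cst _ (ltW L0)) lee_fin subr0 mulrAC.
Qed.

Let EQ0 v i : 0 <= EQ (a i) (b i) r v. Proof. exact: EQ_ge0. Qed.
Let AQ0 v i : 0 <= AQ (a i) (b i) r v. Proof. exact: AQ_ge0. Qed.
Let z0 (i : nat) : 0 <= (0 : \bar R). Proof. exact: lexx. Qed.
Let z1 N : \sum_(0 <= i < N) (0 : \bar R) <= M%:E * 0. Proof. by rewrite mule0 big1. Qed.

Let sumg0 N S' : S0 <= S' -> \sum_(0 <= i < N) N2 (g i) <= (C1 * (2 * kk))%:E * S'.
Proof.
move=> h; apply: (@le_trans _ _ (C1%:E * (1%:E * N2 u + 1%:E * A u + 0%:E * 0 + 0%:E * 0))).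
  have X i : N2 (g i) <= (cL r K)%:E * (1%:E * EQ (a i) (b i) r u + 1%:E * AQ (a i) (b i) r u + 0%:E * 0 + 0%:E * 0).
    by rewrite !mul1e !mul0e !adde0; exact: (N2_loc_le r0 (cc i) (ct i)).
  exact: (sum_lin4 (cL_ge0 r0 K0) M0 ler01 ler01 (lexx _) (lexx _) (EQ0 u) (AQ0 u) z0 z0
    (N2_ge0 u) (A0 u) (lexx _) (lexx _) (sumEQ N mu_) (sumAQ N mu_) (z1 N) (z1 N) X).
rewrite !mul1e !mul0e !adde0; apply: leM_scale => //.
by rewrite mulr_natl mulr2n; apply: leD_scale => //; [exact: b1|exact: b2].
Qed.

Definition loc_cst : R := (2 * (cQ R * (C1 * kk * (2 / r + 4 + 4 * r))))%R.

Let rpos : (2 <= 2 / r + 4 + 4 * r)%R.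
Proof. by have : (0 <= 2 / r)%R by [rewrite divr_ge0// ltW|]; have := r0; lra. Qed.

Let Ck0 : (0 <= C1 * kk)%R. Proof. exact: mulr_ge0. Qed.

Let D0 : (0 <= C1 * kk * (2 / r + 4 + 4 * r))%R.
Proof. by apply: mulr_ge0; [exact: Ck0|have := rpos; lra]. Qed.

Lemma loc_cst_ge0 : (0 <= loc_cst)%R.
Proof. by rewrite /loc_cst; apply: mulr_ge0 => //; apply: mulr_ge0 => //; exact: cQ_ge0. Qed.

Let le1 N (X : nat -> \bar R) (e : R) (S' : \bar R) : (0 <= e)%R -> 0 <= S' ->
  (e <= 2 * (C1 * kk * (2 / r + 4 + 4 * r)))%R ->
  \sum_(0 <= i < N) X i <= (cQ R * e)%:E * S' -> \sum_(0 <= i < N) X i <= loc_cst%:E * S'.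
Proof.
move=> e0 S'0 ee h; apply: (le_scale h) => //; first by apply: mulr_ge0 => //; exact: cQ_ge0.
by rewrite /loc_cst mulrCA ler_wpM2l ?cQ_ge0.
Qed.

Lemma sum_ft2_le N : \sum_(0 <= i < N) \int[leb2]_k (ft2 (g i) k)%:E <= loc_cst%:E * S0.
Proof.
apply: (@le1 N _ (C1 * (2 * kk))%R) => //; first by apply: mulr_ge0 => //; exact: mulr_ge0.
  by rewrite mulrCA ler_wpM2l// -[leLHS]mulr1 ler_wpM2l//; have := rpos; lra.
apply: (@le_trans _ _ (\sum_(0 <= i < N) (cQ R)%:E * N2 (g i))).
  by apply: lee_sum => i _; exact: plancherel_le.
rewrite -ge0_sume_distrr; last by move=> i _; exact: N2_ge0.
by apply: leM_scale; [exact: cQ_ge0|exact: sumg0].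
Qed.

(** The upper Plancherel bound reduces the weight |xi| to [Hs]. The undifferenced terms cost S0, and
    only the x-differences of [u] itself cost S1. *)
Lemma sum_abs_ft2_le N :
  \sum_(0 <= i < N) \int[leb2]_k (`|k.1| * ft2 (g i) k)%:E <= loc_cst%:E * (S0 + S1).
Proof.
have SS : 0 <= S0 + S1 by exact: adde_ge0.
have le0 : S0 <= S0 + S1 by rewrite leeDl.
have le1' : S1 <= S0 + S1 by rewrite leeDr.
apply: (@le1 N _ (C1 * kk * (2 / r + 4 + 4 * r))%R) => //.
  by rewrite -[leLHS]mul1r ler_wpM2r ?ler1n.
apply: (@le_trans _ _ (\sum_(0 <= i < N) (cQ R)%:E * Hs r (g i))).
  by apply: lee_sum => i _; exact: int_abs_ft2_le.
have H0 i : 0 <= Hs r (g i).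
  rewrite /Hs adde_ge0// mule_ge0 ?N2_ge0 ?lee_fin ?invr_ge0 ?(ltW r0)//.
  by apply: integral_ge0 => t _; case: ifP => // _; rewrite mule_ge0 ?N2_ge0// lee_fin invr_ge0 sqr_ge0.
rewrite -ge0_sume_distrr//; apply: leM_scale; first exact: cQ_ge0.
apply: (@sum_Hs_le R r r0 N g C1 kk (fun t => N2 (fdiff (t, 0%R) u)) (fun t => N2 (primx t u)) (N2 u) (A u)) => //.
- exact: measurable_N2_diff.
- exact: measurable_N2_primx.
- by move=> t; exact: N2_ge0.
- by move=> t; exact: N2_ge0.
- exact: N2_ge0.
- move=> t tr; rewrite -{1}[N2 (fdiff _ u)]mul1e -{1}[N2 (primx t u)]mul1e.
  have X i : N2 (fdiff (t, 0%R) (g i)) <= (cL r K)%:E * (1%:E * EQ (a i) (b i) r (fdiff (t, 0%R) u) +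
      (t ^+ 2)%:E * EQ (a i) (b i) r u + 1%:E * EQ (a i) (b i) r (primx t u) + (t ^+ 2)%:E * AQ (a i) (b i) r u).
    by rewrite !mul1e; exact: (N2_fdiff_loc_le r0 (cc i) (ct i)).
  exact: (sum_lin4 (cL_ge0 r0 K0) M0 ler01 (sqr_ge0 t) ler01 (sqr_ge0 t) (EQ0 _) (EQ0 _) (EQ0 _) (AQ0 _)
    (N2_ge0 _) (N2_ge0 _) (N2_ge0 _) (A0 _) (sumEQ N (measurable_diff (t, 0%R) mu_)) (sumEQ N mu_)
    (sumEQ N (measurable_primxt t mu_)) (sumAQ N mu_) X).
- exact: sumg0.
- exact: b3.
- exact: b1.
- exact: b4.
- exact: b2.
Qed.

Let sumG N h S' : (0 < h <= r)%R -> S0 <= S' -> 0 <= S' ->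
  A (fdiff (0%R, h) u) <= (h ^+ 2 * kk)%:E * S' ->
  \sum_(0 <= i < N) N2 (fdiff (0%R, h) (G i)) <= (C1 * (2 * (h ^+ 2 * kk)))%:E * S'.
Proof.
move=> hr hS S'0 hA.
apply: (@le_trans _ _ (C1%:E * (1%:E * A (fdiff (0%R, h) u) + (h ^+ 2)%:E * A u + 0%:E * 0 + 0%:E * 0))).
  have X i : N2 (fdiff (0%R, h) (G i)) <= (cL r K)%:E * (1%:E * AQ (a i) (b i) r (fdiff (0%R, h) u) +
      (h ^+ 2)%:E * AQ (a i) (b i) r u + 0%:E * 0 + 0%:E * 0).
    by rewrite !mul1e !mul0e !adde0; exact: (N2_fdiff_loc_pot_le r0 (cc i) (ct i)).
  exact: (sum_lin4 (cL_ge0 r0 K0) M0 ler01 (sqr_ge0 h) (lexx _) (lexx _) (AQ0 _) (AQ0 _) z0 z0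
    (A0 _) (A0 _) (lexx _) (lexx _) (sumAQ N (measurable_diff (0%R, h) mu_)) (sumAQ N mu_) (z1 N) (z1 N) X).
rewrite !mul1e !mul0e !adde0; apply: leM_scale => //.
have hk : (0 <= h ^+ 2 * kk)%R by rewrite mulr_ge0// sqr_ge0.
rewrite mulr_natl mulr2n; apply: leD_scale => //; apply: leM_scale; first exact: sqr_ge0.
exact: b2.
Qed.

(** All four quantities supplied to [sum_Hs_le] are of order h^2: those built on the y-difference of
    [u] through S2, those with a differenced cut-off through S0. *)
Let sumHsG N h S' : (0 < h <= r)%R -> S0 <= S' -> S2 <= S' -> 0 <= S' ->
  \sum_(0 <= i < N) Hs r (fdiff (0%R, h) (G i)) <= (C1 * (h ^+ 2 * kk) * (2 / r + 4 + 4 * r))%:E * S'.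
Proof.
move=> hr hS hS2 S'0; have mdu := measurable_diff (0%R, h) mu_.
have hk : (0 <= h ^+ 2 * kk)%R by rewrite mulr_ge0// sqr_ge0.
apply: (@sum_Hs_le R r r0 N (fun i => fdiff (0%R, h) (G i)) C1 (h ^+ 2 * kk)%R
  (fun t => N2 (primx t (fdiff (0%R, h) u))) (fun t => (h ^+ 2)%:E * N2 (primx t u))
  (A (fdiff (0%R, h) u)) ((h ^+ 2)%:E * A u)) => //.
- by move=> i; exact: measurable_diff.
- exact: measurable_N2_primx.
- by apply: emeasurable_funM => //; exact: measurable_N2_primx.
- by move=> t; exact: N2_ge0.
- by move=> t; rewrite mule_ge0 ?N2_ge0// lee_fin sqr_ge0.
- by rewrite mule_ge0// lee_fin sqr_ge0.
- move=> t tr; rewrite -{1}[N2 (primx t (fdiff _ u))]mul1e muleA -EFinM -exprMn.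
  have X i : N2 (fdiff (t, 0%R) (fdiff (0%R, h) (G i))) <= (cL r K)%:E *
      (1%:E * EQ (a i) (b i) r (primx t (fdiff (0%R, h) u)) + (t ^+ 2)%:E * AQ (a i) (b i) r (fdiff (0%R, h) u) +
      (h ^+ 2)%:E * EQ (a i) (b i) r (primx t u) + ((t * h) ^+ 2)%:E * AQ (a i) (b i) r u).
    by rewrite !mul1e; exact: (N2_fdiff2_loc_pot_le r0 (cc i) (ct i)).
  exact: (sum_lin4 (cL_ge0 r0 K0) M0 ler01 (sqr_ge0 t) (sqr_ge0 h) (sqr_ge0 (t * h)%R)
    (EQ0 _) (AQ0 _) (EQ0 _) (AQ0 _) (N2_ge0 _) (A0 _) (N2_ge0 _) (A0 _)
    (sumEQ N (measurable_primxt t mdu)) (sumAQ N mdu) (sumEQ N (measurable_primxt t mu_)) (sumAQ N mu_) X).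
- by apply: sumG => //; exact: b6.
- exact: b5.
- exact: b6.
- apply: (@le_trans _ _ ((h ^+ 2)%:E * \int[mu]_t (if (0 < t <= r)%R then ((t ^+ 2)^-1)%:E * N2 (primx t u) else 0))).
    have mN := measurable_N2_primx mu_.
    rewrite -ge0_integralZl// ?lee_fin ?sqr_ge0//; [|by mea|by move=> t _; case: ifP => // _; rewrite mule_ge0 ?N2_ge0// lee_fin invr_ge0 sqr_ge0].
    rewrite le_eqVlt; apply/orP; left; apply/eqP; apply: eq_integral => t _.
    by case: ifP => _; rewrite ?mule0// muleCA.
  by apply: leM_scale; [exact: sqr_ge0|exact: b4].
- by apply: leM_scale; [exact: sqr_ge0|exact: b2].
Qed.

(** The step [h] is chosen after the frequency box, with h n <= 1, so the bound [B] must not depend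
    on [h]. The finite sum over squares is moved inside the integral before the exhaustion, hence
    [B] bounds the whole sum. *)
Let exhaust N (w : R * R -> R) (B : \bar R) : measurable_fun setT w -> (forall k, 0 <= w k)%R ->
  (forall (n : nat) (h : R), (0 < h <= r)%R -> (h * n%:R <= 1)%R ->
    \sum_(0 <= i < N) \int[leb2]_k (if inbox n%:R k then w k * ft2 (g i) k else 0)%:E <= B) ->
  \sum_(0 <= i < N) \int[leb2]_k (w k * ft2 (g i) k)%:E <= B.
Proof.
move=> mw w0 HB; have m2 i := measurable_ft2 (mg i).
have f0 i k : (0 <= w k * ft2 (g i) k)%R by rewrite mulr_ge0 ?ft2_ge0.
have mf i : measurable_fun setT (fun k => w k * ft2 (g i) k)%R by have := m2 i => ?; mea.
rewrite -(int_sum N mf f0); apply: int_le_exhaust.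
- exact: measurable_sum.
- by move=> k; exact: sumr_ge0.
move=> n; pose h : R := Num.min r (n.+1%:R)^-1%R.
have h0 : (0 < h <= r)%R by rewrite lt_min r0 invr_gt0 ltr0n/= ge_min lexx.
have hn : (h * n%:R <= 1)%R.
  apply: (@le_trans _ _ ((n.+1%:R)^-1 * n%:R)%R); first by rewrite ler_wpM2r// ge_min lexx orbT.
  by rewrite ler_pdivrMl ?ltr0n// mulr1 ler_nat.
apply: le_trans (HB n h h0 hn); have mb := measurable_inbox (n%:R : R).
rewrite -int_sum.
- rewrite le_eqVlt; apply/orP; left; apply/eqP; apply: eq_integral => k _; congr EFin.
  by case: ifP => //; rewrite big1.
- by move=> i; have := m2 i => ?; mea.
- by move=> i k; case: ifP.
Qed.

(** The h^2 gained in physical space against the h^-2 spent in frequency space. *)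
Let cancel_h (h e : R) : (0 < h)%R -> (2 * h ^- 2 * cQ R * (C1 * (h ^+ 2 * kk) * e) = cQ R * (2 * (C1 * kk * e)))%R.
Proof. by move=> h0; field; rewrite gt_eqF. Qed.

Lemma sum_eta2_abs_ft2_le N :
  \sum_(0 <= i < N) \int[leb2]_k (k.2 ^+ 2 / `|k.1| * ft2 (g i) k)%:E <= loc_cst%:E * (S0 + S2).
Proof.
have SS : 0 <= S0 + S2 by exact: adde_ge0.
have le0 : S0 <= S0 + S2 by rewrite leeDl.
have le1' : S2 <= S0 + S2 by rewrite leeDr.
apply: exhaust; [by mea|by move=> k; rewrite mulr_ge0 ?sqr_ge0 ?invr_ge0|] => n h hr hn.
have /andP[h0 _] := hr; have h20 : (0 <= 2 * h ^- 2 * cQ R)%R.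
  by rewrite !mulr_ge0 ?invr_ge0 ?sqr_ge0 ?cQ_ge0.
apply: (@le1 N _ (2 * (C1 * kk * (2 / r + 4 + 4 * r)))%R) => //; first by apply: mulr_ge0.
rewrite -(cancel_h _ h0).
apply: (@le_trans _ _ (\sum_(0 <= i < N) (2 * h ^- 2 * cQ R)%:E * Hs r (fdiff (0%R, h) (G i)))).
  by apply: lee_sum => i _; exact: (int_eta2_abs_le (cG i) (cg i) h0 hn r0 (gG i)).
rewrite -ge0_sume_distrr; last first.
  move=> i _; rewrite /Hs adde_ge0// mule_ge0 ?N2_ge0 ?lee_fin ?invr_ge0 ?(ltW r0)//.
  by apply: integral_ge0 => t _; case: ifP => // _; rewrite mule_ge0 ?N2_ge0// lee_fin invr_ge0 sqr_ge0.
by apply: leM_scale => //; exact: sumHsG.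
Qed.

Lemma sum_eta2_sqr_ft2_le N :
  \sum_(0 <= i < N) \int[leb2]_k (k.2 ^+ 2 / k.1 ^+ 2 * ft2 (g i) k)%:E <= loc_cst%:E * (S0 + S3).
Proof.
have SS : 0 <= S0 + S3 by exact: adde_ge0.
have le0 : S0 <= S0 + S3 by rewrite leeDl.
have le1' : S3 <= S0 + S3 by rewrite leeDr.
apply: exhaust; [by mea|by move=> k; rewrite mulr_ge0 ?sqr_ge0 ?invr_ge0 ?sqr_ge0|] => n h hr hn.
have /andP[h0 _] := hr; have h20 : (0 <= 2 * h ^- 2 * cQ R)%R.
  by rewrite !mulr_ge0 ?invr_ge0 ?sqr_ge0 ?cQ_ge0.
apply: (@le1 N _ (2 * (C1 * kk * 2))%R) => //; first by apply: mulr_ge0 => //; apply: mulr_ge0.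
  by rewrite ler_wpM2l// ler_wpM2l.
rewrite -(cancel_h _ h0).
apply: (@le_trans _ _ (\sum_(0 <= i < N) (2 * h ^- 2 * cQ R)%:E * N2 (fdiff (0%R, h) (G i)))).
  by apply: lee_sum => i _; exact: (int_eta2_sqr_le (cG i) (cg i) h0 hn (gG i)).
rewrite -ge0_sume_distrr; last by move=> i _; exact: N2_ge0.
apply: leM_scale => //; rewrite -mulrA [(_ * 2)%R]mulrC.
by apply: sumG => //; exact: b7.
Qed.

End square_sum.

(** * Null sets and good slices *)

Lemma ae_leb2_filter (R : realType) : Filter (nbhs (almost_everywhere (@leb2 R))).
Proof. exact: (ae_filter_ringOfSetsType (@leb2 R)). Qed.

Section almost_everywhere.
Variable R : realType.
Local Notation mu := (@lebesgue_measure R).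
Local Notation leb2 := (@leb2 R).
Implicit Types (f g u : R * R -> R) (p k : R * R).
Local Open Scope ereal_scope.

Local Existing Instance ae_leb2_filter.

Lemma FT_ae (h f g : R * R -> R) : measurable_fun setT f -> measurable_fun setT g ->
  measurable_fun setT h -> {ae leb2, forall p, f p = g p} ->
  (\int[leb2]_p (f p * h p) = \int[leb2]_p (g p * h p))%R.
Proof.
move=> mf mg mh fg; rewrite /Rintegral; congr fine; apply: ae_eq_integral => //; [by mea|by mea|].
by apply: filterS fg => p -> _.
Qed.

(** Truncations of functions that agree almost everywhere have identical Fourier integrals, so the
    approximating sequences coincide. *)
Lemma is_FT_ae f g Fr Fi : measurable_fun setT f -> measurable_fun setT g ->
  {ae leb2, forall p, f p = g p} -> is_FT f Fr Fi -> is_FT g Fr Fi.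
Proof.
move=> mf mg fg [mr mi cv]; split; [exact: mr|exact: mi|].
have E n : {ae leb2, forall p, trunc f n p = trunc g n p}.
  by apply: filterS fg => p fgp; rewrite /trunc fgp.
have mtf n := measurable_trunc n mf; have mtg n := measurable_trunc n mg.
have Er n k : FTre (trunc g n) k = FTre (trunc f n) k.
  by apply/esym/FT_ae => //; mea.
have Ei n k : FTim (trunc g n) k = FTim (trunc f n) k.
  by rewrite /FTim; congr (- _)%R; apply/esym/FT_ae => //; mea.
rewrite (_ : (fun n : nat => _) = (fun n : nat => \int[leb2]_k
  ((Fr k - FTre (trunc f n) k) ^+ 2 + (Fi k - FTim (trunc f n) k) ^+ 2)%:E)); first exact: cv.
by apply/funext => n; apply: eq_integral => k _; rewrite Er Ei.
Qed.

Lemma N2_ae f g : measurable_fun setT f -> measurable_fun setT g ->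
  {ae leb2, forall p, f p = g p} -> N2 f = N2 g.
Proof.
move=> mf mg fg; apply: ae_eq_integral => //; [by mea|by mea|].
by apply: filterS fg => p -> _.
Qed.

(** The truncations equal [f] from some index on, and the sequence of errors is eventually 0. *)
Lemma is_FT_cl2 f : cl2 f -> is_FT f (FTre f) (FTim f).
Proof.
move=> [mf _ [n fn]]; split; [exact: measurable_FTre|exact: measurable_FTim|].
apply: cvg_near_cst; exists (Num.truncn n).+1 => // N /= nN.
have nN' : (n <= N%:R)%R by rewrite (le_trans (ltW (truncnS_gt n)))// ler_nat.
have -> : trunc f N = f.
  apply/funext => p; rewrite /trunc; have [fp|/fn /andP[p1 p2]] := eqVneq (f p) 0%R.
    by rewrite fp; case: ifP.
  by rewrite (le_trans p1 nN') (le_trans p2 nN').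
by rewrite integral0_eq// => k _; rewrite !subrr expr0n/= addr0.
Qed.

(** Convergence places the transform at finite L^2 distance from that of some truncation, to which
    the upper Plancherel bound applies. *)
Lemma int_FTsq_fin u Fr Fi : L2 u -> is_FT u Fr Fi -> \int[leb2]_k (FTsq Fr Fi k)%:E < +oo.
Proof.
move=> uL [mr mi cv]; have /fine_cvgP[[n _ Hn] _] := cv.
have ct := cl2_trunc n uL; have [mt too _] := ct.
have mc := measurable_FTre mt; have ms := measurable_FTim mt.
pose D k : R := ((Fr k - FTre (trunc u n) k) ^+ 2 + (Fi k - FTim (trunc u n) k) ^+ 2)%R.
have mD : measurable_fun setT D by rewrite /D; mea.
have D0 k : (0 <= D k)%R by rewrite addr_ge0 ?sqr_ge0.
have m2 := measurable_ft2 mt.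
apply: (@le_lt_trans _ _ (\int[leb2]_k (2 * D k + 2 * ft2 (trunc u n) k)%:E)).
  apply: le_int; [by rewrite /FTsq; mea|by mea|by move=> k; exact: FTsq_ge0|] => k.
  have h (x y : R) : (x ^+ 2 <= 2 * (x - y) ^+ 2 + 2 * y ^+ 2)%R.
    by have := sqr_ge0 (x - 2 * y)%R; nra.
  rewrite /ft2 /FTsq /D.
  by have := h (Fr k) (FTre (trunc u n) k); have := h (Fi k) (FTim (trunc u n) k); lra.
rewrite intD; [|by mea|by mea|by move=> k; rewrite mulr_ge0|by move=> k; rewrite mulr_ge0 ?ft2_ge0].
rewrite intZ// intZ//; last by move=> k; exact: ft2_ge0.
have Dfin : \int[leb2]_k (D k)%:E \is a fin_num by exact: (Hn n (leqnn n)).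
rewrite lte_add_pinfty//; first by rewrite lte_mul_pinfty// ltey_eq Dfin.
rewrite lte_mul_pinfty//.
apply: (le_lt_trans (plancherel_le ct)).
by rewrite lte_mul_pinfty// lee_fin; exact: cQ_ge0.
Qed.

Definition slice_ok u y : bool := \int[mu]_s (u (s, y) ^+ 2)%:E < +oo.

(* Changing [u] on a null set makes every horizontal slice square integrable, so
   that primitives along all of them make sense. *)
Definition good_slices u p : R := if slice_ok u p.2 then u p else 0%R.

Variable u : R * R -> R.
Hypothesis uL2 : L2 u.

Let mu_ : measurable_fun setT u. Proof. by case: uL2. Qed.

Let mi : measurable_fun setT (fun y => \int[mu]_s (u (s, y) ^+ 2)%:E).
Proof. by apply: (measurable_param_mu (F := fun y s => (u (s, y) ^+ 2)%:E)); mea. Qed.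

Lemma measurable_slice_ok : measurable_fun setT (slice_ok u).
Proof. by apply: measurable_fun_lte => //; exact: measurable_cst. Qed.

(** By Tonelli almost every slice integral is finite; the exceptional set is a product of a line
    with a null set, hence null in the plane. *)
Lemma ae_slice_ok : {ae leb2, forall p, slice_ok u p.2}.
Proof.
have ok1 : {ae mu, forall y, slice_ok u y}.
  have i1 : mu.-integrable setT (fun y => \int[mu]_s (u (s, y) ^+ 2)%:E).
    apply/integrableP; split => //; have [_ uoo] := uL2.
    rewrite leb2_tonelli2 in uoo; [|by mea|by move=> p; rewrite lee_fin sqr_ge0].
    have -> : \int[mu]_y `|\int[mu]_s (u (s, y) ^+ 2)%:E| = \int[mu]_y \int[mu]_s (u (s, y) ^+ 2)%:E.
      by apply: eq_integral => y _; rewrite gee0_abs//; apply: int_ge0 => s; exact: sqr_ge0.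
    exact: uoo.
  apply: filterS (integrable_ae measurableT i1) => y /(_ I).
  by rewrite /slice_ok ge0_fin_numE//; apply: int_ge0 => s; exact: sqr_ge0.
have mok := measurable_slice_ok.
have mok2 : measurable_fun setT (fun p : R * R => slice_ok u p.2).
  exact: (measurableT_comp mok measurable_snd).
exists [set p | ~~ slice_ok u p.2]; split.
- rewrite (_ : [set p | _] = (fun p : R * R => slice_ok u p.2) @^-1` [set false]); last first.
    by apply/seteqP; split => p /=; case: slice_ok.
  by rewrite -[X in measurable X]setTI; exact: mok2.
- set A := [set p | _].
  have -> : leb2 A = \int[leb2]_p (if slice_ok u p.2 then 0 else 1)%:E.
    rewrite -[in LHS](setIT A) -integral_indic//; last first.
      rewrite (_ : A = (fun p : R * R => slice_ok u p.2) @^-1` [set false]); last first.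
        by apply/seteqP; split => p /=; rewrite /A /=; case: slice_ok.
      by rewrite -[X in measurable X]setTI; exact: mok2.
    apply: eq_integral => p _; rewrite indicE.
    case: ifPn => h; last by rewrite mem_set.
    by rewrite memNset// /A /= h.
  rewrite leb2_tonelli2; [|by mea|by move=> p; case: ifP].
  transitivity (\int[mu]_(y in setT) (cst 0 y : \bar R)); last by rewrite integral0.
  apply: ae_eq_integral => //.
  - by apply: (measurable_param_mu (F := fun y (x : R) => (if slice_ok u y then 0 else 1)%:E)); mea.
  - have [B [mB B0 sB]] := ok1; exists B; split => // y ny; apply: sB => oky.
    by apply: ny => _ /=; rewrite oky integral0.
- by move=> p /=; apply: contra_notN => ->.
Qed.

Lemma measurable_good_slices : measurable_fun setT (good_slices u).
Proof.
have mok2 : measurable_fun setT (fun p : R * R => slice_ok u p.2).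
  exact: (measurableT_comp measurable_slice_ok measurable_snd).
by rewrite /good_slices; mea.
Qed.

Lemma sliceL2_good : sliceL2 (good_slices u).
Proof.
move=> y; rewrite /good_slices /=; have [oky|nok] := boolP (slice_ok u y); first exact: oky.
by rewrite integral0_eq// => s _; rewrite expr0n.
Qed.

Lemma ae_good_slices : {ae leb2, forall p, u p = good_slices u p}.
Proof. by apply: filterS ae_slice_ok => p; rewrite /good_slices => ->. Qed.

Lemma L2_good : L2 (good_slices u).
Proof.
split; first exact: measurable_good_slices.
have [_] := uL2; rewrite -/(N2 u) -/(N2 (good_slices u)) => uoo.
by rewrite -(N2_ae mu_ measurable_good_slices ae_good_slices).
Qed.

End almost_everywhere.

(** * Weighted norms and the final estimate *)

Section weighted_norm.
Variable R : realType.
Local Notation leb2 := (@leb2 R).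
Local Open Scope ereal_scope.

(** The factors [1%:E] give the sum the four-term shape of [sum_lin4]. *)
Lemma int_Xweight (lam mu : R) (f : R * R -> R) : (0 <= lam)%R -> (0 <= mu)%R ->
  measurable_fun setT f -> (forall k, 0 <= f k)%R ->
  \int[leb2]_k (f k * Xweight lam mu k)%:E =
  1%:E * \int[leb2]_k (f k)%:E + 1%:E * \int[leb2]_k (`|k.1| * f k)%:E +
  lam%:E * \int[leb2]_k (k.2 ^+ 2 / `|k.1| * f k)%:E +
  mu%:E * \int[leb2]_k (k.2 ^+ 2 / k.1 ^+ 2 * f k)%:E.
Proof.
move=> l0 m0 mf f0; rewrite !mul1e.
pose F1 (k : R * R) : R := (`|k.1| * f k)%R; pose F2 (k : R * R) : R := (k.2 ^+ 2 / `|k.1| * f k)%R.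
pose F3 (k : R * R) : R := (k.2 ^+ 2 / k.1 ^+ 2 * f k)%R.
have F10 k : (0 <= F1 k)%R by rewrite mulr_ge0.
have F20 k : (0 <= F2 k)%R by rewrite mulr_ge0// divr_ge0 ?sqr_ge0.
have F30 k : (0 <= F3 k)%R by rewrite mulr_ge0// divr_ge0 ?sqr_ge0.
have m1 : measurable_fun setT F1 by rewrite /F1; mea.
have m2 : measurable_fun setT F2 by rewrite /F2; mea.
have m3 : measurable_fun setT F3 by rewrite /F3; mea.
have l2 k : (0 <= lam * F2 k)%R by rewrite mulr_ge0.
have l3 k : (0 <= mu * F3 k)%R by rewrite mulr_ge0.
transitivity (\int[leb2]_k (f k + F1 k + lam * F2 k + mu * F3 k)%:E).
  by apply: eq_integral => k _; rewrite /Xweight /F1 /F2 /F3; congr EFin; ring.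
rewrite intD; [|by mea|by mea|by move=> k; rewrite !addr_ge0|by []].
rewrite intD; [|by mea|by mea|by move=> k; rewrite !addr_ge0|by []].
rewrite intD; [|by mea|by mea|by []|by []].
by rewrite (intZ leb2 m2 F20 l0) (intZ leb2 m3 F30 m0).
Qed.

Lemma Xweight_ge0 (lam mu : R) k : (0 <= lam)%R -> (0 <= mu)%R -> (0 <= Xweight lam mu k)%R.
Proof.
by move=> l0 m0; rewrite /Xweight !addr_ge0// mulr_ge0// divr_ge0 ?sqr_ge0.
Qed.

Lemma Xnorm2_ge0 (lam mu : R) f : (0 <= lam)%R -> (0 <= mu)%R -> 0 <= Xnorm2 lam mu f.
Proof.
move=> l0 m0; apply: le_ereal_inf_tmp => _ [Fr [Fi [_ ->]]].
rewrite mule_ge0 ?lee_fin ?invr_ge0 ?sqr_ge0//; apply: int_ge0 => k.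
by rewrite mulr_ge0 ?FTsq_ge0 ?Xweight_ge0.
Qed.

End weighted_norm.

(** Each of I0, I1, l I2 and m I3 is at most their sum T. Counting the copies of T gives 1 + 1 + (l
    + 1) + (m + 1), where [l] and [m] come from the copies of I0 attached to the singular
    weights. *)
Lemma weighted_sum_le (R : realType) (l m c : R) (I0 I1 I2 I3 : \bar R) :
  0 <= l -> 0 <= m -> 0 <= c -> (0 <= I0 -> 0 <= I1 -> 0 <= I2 -> 0 <= I3 ->
  c%:E * (I0 + (I0 + I1) + l%:E * (I0 + I2) + m%:E * (I0 + I3)) <=
  (c * (4 + l + m) + 1)%:E * (I0 + I1 + l%:E * I2 + m%:E * I3))%E.
Proof.
move=> l0 m0 c0 T0 T1 T2 T3.
have J2 : (0 <= l%:E * I2)%E by exact: mule_ge0.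
have J3 : (0 <= m%:E * I3)%E by exact: mule_ge0.
have P01 := adde_ge0 T0 T1. have P012 := adde_ge0 P01 J2. have PT := adde_ge0 P012 J3.
set T := (I0 + I1 + l%:E * I2 + m%:E * I3)%E in PT *.
have q012 : (I0 + I1 + l%:E * I2 <= T)%E by exact: leeDl.
have q01 : (I0 + I1 <= T)%E by apply: le_trans q012; exact: leeDl.
have q0 : (I0 <= T)%E by apply: le_trans q01; exact: leeDl.
have q2 : (l%:E * I2 <= T)%E by apply: le_trans q012; exact: leeDr.
have q3 : (m%:E * I3 <= T)%E by exact: leeDr.
have one x : (x <= T -> x <= 1%:E * T)%E by rewrite mul1e.
have l1 : 0 <= l + 1 by exact: addr_ge0.
have m1 : 0 <= m + 1 by exact: addr_ge0.
have scl (f : R) : 0 <= f -> (f%:E * I0 <= f%:E * T)%E by move=> f0; apply: lee_wpmul2l.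
have H : (I0 + (I0 + I1) + l%:E * (I0 + I2) + m%:E * (I0 + I3) <=
    (1 + 1 + (l + 1) + (m + 1))%:E * T)%E.
  rewrite (ge0_muleDr _ T0 T2) (ge0_muleDr _ T0 T3).
  have n0 : 0 <= 1 + 1 :> R by exact: addr_ge0.
  apply: (leD_scale (addr_ge0 n0 l1) m1).
    apply: (leD_scale n0 l1); first by apply: leD_scale (one _ q0) (one _ q01).
    exact: (leD_scale l0 ler01 (scl _ l0) (one _ q2)).
  exact: (leD_scale m0 ler01 (scl _ m0) (one _ q3)).
have c0E : (0 <= c%:E)%E by rewrite lee_fin.
apply: (le_trans (lee_wpmul2l c0E H)); rewrite muleA -EFinM.
apply: lee_wpmul2r; first exact: PT.
rewrite lee_fin; have -> : c * (1 + 1 + (l + 1) + (m + 1)) = c * (4 + l + m) by ring.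
by rewrite lerDl.
Qed.

Theorem theorem2p11 (R : realType) (lam mu r : R) (Om : nat -> set (R * R))
  (hlam : 0 <= lam) (hmu : 0 <= mu) (hlm : ~ (lam = 0 /\ mu = 0)) (hr : 0 < r)
  (hsq : forall i, open_square r (Om i))
  (hcover : \bigcup_i Om i = setT)
  (hmult : forall (p : R * R) (s : seq nat),
      uniq s -> (forall i, i \in s -> Om i p) -> (size s <= 3)%N) :
  exists C : R, forall u : R * R -> R, inX u ->
    (\sum_(0 <= i <oo) XOmnorm2 lam mu (Om i) u <= C%:E * Xnorm2 lam mu u)%E.
Proof.
have /choice[a /choice[b OmE]] := hsq.
have [K [K0 /choice[c /choice[d cut]]]] := cutoff_exists hr.
have sq3 (p : R * R) (s : seq nat) : uniq s ->
    (forall i, i \in s -> (a i < p.1 < a i + r) && (b i < p.2 < b i + r)) -> (size s <= 3)%N.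
  move=> us sp; apply: (hmult p s us) => i /sp /andP[h1 h2].
  by rewrite OmE.
pose Lc := loc_cst r K.
have Lc0 : 0 <= Lc by exact: loc_cst_ge0.
(* The + 1 makes [C] positive, so that it can be divided out below. *)
pose C := Lc * (4 + lam + mu) + 1.
have C0 : 0 < C by rewrite /C ltr_wpDl// mulr_ge0// !addr_ge0.
exists C => u uX; have [uL2 [Fr0 [Fi0 [uF0 S1oo S2oo]]]] := uX.
have [mu_ _] := uL2.
pose v := good_slices u.
have vL2 : L2 v by exact: L2_good. have vs : sliceL2 v by exact: sliceL2_good.
have [mv _] := vL2.
have uv : {ae (@leb2 R), forall p, u p = v p} by exact: ae_good_slices.
pose g i := loc (a i) r (c (a i)) (d (a i)) (c (b i)) v.
have cg i : cl2 (g i) by exact: (cl2_loc hr K0 (cut (a i)) (cut (b i))).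
have mg i : measurable_fun setT (g i) by case: (cg i).
pose sq i (p : R * R) := (a i < p.1 < a i + r) && (b i < p.2 < b i + r).
have msq i : measurable_fun setT (sq i) by rewrite /sq; mea.
(* Restriction means equality at every point, but [g i] equals [u] on the square only where [v]
   does. Restoring [u] there changes [g i] on a null set and keeps its transform. *)
pose gf i p := if sq i p then u p else g i p.
have mgf i : measurable_fun setT (gf i) by have := msq i => ?; have := mg i => ?; rewrite /gf; mea.
have gfE i : {ae (@leb2 R), forall p, g i p = gf i p}.
  have := @ae_leb2_filter R => ?; apply: filterS uv => p up; rewrite /gf; case: ifPn => // /andP[/andP[p1 p2] /andP[p3 p4]].
  by rewrite up /g (loc_in (cut (a i)) (cut (b i)))// ?(ltW p1) ?(ltW p2) ?(ltW p3) ?(ltW p4).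
have gF i : is_FT (gf i) (FTre (g i)) (FTim (g i)).
  by apply: (is_FT_ae (mg i) (mgf i) (gfE i)); exact: is_FT_cl2.
have gL2 i : L2 (gf i).
  split; first exact: mgf.
  by rewrite -/(N2 (gf i)) -(N2_ae (mg i) (mgf i) (gfE i)); case: (cg i).
have vF Fr Fi : is_FT u Fr Fi -> is_FT v Fr Fi by exact: is_FT_ae.
have est1 N Fr Fi (uF : is_FT u Fr Fi) := sum_abs_ft2_le hr K0 (fun i => cut (a i)) (fun i => cut (b i)) sq3 vL2 vs (vF _ _ uF) N.
have est2 N Fr Fi (uF : is_FT u Fr Fi) := sum_eta2_abs_ft2_le hr K0 (fun i => cut (a i)) (fun i => cut (b i)) sq3 vL2 vs (vF _ _ uF) N.
have est0 N Fr Fi (uF : is_FT u Fr Fi) := sum_ft2_le hr K0 (fun i => cut (a i)) (fun i => cut (b i)) sq3 vL2 vs (vF _ _ uF) N.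
have est3 N Fr Fi (uF : is_FT u Fr Fi) := sum_eta2_sqr_ft2_le hr K0 (fun i => cut (a i)) (fun i => cut (b i)) sq3 vL2 vs (vF _ _ uF) N.
have S0oo : (\int[@leb2 R]_k (FTsq Fr0 Fi0 k)%:E < +oo)%E.
  exact: int_FTsq_fin uF0.
have term (X : nat -> \bar R) i : (forall j, (0 <= X j)%E) -> (X i <= \sum_(0 <= j < i.+1) X j)%E.
  by move=> X0; rewrite big_nat_recr//= leeDr//; apply: sume_ge0 => j _.
(* One term is at most the partial sum up to it, and that sum is finite because the transform [Fr0],
   [Fi0] witnesses membership of [u]. *)
have gX i : inX (gf i).
  split; first exact: gL2.
  exists (FTre (g i)), (FTim (g i)); split; first exact: gF.
  - pose X j := (\int[@leb2 R]_k (`|k.1| * ft2 (g j) k)%:E)%E.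
    have X0 j : (0 <= X j)%E by apply: int_ge0 => k; rewrite mulr_ge0 ?ft2_ge0.
    apply: (le_lt_trans (term X i X0)); apply: (le_lt_trans (est1 i.+1 _ _ uF0)).
    by rewrite lte_mul_pinfty ?lee_fin// lte_add_pinfty.
  - pose X j := (\int[@leb2 R]_k (k.2 ^+ 2 / `|k.1| * ft2 (g j) k)%:E)%E.
    have X0 j : (0 <= X j)%E.
      by apply: int_ge0 => k; rewrite mulr_ge0 ?ft2_ge0// divr_ge0 ?sqr_ge0.
    apply: (le_lt_trans (term X i X0)); apply: (le_lt_trans (est2 i.+1 _ _ uF0)).
    by rewrite lte_mul_pinfty ?lee_fin// lte_add_pinfty.
have gle i : (XOmnorm2 lam mu (Om i) u <= ((2 * pi) ^- 2)%:E *
    \int[@leb2 R]_k (ft2 (g i) k * Xweight lam mu k)%:E)%E.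
  apply: (@le_trans _ _ (Xnorm2 lam mu (gf i))).
    apply: ereal_inf_lbound; exists (gf i); last by [].
    split; first exact: gX.
    by move=> p; rewrite OmE /gf /sq => -[-> ->].
  apply: ereal_inf_lbound; exists (FTre (g i)), (FTim (g i)).
  by split; [exact: gF|rewrite /ft2].
have XO0 i : (0 <= XOmnorm2 lam mu (Om i) u)%E.
  by apply: le_ereal_inf_tmp => _ [w _ <-]; exact: Xnorm2_ge0.
(* The norm of [u] is an infimum over its transforms; with [C] divided out the bound is checked for
   each transform, and for the series through partial sums. *)
rewrite -lee_pdivrMl//; apply: le_ereal_inf_tmp => _ [Fr [Fi [uF ->]]].
rewrite lee_pdivrMl//; apply: lime_le; first by apply: is_cvg_nneseries => i _ _; exact: XO0.
apply: nearW => N.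
have mS := is_FT_meas uF; have S0 := FTsq_ge0 Fr Fi.
have m2 i := measurable_ft2 (mg i).
have w1 (f : R * R -> R) : (forall k, 0 <= f k) -> (0 <= \int[@leb2 R]_k (`|k.1| * f k)%:E)%E.
  by move=> f0; apply: int_ge0 => k; rewrite mulr_ge0.
have w2 (f : R * R -> R) : (forall k, 0 <= f k) -> (0 <= \int[@leb2 R]_k (k.2 ^+ 2 / `|k.1| * f k)%:E)%E.
  by move=> f0; apply: int_ge0 => k; rewrite mulr_ge0// divr_ge0 ?sqr_ge0.
have w3 (f : R * R -> R) : (forall k, 0 <= f k) -> (0 <= \int[@leb2 R]_k (k.2 ^+ 2 / k.1 ^+ 2 * f k)%:E)%E.
  by move=> f0; apply: int_ge0 => k; rewrite mulr_ge0// divr_ge0 ?sqr_ge0.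
have f0 i k : 0 <= ft2 (g i) k by exact: ft2_ge0.
have p0 : 0 <= (2 * pi) ^- 2 :> R by rewrite invr_ge0 sqr_ge0.
have T0 := int_ge0 (@leb2 R) S0; have T1 := w1 _ S0; have T2 := w2 _ S0; have T3 := w3 _ S0.
have X i : (\int[@leb2 R]_k (ft2 (g i) k * Xweight lam mu k)%:E <=
    1%:E * (1%:E * \int[@leb2 R]_k (ft2 (g i) k)%:E +
    1%:E * \int[@leb2 R]_k (`|k.1| * ft2 (g i) k)%:E +
    lam%:E * \int[@leb2 R]_k (k.2 ^+ 2 / `|k.1| * ft2 (g i) k)%:E +
    mu%:E * \int[@leb2 R]_k (k.2 ^+ 2 / k.1 ^+ 2 * ft2 (g i) k)%:E))%E.
  by rewrite mul1e -(int_Xweight hlam hmu (m2 i) (f0 i)).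
have sumX := sum_lin4 ler01 Lc0 ler01 ler01 hlam hmu (fun i => int_ge0 (@leb2 R) (f0 i))
  (fun i => w1 _ (f0 i)) (fun i => w2 _ (f0 i)) (fun i => w3 _ (f0 i))
  T0 (adde_ge0 T0 T1) (adde_ge0 T0 T2) (adde_ge0 T0 T3)
  (est0 N _ _ uF) (est1 N _ _ uF) (est2 N _ _ uF) (est3 N _ _ uF) X.
apply: (@le_trans _ _ (\sum_(0 <= i < N) ((2 * pi) ^- 2)%:E *
    \int[@leb2 R]_k (ft2 (g i) k * Xweight lam mu k)%:E)%E).
  by apply: lee_sum => i _; exact: gle.
have FX0 i : (0 <= \int[@leb2 R]_k (ft2 (g i) k * Xweight lam mu k)%:E)%E.
  by apply: int_ge0 => k; rewrite mulr_ge0 ?Xweight_ge0.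
rewrite -ge0_sume_distrr// muleCA; apply: lee_wpmul2l; first by rewrite lee_fin.
apply: (le_trans sumX); rewrite mul1r (int_Xweight hlam hmu mS S0).
rewrite !mul1e; exact: (weighted_sum_le hlam hmu Lc0 T0 T1 T2 T3).
Qed.
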